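(* For every $r\in\mathbb{N}$ (with $d=d(r)\in\mathbb{N}$) let $(\xi_{k\ell})_{1\le k<\ell\le r}$ be i.i.d. copies of a $0/1$ random variable $\xi=\xi_r$ with $\mathbf{P}(\xi=1)=p_r\in(0,1]$. Let $(\mathbf{v}^{k\ell})_{1\le k<\ell\le r}$ be mutually independent random vectors in $\mathbb{R}^d$, independent of $(\xi_{k\ell})_{k<\ell}$, which are normalized and isotropic, $\mathbf{E}\,\mathbf{v}^{k\ell}\mathbf{v}^{k\ell\,T}=d^{-1}I_d$, have norms uniformly bounded in $r$ (there is $C_0>0$ with $\|\mathbf{v}^{k\ell}\|_2^2\le C_0$ for all $r$ and $k<\ell$), and are such that for all deterministic $d\times d$ matrices $D=D_d$ with $\|D\|_{op}=1$, $$\sup_{k<\ell}\mathbf{Var}(D\mathbf{v}^{k\ell},\mathbf{v}^{k\ell})=o(1),\quad d\to\infty.$$ Let $\mathcal{A}_{rd}$ be the $rd\times rd$ block matrix defined in the context. Suppose that $$d\to\infty\quad\text{and}\quad rp_r/d\to c\ge0\quad\text{as } r\to\infty.$$ Then, as $r\to\infty$, the empirical spectral distributions $N_{\mathcal{A}_{rd}}$ converge in probability to a non-random probability measure $N_{\mathcal{A}}$ whose Stieltjes transform $f_{\mathcal{A}}$ is uniquely determined by the equation $$zf_{\mathcal{A}}^3+(1-c)f_{\mathcal{A}}^2-zf_{\mathcal{A}}-1=0$$ in the class of Stieltjes transforms of non-negative measures.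
   Context: For $1\le k<\ell\le r$ put $B_{k\ell}=\xi_{k\ell}\mathbf{v}^{k\ell}\mathbf{v}^{k\ell\,T}$ (a $d\times d$ matrix) and $B_{\ell k}=B_{k\ell}$. Define the $rd\times rd$ block matrix, with $d\times d$ blocks, $$\mathcal{A}_{rd}=\big((1-\delta_{k\ell})B_{k\ell}\big)_{k,\ell=1}^r.$$ For a real symmetric $n\times n$ matrix $M$ with eigenvalues $(\lambda_i)_i$, its empirical spectral distribution is $N_M(\Delta)=|\{i:\lambda_i\in\Delta\}|/n$, $\Delta\subset\mathbb{R}$; convergence in probability of random measures is with respect to the weak topology. The Stieltjes transform of a non-negative measure $N$ is $\int\frac{N(d\lambda)}{\lambda-z}$, $\Im z\neq0$. $\|\cdot\|_{op}$ is the operator norm, $\|\cdot\|_2$ the Euclidean norm and $(\cdot,\cdot)$ the Euclidean inner product. *)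

(* Defs.v *)
From HB Require Import structures.
From mathcomp Require Import all_boot all_order all_algebra.
From mathcomp Require Import polyrcf complex.
From mathcomp Require Import all_classical all_reals all_analysis.
Set Implicit Arguments.
Unset Strict Implicit.
Unset Printing Implicit Defensive.
Import Order.TTheory GRing.Theory Num.Theory.
Import numFieldNormedType.Exports.
Local Open Scope classical_set_scope.
Local Open Scope ring_scope.

Definition dotv (R : realType) (n : nat) (u w : 'cV[R]_n) : R :=
  \sum_(i < n) u i ord0 * w i ord0.

Definition norm2 (R : realType) (n : nat) (u : 'cV[R]_n) : R :=
  Num.sqrt (dotv u u).

Definition opnorm (R : realType) (n : nat) (D : 'M[R]_n) : R :=
  sup [set norm2 (D *m x) | x in [set x : 'cV[R]_n | norm2 x <= 1]].

(* [rootsR] lists each root once; every root is repeated here according to its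
   multiplicity in the characteristic polynomial. *)
Definition eigvals (R : realType) (n : nat) (M : 'M[R]_n) : seq R :=
  flatten [seq nseq (mup x (char_poly M)) x | x <- rootsR (char_poly M)].

Lemma invn_ge0 (R : realType) (n : nat) : 0 <= (n%:R^-1 : R).
Proof. by rewrite invr_ge0 ler0n. Qed.

Definition esd (R : realType) (n : nat) (M : 'M[R]_n) :
    {measure set R -> \bar R} :=
  mscale (NngNum (invn_ge0 R n))
    (msum (fun i => dirac (nth 0 (eigvals M) i))
          (size (eigvals M))).

Lemma esdE (R : realType) (n : nat) (M : 'M[R]_n) (Delta : set R) :
  esd M Delta =
    ((count (fun x => x \in Delta) (eigvals M))%:R / n%:R)%:E.
Proof.
rewrite /esd /mscale /msum /= mulrC EFinM; congr (_ * _)%E.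
set s := eigvals M.
rewrite -sum1_count big_mkcond /= (big_nth 0) big_mkord natr_sum -sumEFin.
by apply: eq_bigr => i _; rewrite [LHS](@diracE _ _ R); case: (_ \in _).
Qed.

Section independence.
Local Open Scope ereal_scope.
Context (disp : measure_display) (T : measurableType disp) (R : realType).

(* sigma-algebra generated by the real random variables X i, i in J *)
Definition sigma_gen (I : Type) (J : set I) (X : I -> T -> R) : set (set T) :=
  <<s \bigcup_(i in J)
        preimage_set_system setT (X i) measurable >>.

Definition mutually_independent (P : probability T R) (I : finType)
    (J : {set I}) (F : I -> set (set T)) : Prop :=
  forall (K : {set I}) (A : I -> set T), K \subset J ->
    (forall i, i \in K -> F i (A i)) ->
    P (\bigcap_(i in [set` K]) A i) = (\prod_(i in K) fine (P (A i)))%:E.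

Definition independent2 (P : probability T R) (F G : set (set T)) : Prop :=
  forall A B, F A -> G B -> P (A `&` B) = P A * P B.

End independence.

(* [bblock] is only given data (xi k l, v k l) for k < l and is extended to
   k > l by symmetry; its value for k = l is irrelevant. *)
Definition bblock (R : realType) (r d : nat) (xi : 'I_r -> 'I_r -> R)
    (v : 'I_r -> 'I_r -> 'cV[R]_d) (k l : 'I_r) : 'M[R]_d :=
  let b i j := xi i j *: (v i j *m (v i j)^T) in
  if (k < l)%N then b k l else b l k.

Definition Amx (R : realType) (r d : nat) (xi : 'I_r -> 'I_r -> R)
    (v : 'I_r -> 'I_r -> 'cV[R]_d) : 'M[R]_(\sum_(k < r) d) :=
  \mxblock_(k < r, l < r) ((1 - (k == l)%:R) *: bblock xi v k l).

(* basic neighbourhoods of nu for the weak topology *)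
Definition weak_nbhd (R : realType)
    (nu : {measure set R -> \bar R})
    (m : nat) (f : 'I_m -> R -> R) (eps : R) :
    set {measure set R -> \bar R} :=
  [set mu | forall j : 'I_m,
    `|Rintegral mu setT (f j) - Rintegral nu setT (f j)| < eps].

(* The random measures mu r may live on different probability spaces. *)
Definition cvg_in_probability_weakly (R : realType)
    (disp : nat -> measure_display) (T : forall r, measurableType (disp r))
    (P : forall r, probability (T r) R)
    (mu : forall r, T r -> {measure set R -> \bar R})
    (nu : {measure set R -> \bar R}) : Prop :=
  forall (m : nat) (f : 'I_m -> R -> R) (eps : R),
    (forall j, continuous (f j)) ->
    (forall j, exists C : R, forall x, `|f j x| <= C) ->
    0 < eps ->
    P r [set w | ~ weak_nbhd nu f eps (mu r w)] @[r --> \oo] --> 0%E.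

Section stieltjes.
Local Open Scope complex_scope.
Context (R : realType).
Implicit Type mu : {measure set R -> \bar R}.

Definition stieltjes_kernel (z : R[i]) (x : R) : R[i] := (x%:C - z)^-1.

Definition has_stieltjes mu : Prop :=
  forall z : R[i], complex.Im z != 0 ->
    mu.-integrable setT (fun x => (complex.Re (stieltjes_kernel z x))%:E) /\
    mu.-integrable setT (fun x => (complex.Im (stieltjes_kernel z x))%:E).

Definition stieltjes mu (z : R[i]) : R[i] :=
  Rintegral mu setT (fun x => complex.Re (stieltjes_kernel z x)) +i*
  Rintegral mu setT (fun x => complex.Im (stieltjes_kernel z x)).

Definition satisfies_cubic (c : R) (f : R[i] -> R[i]) : Prop :=
  forall z : R[i], complex.Im z != 0 ->
    z * f z ^+ 3 + (1 - c%:C) * f z ^+ 2 - z * f z - 1 = 0.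

End stieltjes.

(* Main.v *)
(** For Im z large, let g_k be the normalized trace of the diagonal block G_kk of
    the resolvent G = (A - z)^-1. The row equation reads
    z g_k = -1 + d^-1 sum_l xi_kl (v_kl, G_lk v_kl). Removing the edge kl is a
    rank-two perturbation, and the blocks of the cut resolvent are independent of
    xi_kl and v_kl, so that their quadratic forms in v_kl concentrate around
    normalized traces; this gives (v_kl, G_lk v_kl) ~ - psi(F), with
    psi(F) = F^2 / (1 - F^2), as soon as g_k and g_l are close to F. Choosing for
    F the small root of the cubic, i.e. z F = -1 - c psi(F), turns the row equation
    into a contraction for the average of E |g_k - F|, which therefore tends to 0.

    An ultrafilter version of Helly's theorem provides a probability measure N
    whose Stieltjes transform is F for Im z large; expanding it in Taylor series
    at points of large imaginary part extends the cubic equation to the whole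
    upper half-plane, where a root of positive imaginary part is unique.

    Finally, convergence of the Stieltjes transforms for Im z large propagates to
    all z by Newton interpolation, hence to Poisson kernels, to compactly supported
    continuous functions, and to bounded continuous functions. *)
Require Import Defs.
From HB Require Import structures.
From mathcomp Require Import all_boot all_order all_algebra.
From mathcomp Require Import polyrcf complex.
From mathcomp Require Import all_classical all_reals all_analysis.
From mathcomp Require Import measurable_realfun.
From mathcomp Require Import ring lra.
Set Implicit Arguments.
Unset Strict Implicit.
Unset Printing Implicit Defensive.
Import Order.TTheory GRing.Theory Num.Theory.
Import numFieldNormedType.Exports.
Import ComplexField.Normc.
Local Open Scope classical_set_scope.
Local Open Scope ring_scope.
Local Notation Re := (@complex.Re _).
Local Notation Im := (@complex.Im _).
Local Notation "x %:C" := (real_complex _ x) (format "x %:C") : ring_scope.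

(** * Complex numbers and resolvents *)

(** The local law is therefore a direct estimate against a number [F] that is not yet known to be a
    value of a Stieltjes transform; this is learned only from the limit measure. Two mismatches
    shape the probabilistic part. The variance condition concerns one deterministic sequence of
    matrices, but it is applied to random resolvent blocks: it is first made uniform over all
    matrices of norm one, then averaged over an independent random matrix. And [xi], [v] are
    controlled only almost surely, while the estimates are pointwise: they are replaced by
    truncations that agree with them almost surely. Eigenvalues are never treated as random
    variables. Measurability comes from resolvent entries, which are rational in the matrix entries,
    and reaches other test functions by approximation. *)

Section normc_facts.
Variable R : realType.
Implicit Types z w : R[i].

Lemma ReM z w : Re (z * w) = Re z * Re w - Im z * Im w.
Proof. by case: z w => [a b] [c d]. Qed.

Lemma ImM z w : Im (z * w) = Re z * Im w + Im z * Re w.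
Proof. by case: z w => [a b] [c d]. Qed.

Lemma ReD z w : Re (z + w) = Re z + Re w. Proof. by case: z w => [? ?] []. Qed.
Lemma ImD z w : Im (z + w) = Im z + Im w. Proof. by case: z w => [? ?] []. Qed.
Lemma ReN z : Re (- z) = - Re z. Proof. by case: z. Qed.
Lemma ImN z : Im (- z) = - Im z. Proof. by case: z. Qed.
Lemma ReB z w : Re (z - w) = Re z - Re w. Proof. by rewrite ReD ReN. Qed.
Lemma ImB z w : Im (z - w) = Im z - Im w. Proof. by rewrite ImD ImN. Qed.

Lemma Re_sum (I : Type) (s : seq I) (Q : pred I) (f : I -> R[i]) :
  Re (\sum_(i <- s | Q i) f i) = \sum_(i <- s | Q i) Re (f i).
Proof. by elim/big_rec2: _ => // i y1 y2 _ <-; rewrite ReD. Qed.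

Lemma Im_sum (I : Type) (s : seq I) (Q : pred I) (f : I -> R[i]) :
  Im (\sum_(i <- s | Q i) f i) = \sum_(i <- s | Q i) Im (f i).
Proof. by elim/big_rec2: _ => // i y1 y2 _ <-; rewrite ImD. Qed.

Lemma sqr_normc_ReIm z : normc z ^+ 2 = Re z ^+ 2 + Im z ^+ 2.
Proof. by case: z => a b; rewrite /normc sqr_sqrtr// addr_ge0 ?sqr_ge0. Qed.

Lemma normc_ge0 z : 0 <= normc z.
Proof. by case: z => a b; rewrite /normc sqrtr_ge0. Qed.

Lemma normc_real (x : R) : normc x%:C = `|x|.
Proof. by rewrite /normc /= expr0n /= addr0 sqrtr_sqr. Qed.

Lemma normcX z n : normc (z ^+ n) = normc z ^+ n.
Proof. by elim: n => [|n IH]; rewrite ?normc1 // !exprS normcM IH. Qed.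

Lemma normcB z w : normc (z - w) = normc (w - z).
Proof. by rewrite -normcN opprB. Qed.

Lemma normc_le_sub z w : normc z - normc w <= normc (z - w).
Proof. by rewrite lerBlDr (le_trans _ (le_normcD _ _))// subrK. Qed.

Lemma le_normc_sum (I : Type) (s : seq I) (Q : pred I) (f : I -> R[i]) :
  normc (\sum_(i <- s | Q i) f i) <= \sum_(i <- s | Q i) normc (f i).
Proof.
elim/big_rec2: _ => [|i y1 y2 _ le12]; first by rewrite normc0.
by rewrite (le_trans (le_normcD _ _))// lerD2l.
Qed.

Lemma Re_le_normc z : `|Re z| <= normc z.
Proof.
rewrite -(@ler_pXn2r _ 2) ?nnegrE ?normr_ge0 ?normc_ge0// sqr_normc_ReIm.
by rewrite real_normK ?num_real// lerDl sqr_ge0.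
Qed.

Lemma Im_le_normc z : `|Im z| <= normc z.
Proof.
rewrite -(@ler_pXn2r _ 2) ?nnegrE ?normr_ge0 ?normc_ge0// sqr_normc_ReIm.
by rewrite real_normK ?num_real// lerDr sqr_ge0.
Qed.

Lemma normc_le_ReIm z : normc z <= `|Re z| + `|Im z|.
Proof.
rewrite -(@ler_pXn2r _ 2) ?nnegrE ?addr_ge0 ?normc_ge0// sqr_normc_ReIm.
by rewrite sqrrD !real_normK ?num_real// addrAC lerDl mulrn_wge0// mulr_ge0.

Qed.

Lemma normc_eq0 z : (normc z == 0) = (z == 0).
Proof. by apply/eqP/eqP => [/eq0_normc//|->]; rewrite normc0. Qed.

Lemma complex_eqP z w : Re z = Re w -> Im z = Im w -> z = w.
Proof. by case: z w => [a b] [c d] /= -> ->. Qed.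

Lemma ReZ (a : R) z : Re (a%:C * z) = a * Re z.
Proof. by rewrite ReM /= mul0r subr0. Qed.

Lemma ImZ (a : R) z : Im (a%:C * z) = a * Im z.
Proof. by rewrite ImM /= mul0r addr0. Qed.

(** Lagrange's identity: the double sum of the squares of [a i * b j - a j * b i] is twice the
    difference of the two sides. *)
Lemma sum_sqr_le (n : nat) (a b : 'I_n -> R) :
  (\sum_i a i * b i) ^+ 2 <= (\sum_i a i ^+ 2) * (\sum_i b i ^+ 2).
Proof.
have : 0 <= \sum_i \sum_j (a i * b j - a j * b i) ^+ 2.
  by apply: sumr_ge0 => i _; apply: sumr_ge0 => j _; apply: sqr_ge0.
have -> : \sum_i \sum_j (a i * b j - a j * b i) ^+ 2 =
  ((\sum_i a i ^+ 2) * (\sum_i b i ^+ 2)) *+ 2 - ((\sum_i a i * b i) ^+ 2) *+ 2.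
  transitivity (\sum_i \sum_j (a i ^+ 2 * b j ^+ 2 + a j ^+ 2 * b i ^+ 2
     - (a i * b i * (a j * b j)) *+ 2)).
    by apply: eq_bigr => i _; apply: eq_bigr => j _; ring.
  under eq_bigr do rewrite sumrB big_split /=.
  rewrite sumrB big_split /=.
  have -> : \sum_i \sum_j a i ^+ 2 * b j ^+ 2 =
    (\sum_i a i ^+ 2) * \sum_i b i ^+ 2 by rewrite big_distrlr.
  have -> : \sum_i \sum_j a j ^+ 2 * b i ^+ 2 =
    (\sum_i a i ^+ 2) * \sum_i b i ^+ 2 by rewrite exchange_big big_distrlr.
  rewrite -mulr2n; congr (_ - _).
  under eq_bigr do rewrite sumrMnl.
  by rewrite sumrMnl expr2 big_distrlr.
by rewrite subr_ge0 lerMn2r.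
Qed.

End normc_facts.

(** * Frobenius norms of complex matrices *)

Section frobenius.
Variable R : realType.

(** Squared Frobenius norm. A bound on the operator norm of a complex matrix is expressed below by
    comparing [sqn (G *m X)] with [sqn X] for every [X]. *)
Definition sqn m n (A : 'M[R[i]]_(m, n)) : R := \sum_i \sum_j normc (A i j) ^+ 2.

Definition frdot m n (A B : 'M[R]_(m, n)) : R := \tr (A^T *m B).

Lemma frdotE m n (A B : 'M[R]_(m, n)) : frdot A B = \sum_i \sum_j A i j * B i j.
Proof.
rewrite /frdot /mxtrace exchange_big; apply: eq_bigr => i _ /=.
by rewrite mxE; apply: eq_bigr => j _; rewrite mxE.
Qed.

Lemma frdotC m n (A B : 'M[R]_(m, n)) : frdot A B = frdot B A.
Proof. by rewrite /frdot -mxtrace_tr trmx_mul trmxK. Qed.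

Lemma frdotDl m n (A B D : 'M[R]_(m, n)) : frdot (A + B) D = frdot A D + frdot B D.
Proof. by rewrite /frdot raddfD mulmxDl raddfD. Qed.

Lemma frdotZl m n (a : R) (A B : 'M[R]_(m, n)) : frdot (a *: A) B = a * frdot A B.
Proof. by rewrite /frdot linearZ /= -scalemxAl linearZ. Qed.

Lemma frdot_ge0 m n (A : 'M[R]_(m, n)) : 0 <= frdot A A.
Proof.
rewrite frdotE; apply: sumr_ge0 => i _; apply: sumr_ge0 => j _.
by rewrite -expr2 sqr_ge0.
Qed.

Lemma sqn_ReIm m n (A : 'M[R[i]]_(m, n)) :
  sqn A = frdot (map_mx Re A) (map_mx Re A) + frdot (map_mx Im A) (map_mx Im A).
Proof.
rewrite !frdotE -big_split; apply: eq_bigr => i _ /=.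
by rewrite -big_split; apply: eq_bigr => j _ /=; rewrite !mxE sqr_normc_ReIm.
Qed.

Lemma sqn_ge0 m n (A : 'M[R[i]]_(m, n)) : 0 <= sqn A.
Proof. by apply: sumr_ge0 => i _; apply: sumr_ge0 => j _; apply: sqr_ge0. Qed.

Lemma sqn_eq0 m n (A : 'M[R[i]]_(m, n)) : sqn A = 0 -> A = 0.
Proof.
move=> A0; apply/matrixP => i j; rewrite mxE; apply/eqP.
rewrite -normc_eq0 -sqrf_eq0.
have := A0 => /eqP; rewrite psumr_eq0 => [/allP/(_ i)|]; last first.
  by move=> k _; apply: sumr_ge0 => l _; apply: sqr_ge0.
rewrite mem_index_enum => /(_ isT) /=.
rewrite psumr_eq0 => [/allP/(_ j)|]; last by move=> l _; apply: sqr_ge0.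
by rewrite mem_index_enum => /(_ isT).
Qed.

Lemma sqn_tr m n (A : 'M[R[i]]_(m, n)) : sqn A^T = sqn A.
Proof.
rewrite /sqn exchange_big; apply: eq_bigr => i _.
by apply: eq_bigr => j _; rewrite mxE.
Qed.

Lemma entry_le_sqn m n (A : 'M[R[i]]_(m, n)) i j : normc (A i j) ^+ 2 <= sqn A.
Proof.
rewrite /sqn (bigD1 i)//= (bigD1 j)//= -addrA lerDl addr_ge0//.
  by apply: sumr_ge0 => ? _; apply: sqr_ge0.
by apply: sumr_ge0 => ? _; apply: sumr_ge0 => ? _; apply: sqr_ge0.
Qed.

Lemma dot_le_sqn n (u w : 'cV[R[i]]_n) :
  normc ((u^T *m w) 0 0) ^+ 2 <= sqn u * sqn w.
Proof.
rewrite mxE; set S := \sum_(j < n) _.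
have : normc S <= \sum_j normc (u j 0) * normc (w j 0).
  apply: le_trans (le_normc_sum _ _ _) _.
  by apply: ler_sum => j _; rewrite mxE normcM.
move=> leS; apply: (@le_trans _ _ ((\sum_j normc (u j 0) * normc (w j 0)) ^+ 2)).
  by rewrite ler_pXn2r ?nnegrE ?normc_ge0// (le_trans (normc_ge0 _) leS).
apply: le_trans (sum_sqr_le _ _) _.
rewrite /sqn; under [X in _ <= X * _]eq_bigr do rewrite big_ord1.
by under [X in _ <= _ * X]eq_bigr do rewrite big_ord1.
Qed.

Lemma trace_le_sqn n (A : 'M[R[i]]_n) : normc (\tr A) ^+ 2 <= n%:R * sqn A.
Proof.
have leS : normc (\tr A) <= \sum_i 1 * normc (A i i).
  by under eq_bigr do rewrite mul1r; apply: le_normc_sum.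
apply: (@le_trans _ _ ((\sum_i 1 * normc (A i i)) ^+ 2)).
  by rewrite ler_pXn2r ?nnegrE ?normc_ge0// (le_trans (normc_ge0 _) leS).
apply: le_trans (sum_sqr_le _ _) _.
under eq_bigr do rewrite expr1n.
rewrite sumr_const card_ord ler_wpM2l//; apply: ler_sum => i _.
by rewrite (bigD1 i)//= lerDl; apply: sumr_ge0 => ? _; apply: sqr_ge0.
Qed.

Lemma sqn_isometry m n p (E : 'M[R]_(m, n)) (A : 'M[R[i]]_(n, p)) :
  E^T *m E = 1%:M -> sqn (map_mx (real_complex R) E *m A) = sqn A.
Proof.
move=> EE; rewrite !sqn_ReIm.
have -> : map_mx Re (map_mx (real_complex R) E *m A) = E *m map_mx Re A.
  apply/matrixP => i j; rewrite !mxE Re_sum; apply: eq_bigr => k _.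
  by rewrite !mxE ReZ.
have -> : map_mx Im (map_mx (real_complex R) E *m A) = E *m map_mx Im A.
  apply/matrixP => i j; rewrite !mxE Im_sum; apply: eq_bigr => k _.
  by rewrite !mxE ImZ.
by rewrite /frdot !trmx_mul !mulmxA -!(mulmxA _ E^T) EE !mulmx1.
Qed.

Lemma sqn_real n (u : 'cV[R]_n) : sqn (map_mx (real_complex R) u) = dotv u u.
Proof.
rewrite /sqn /dotv; apply: eq_bigr => i _.
by rewrite big_ord1 mxE normc_real real_normK ?num_real// expr2.
Qed.

End frobenius.

Section resolvent.
Variable R : realType.
Local Notation toC := (real_complex R).

Definition resolvent n (M : 'M[R]_n) (z : R[i]) : 'M[R[i]]_n :=
  invmx (map_mx toC M - z%:M).

Variables (n : nat) (M : 'M[R]_n) (z : R[i]).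
Hypotheses (symM : M^T = M) (Imz : 0 < Im z).

(** Symmetry of [N = M - Re z] cancels the cross terms, so the right side equals the left side plus
    the squared norms of [N *m P] and [N *m Q]. This gives both invertibility of [M - z] and the
    bound [1 / Im z] on the resolvent, without diagonalization. *)
Lemma sqn_shift_ge m (X : 'M[R[i]]_(n, m)) :
  Im z ^+ 2 * sqn X <= sqn ((map_mx toC M - z%:M) *m X).
Proof.
rewrite !sqn_ReIm; set P := map_mx Re X; set Q := map_mx Im X.
set N := M - (Re z)%:M.
have -> : map_mx Re ((map_mx toC M - z%:M) *m X) = N *m P + Im z *: Q.
  rewrite !mulmxBl !mul_scalar_mx; apply/matrixP => i j.
  rewrite !mxE !ReB !ReM Re_sum.
  under eq_bigr do rewrite !mxE ReZ.
  under [in RHS]eq_bigr do rewrite !mxE.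
  by ring.
have -> : map_mx Im ((map_mx toC M - z%:M) *m X) = N *m Q + (- Im z) *: P.
  rewrite !mulmxBl !mul_scalar_mx; apply/matrixP => i j.
  rewrite !mxE !ImB !ImM Im_sum.
  under eq_bigr do rewrite !mxE ImZ.
  under [in RHS]eq_bigr do rewrite !mxE.
  by ring.
have symN : N^T = N by rewrite /N linearB /= symM tr_scalar_mx.
have NPQ : frdot (N *m P) Q = frdot (N *m Q) P.
  by rewrite [RHS]frdotC /frdot trmx_mul symN mulmxA.
rewrite !(frdotDl, frdotZl) ![frdot _ (_ + _)]frdotC.
rewrite !(frdotDl, frdotZl).
rewrite (frdotC Q (N *m P)) (frdotC P (N *m Q)) NPQ.
have := frdot_ge0 (N *m P); have := frdot_ge0 (N *m Q).
set a := frdot (N *m P) _; set b := frdot (N *m Q) (N *m Q).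
set e := frdot (N *m Q) P; set f := frdot P P; set g := frdot Q Q.
by move=> *; rewrite -subr_ge0 (_ : _ - _ = a + b) ?addr_ge0//; ring.
Qed.

Lemma shift_unit : map_mx toC M - z%:M \in unitmx.
Proof.
rewrite -unitmx_tr -row_free_unit -kermx_eq0; apply/eqP.
apply: trmx_inj; rewrite trmx0; apply: sqn_eq0; apply/eqP; rewrite eq_le sqn_ge0 andbT.
have := sqn_shift_ge (kermx (map_mx toC M - z%:M)^T)^T.
rewrite -[X in X *m _]trmxK -trmx_mul mulmx_ker.
have -> : sqn ((0 : 'M[R[i]]_n)^T) = 0.
  rewrite /sqn big1// => i _; rewrite big1// => j _.
  by rewrite !mxE normc0 expr0n.
by rewrite pmulr_rle0 // exprn_gt0.
Qed.

Lemma resolventK : resolvent M z *m (map_mx toC M - z%:M) = 1%:M.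
Proof. by rewrite mulVmx ?shift_unit. Qed.

Lemma resolventVK : (map_mx toC M - z%:M) *m resolvent M z = 1%:M.
Proof. by rewrite mulmxV ?shift_unit. Qed.

Lemma sqn_resolvent m (X : 'M[R[i]]_(n, m)) :
  sqn (resolvent M z *m X) <= sqn X / Im z ^+ 2.
Proof.
rewrite ler_pdivlMr ?exprn_gt0// mulrC.
by apply: le_trans (sqn_shift_ge _) _; rewrite mulmxA resolventVK mul1mx.
Qed.

Lemma tr_resolvent : (resolvent M z)^T = resolvent M z.
Proof. by rewrite /resolvent trmx_inv linearB /= map_trmx symM tr_scalar_mx. Qed.

End resolvent.

(** * Rank-two perturbations *)

Section bilinear.
Variable R : realType.
Local Notation toC := (real_complex R).

(** No conjugation: the vectors are real, and the resolvent of a real symmetric matrix is symmetric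
    but not Hermitian. *)
Definition bil n (x : 'cV[R]_n) (G : 'M[R[i]]_n) (y : 'cV[R]_n) : R[i] :=
  ((map_mx toC x)^T *m (G *m map_mx toC y)) 0 0.

Lemma bilC n (x y : 'cV[R]_n) (G : 'M[R[i]]_n) : G^T = G -> bil x G y = bil y G x.
Proof.
move=> symG; rewrite /bil.
set X := map_mx _ x; set Y := map_mx _ y.
have -> : X^T *m (G *m Y) = (Y^T *m (G *m X))^T.
  by rewrite !trmx_mul trmxK symG mulmxA.
by rewrite mxE.
Qed.

Lemma bil_resolvent_le n (M : 'M[R]_n) z (x y : 'cV[R]_n) (K : R) :
  M^T = M -> 0 < Im z -> dotv x x <= K -> dotv y y <= K ->
  normc (bil x (resolvent M z) y) <= K / Im z.
Proof.
move=> symM Imz xK yK.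
have K0 : 0 <= K by rewrite (le_trans _ xK)// -sqn_real sqn_ge0.
rewrite -(@ler_pXn2r _ 2) ?nnegrE ?normc_ge0 ?divr_ge0 ?(ltW Imz)//.
apply: le_trans (dot_le_sqn _ _) _.
rewrite expr_div_n [K ^+ 2]expr2 -mulrA ler_pM ?sqn_ge0 ?sqn_real//.
apply: le_trans (sqn_resolvent symM Imz _) _.
by rewrite sqn_real ler_wpM2r// invr_ge0 exprn_ge0// ltW.
Qed.

(** [E *m E^T] is an orthogonal projection, and the inequality is the nonnegativity of the squared
    norm of [P - E *m (E^T *m P)]. *)
Lemma sqn_coisometry m n p (E : 'M[R]_(m, n)) (A : 'M[R[i]]_(m, p)) :
  E^T *m E = 1%:M -> sqn ((map_mx toC E)^T *m A) <= sqn A.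
Proof.
move=> EE; rewrite !sqn_ReIm.
have -> : map_mx Re ((map_mx toC E)^T *m A) = E^T *m map_mx Re A.
  apply/matrixP => i j; rewrite !mxE Re_sum; apply: eq_bigr => k _.
  by rewrite !mxE ReZ.
have -> : map_mx Im ((map_mx toC E)^T *m A) = E^T *m map_mx Im A.
  apply/matrixP => i j; rewrite !mxE Im_sum; apply: eq_bigr => k _.
  by rewrite !mxE ImZ.
suff H (P : 'M[R]_(m, p)) : frdot (E^T *m P) (E^T *m P) <= frdot P P.
  by rewrite lerD.
have EP : frdot (E *m (E^T *m P)) P = frdot (E^T *m P) (E^T *m P).
  by rewrite /frdot !trmx_mul trmxK !mulmxA.
have EEP : frdot (E *m (E^T *m P)) (E *m (E^T *m P)) = frdot (E^T *m P) (E^T *m P).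
  by rewrite /frdot !trmx_mul trmxK !mulmxA -(mulmxA _ E^T E) EE mulmx1.
have := frdot_ge0 (P + (-1) *: (E *m (E^T *m P))).
rewrite !(frdotDl, frdotZl) ![frdot _ (_ + _)]frdotC !(frdotDl, frdotZl).
by rewrite EEP (frdotC P (E *m _)) EP; lra.
Qed.

End bilinear.

Section rank_two.
Variable R : realType.
Local Notation toC := (real_complex R).
Variables (n : nat) (M' : 'M[R]_n) (x y : 'cV[R]_n) (xi : R) (z : R[i]).
Hypotheses (symM' : M'^T = M') (Imz : 0 < Im z).
Let M := M' + xi *: (x *m y^T + y *m x^T).
Local Notation G := (resolvent M z).
Local Notation G' := (resolvent M' z).
Local Notation X := (map_mx toC x).
Local Notation Y := (map_mx toC y).

Lemma rank_two_sym : M^T = M.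
Proof.
rewrite /M linearD /= symM' linearZ /= linearD /= !trmx_mul !trmxK.
by rewrite [X in _ *: X]addrC.
Qed.

(** Second resolvent identity, with the perturbed resolvent on the left: tested on vectors it yields
    linear equations for the forms of [G] whose coefficients are forms of [G']. *)
Lemma resolvent_rank_two :
  G = G' - xi%:C *: (G *m (X *m Y^T + Y *m X^T) *m G').
Proof.
have symM := rank_two_sym.
have : G *m (map_mx toC M - z%:M) *m G' = G'.
  by rewrite (resolventK symM)// mul1mx.
have -> : map_mx toC M - z%:M =
    (map_mx toC M' - z%:M) + xi%:C *: (X *m Y^T + Y *m X^T).
  rewrite /M map_mxD map_mxZ /= map_mxD !map_mxM /= !map_trmx.
  by rewrite addrAC.
rewrite (mulmxDr G (_ - _)) (mulmxDl (G *m (_ - _))) -(mulmxA G (_ - _)) (resolventVK symM')// mulmx1.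
by move=> H; rewrite -{1}H -scalemxAr -scalemxAl addrK.
Qed.

Lemma bil_rank_two (u w : 'cV[R]_n) :
  bil u G w = bil u G' w - xi%:C * (bil u G x * bil y G' w + bil u G y * bil x G' w).
Proof.
rewrite /bil {1}resolvent_rank_two mulmxBl mulmxBr [LHS]mxE; congr (_ + _).
rewrite -scalemxAl -scalemxAr mxE mxE; congr (- (_ * _)).
rewrite mulmxDr mulmxDl mulmxDl mulmxDr [LHS]mxE; congr (_ + _).
  transitivity (((map_mx toC u)^T *m (G *m X) *m (Y^T *m (G' *m map_mx toC w))) 0 0).
    by rewrite !mulmxA.
  by rewrite mxE big_ord1.
transitivity (((map_mx toC u)^T *m (G *m Y) *m (X^T *m (G' *m map_mx toC w))) 0 0).
  by rewrite !mulmxA.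
by rewrite mxE big_ord1.
Qed.

(** By cyclicity the trace of each rank-one term is a scalar product of two vectors, so the bound
    does not grow with the dimension, and the effect on a trace normalized by [d] vanishes. *)
Lemma trace_rank_two (d : nat) (E F : 'M[R]_(n, d)) (K : R) :
  E^T *m E = 1%:M -> F^T *m F = 1%:M -> dotv x x <= K -> dotv y y <= K ->
  normc (\tr ((map_mx toC E)^T *m G *m map_mx toC F)
       - \tr ((map_mx toC E)^T *m G' *m map_mx toC F))
    <= `|xi| * (2 * K / Im z ^+ 2).
Proof.
move=> EE FF xK yK; have symM := rank_two_sym.
set Ec := map_mx toC E; set Fc := map_mx toC F.
have trE (u w : 'cV[R]_n) : \tr (Ec^T *m (G *m (map_mx toC u *m (map_mx toC w)^T) *m G') *m Fc) =
    ((G' *m map_mx toC w)^T *m (Fc *m (Ec^T *m (G *m map_mx toC u)))) 0 0.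
  rewrite trmx_mul (tr_resolvent _ symM').
  transitivity (\tr ((map_mx toC w)^T *m G' *m (Fc *m (Ec^T *m (G *m map_mx toC u)))));
    last by rewrite /mxtrace big_ord1.
  transitivity (\tr ((Ec^T *m (G *m map_mx toC u)) *m
      ((map_mx toC w)^T *m (G' *m Fc)))); first by rewrite !mulmxA.
  by rewrite mxtrace_mulC !mulmxA.
have trle (u w : 'cV[R]_n) : dotv u u <= K -> dotv w w <= K ->
    normc (\tr (Ec^T *m (G *m (map_mx toC u *m (map_mx toC w)^T) *m G') *m Fc))
      <= K / Im z ^+ 2.
  move=> uK wK; have K0 : 0 <= K by rewrite (le_trans _ uK)// -sqn_real sqn_ge0.
  rewrite trE.
  rewrite -(@ler_pXn2r _ 2) ?nnegrE ?normc_ge0 ?divr_ge0 ?exprn_ge0 ?(ltW Imz)//.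
  apply: le_trans (dot_le_sqn _ _) _.
  rewrite [leRHS]expr2 ler_pM ?sqn_ge0//.
    apply: le_trans (sqn_resolvent symM' Imz _) _.
    by rewrite sqn_real ler_wpM2r// invr_ge0 exprn_ge0// ltW.
  rewrite sqn_isometry// (le_trans (sqn_coisometry _ EE))//.
  apply: le_trans (sqn_resolvent symM Imz _) _.
  by rewrite sqn_real ler_wpM2r// invr_ge0 exprn_ge0// ltW.
rewrite -linearB /= -mulmxBl -mulmxBr {1}resolvent_rank_two addrAC subrr sub0r.
rewrite mulmxN mulNmx linearN /= normcN -scalemxAr -scalemxAl linearZ /=.
rewrite normcM normc_real ler_wpM2l// mulmxDr mulmxDl mulmxDr mulmxDl linearD /=.
apply: le_trans (le_normcD _ _) _.
by rewrite -mulrA [2 * _]mulr_natl mulr2n lerD ?trle.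
Qed.

End rank_two.

(** [a], [b], [e] stand for the left-left, left-right and right-right forms of the cut resolvent at
    an edge, [u] and [Gam] for the left-left and left-right forms of the full one. If [b = 0] and
    [a = e = F], the two relations force [Gam = - F^2 / (1 - F^2)]; the lemma is the stability of
    this solution. *)
Lemma rank_two_approx (R : realType) (a b e u Gam F : R[i]) :
  Gam = b - (u * e + Gam * b) -> u = a - (u * b + Gam * a) ->
  normc a <= 1 -> normc b <= 1 -> normc e <= 1 -> normc Gam <= 1 ->
  normc F <= 2^-1 ->
  normc (Gam + F ^+ 2 / (1 - F ^+ 2)) <=
    7 * (normc b + normc (a - F) + normc (e - F)).
Proof.
move=> HG Hu a1 b1 e1 G1 F1.
have F2 : normc (F ^+ 2) <= 4^-1.
  rewrite normcX expr2 (_ : 4^-1 = 2^-1 * 2^-1 :> R); last by field.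
  by rewrite ler_pM ?normc_ge0.
have nF : 3 / 4 <= normc (1 - F ^+ 2).
  by apply: le_trans _ (normc_le_sub _ _); rewrite normc1; lra.
have F0 : 1 - F ^+ 2 != 0 by rewrite -normc_eq0 gt_eqF// (lt_le_trans _ nF)// divr_gt0.
set D := a * e - F ^+ 2.
(* The two relations amount to [Gam ((1 + b)^2 - a e) = b (1 + b) - a e]. *)
have key : (Gam + F ^+ 2 / (1 - F ^+ 2)) * (1 - F ^+ 2) =
  b * (1 + b) - D - Gam * (b * 2 + b * b - D).
  rewrite mulrDl divfK// /D.
  have {}HG : Gam * (1 + b) = b - u * e by rewrite mulrDr mulr1 {1}HG; ring.
  have {}Hu : u * (1 + b) = a * (1 - Gam) by rewrite mulrDr mulr1 {1}Hu; ring.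
  have : Gam * (1 + b) * (1 + b) = b * (1 + b) - e * (a * (1 - Gam)).
    by rewrite HG -Hu; ring.
  move/eqP; rewrite -subr_eq0 => /eqP H.
  by apply/eqP; rewrite -subr_eq0 -H; apply/eqP; ring.
have D_le : normc D <= normc (a - F) + normc (e - F).
  have -> : D = a * (e - F) + F * (a - F) by rewrite /D; ring.
  apply: le_trans (le_normcD _ _) _; rewrite !normcM addrC lerD//.
    by rewrite ler_piMl ?normc_ge0//; lra.
  by rewrite ler_piMl ?normc_ge0.
have nb : normc (b * b) <= normc b by rewrite normcM ler_piMl ?normc_ge0.
(* Division by the lower bound [3 / 4] of [normc (1 - F ^+ 2)] turns the factors [5] and [2] into
   [20 / 3] and [8 / 3], both below [7]. *)
have : normc ((Gam + F ^+ 2 / (1 - F ^+ 2)) * (1 - F ^+ 2)) <=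
   5 * normc b + 2 * normc D.
  rewrite key; apply: le_trans (le_normcD _ _) _; rewrite normcN normcM.
  have h1 : normc (b * (1 + b) - D) <= 2 * normc b + normc D.
    apply: le_trans (le_normcD _ _) _; rewrite normcN lerD2r mulrDr mulr1.
    by apply: le_trans (le_normcD _ _) _; lra.
  have h2 : normc (b * 2 + b * b - D) <= 3 * normc b + normc D.
    apply: le_trans (le_normcD _ _) _; rewrite normcN lerD2r.
    apply: le_trans (le_normcD _ _) _.
    have -> : normc (b * 2) = 2 * normc b.
      have -> : b * 2 = (2 : R)%:C * b by rewrite rmorph_nat mulrC.
      by rewrite normcM normc_real ger0_norm.
    by lra.
  have : normc Gam * normc (b * 2 + b * b - D) <= normc (b * 2 + b * b - D).
    by rewrite ler_piMl ?normc_ge0.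
  by lra.
rewrite normcM.
set Y := normc (_ + _ / _); have Y0 : 0 <= Y by apply: normc_ge0.
have : Y * (3 / 4) <= Y * normc (1 - F ^+ 2) by rewrite ler_wpM2l.
have := normc_ge0 (a - F); have := normc_ge0 (e - F); have := normc_ge0 b.
by lra.
Qed.

(** * The block matrix and its edges *)

Section blocks.
Variables (R : realType) (r d : nat).
Local Notation toC := (real_complex R).
Local Notation n := (\sum_(k < r) d)%N.
Local Notation edge := ('I_r * 'I_r)%type.
Implicit Types (xi : 'I_r -> 'I_r -> R) (v : 'I_r -> 'I_r -> 'cV[R]_d) (e : edge).

(** Isometric embedding of the [k]-th copy of the [d]-dimensional space. Blocks are reached by
    multiplication with these columns, which keeps all computations matrix identities. *)
Definition blockE (k : 'I_r) : 'M[R]_(n, d) :=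
  \mxcol_(l < r) ((l == k)%:R%:M : 'M[R]_d).

Lemma blockE_orth k l : (blockE k)^T *m blockE l = (k == l)%:R%:M.
Proof.
rewrite /blockE tr_mxcol mul_mxrow_mxcol (bigD1 k)//= big1 ?addr0 => [|j /negPf jk].
  by rewrite eqxx tr_scalar_mx mul1mx eq_sym.
by rewrite jk tr_scalar_mx mul_scalar_mx scale0r.
Qed.

Lemma blockE_isometry k : (blockE k)^T *m blockE k = 1%:M.
Proof. by rewrite blockE_orth eqxx. Qed.

Lemma mul_blockE (M : 'I_r -> 'I_r -> 'M[R]_d) :
  \mxblock_(k, l) M k l = \sum_k \sum_l blockE k *m M k l *m (blockE l)^T.
Proof.
have -> : \mxblock_(k, l) M k l = \sum_i \sum_j
  \mxblock_(k, l) (((k == i)%:R%:M : 'M[R]_d) *m M i j *m ((l == j)%:R%:M : 'M[R]_d)^T).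
  under [RHS]eq_bigr do rewrite -mxblock_sum.
  rewrite -mxblock_sum; apply/eq_mxblockP => k l.
  rewrite (bigD1 k)//= (bigD1 l)//= !eqxx tr_scalar_mx mul1mx mulmx1.
  rewrite big1 => [|j /negPf lj].
    rewrite addr0 big1 ?addr0// => i /negPf ki; rewrite big1// => j _.
    by rewrite eq_sym ki mul_scalar_mx scale0r mul0mx.
  by rewrite [l == j]eq_sym lj tr_scalar_mx mul_mx_scalar scale0r.
apply: eq_bigr => i _; apply: eq_bigr => j _.
by rewrite /blockE tr_mxcol -mulmxA mul_mxrow mul_mxcol_mxrow; under [RHS]eq_mxblock do rewrite mulmxA.
Qed.

Lemma sum_blockE : \sum_k blockE k *m (blockE k)^T = 1%:M.
Proof.
have -> : 1%:M = \mxblock_(k, l) ((k == l)%:R%:M : 'M[R]_d) :> 'M[R]_n.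
  rewrite -[LHS](submxblockK (p_ := fun=> d) (q_ := fun=> d)).
  apply/eq_mxblockP => k l; apply/matrixP => i j; rewrite !mxE.
  rewrite /tagnat.Rank (inj_eq (@tagnat.rank_inj _ _)).
  have [kl|kl] := eqVneq k l; last first.
    by rewrite -tag_eqE /tag_eq /= (negPf kl) mul0rn.
  by case: _ / kl j => j; rewrite -tag_eqE /tag_eq /= eqxx tagged_asE.
rewrite mul_blockE; apply: eq_bigr => k _; rewrite [RHS](bigD1 k)//= eqxx mulmx1.
rewrite [X in _ + X]big1 ?addr0// => l /negPf lk.
by rewrite eq_sym lk mul_mx_scalar scale0r mul0mx.
Qed.

(** The vector of an edge placed at its two end points. An edge contributes to the matrix only
    through these two vectors, whence the rank two. *)
Definition edge_l v e : 'cV[R]_n := blockE e.1 *m v e.1 e.2.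
Definition edge_r v e : 'cV[R]_n := blockE e.2 *m v e.1 e.2.
Definition edge_mx v e : 'M[R]_n :=
  edge_l v e *m (edge_r v e)^T + edge_r v e *m (edge_l v e)^T.

Lemma AmxE xi v :
  Amx xi v = \sum_(e : edge | (e.1 < e.2)%N) xi e.1 e.2 *: edge_mx v e.
Proof.
pose t (a b k l : 'I_r) : 'M[R]_n :=
  blockE k *m (xi a b *: (v a b *m (v a b)^T)) *m (blockE l)^T.
rewrite /Amx mul_blockE pair_big /=.
rewrite (bigID (fun e : edge => (e.1 < e.2)%N)) /=.
rewrite [X in _ + X](bigID (fun e : edge => (e.2 < e.1)%N)) /=.
rewrite [X in _ + (_ + X)]big1 ?addr0; last first.
  move=> [k l] /=; rewrite -!leqNgt => /andP[lk kl].
  have -> : k = l by apply/val_inj/anti_leq; rewrite kl lk.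
  by rewrite eqxx subrr scale0r mulmx0 mul0mx.
have -> : \sum_(e : edge | ~~ (e.1 < e.2)%N && (e.2 < e.1)%N) blockE e.1 *m
    ((1 - (e.1 == e.2)%:R) *: bblock xi v e.1 e.2) *m (blockE e.2)^T =
  \sum_(e : edge | (e.1 < e.2)%N) t e.1 e.2 e.2 e.1.
  rewrite (reindex_inj (h := fun e : edge => (e.2, e.1))) /=; last by move=> [? ?] [? ?] [-> ->].
  apply: eq_big => [[k l]|[k l]] /=.
    by apply: andb_idl => kl; rewrite -leqNgt ltnW.
  move=> /andP[lk kl]; rewrite eq_sym (_ : (k == l) = false) ?subr0 ?scale1r; last first.
    by apply/negbTE; rewrite neq_ltn kl.
  by rewrite /t /bblock (negPf lk).
rewrite -big_split; apply: eq_bigr => -[k l] /= kl.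
rewrite (_ : (k == l) = false) ?subr0 ?scale1r; last first.
  by apply/negbTE; rewrite neq_ltn kl.
rewrite /t /bblock kl /edge_mx /edge_l /edge_r /= !trmx_mul scalerDr.
by rewrite -!scalemxAr -!scalemxAl !mulmxA.
Qed.

Lemma edge_mx_sym v e : (edge_mx v e)^T = edge_mx v e.
Proof. by rewrite /edge_mx linearD /= !trmx_mul !trmxK addrC. Qed.

Lemma Amx_sym xi v : (Amx xi v)^T = Amx xi v.
Proof.
rewrite AmxE linear_sum; apply: eq_bigr => e _.
by rewrite linearZ /= edge_mx_sym.
Qed.

(** Clearing the single entry at [e] suffices, since [Amx] reads [xi] only above the diagonal. *)
Definition cut xi (e : edge) (i j : 'I_r) : R := if (i, j) == e then 0 else xi i j.

Lemma Amx_cut xi v e : (e.1 < e.2)%N ->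
  Amx xi v = Amx (cut xi e) v + xi e.1 e.2 *: edge_mx v e.
Proof.
move=> he; rewrite !AmxE (bigD1 e)//= addrC; congr (_ + _).
rewrite [RHS](bigD1 e)//= /cut -surjective_pairing eqxx scale0r add0r.
by apply: eq_bigr => f /andP[_ /negPf fe]; rewrite -surjective_pairing fe.
Qed.

Lemma dotv_edge_l v e : dotv (edge_l v e) (edge_l v e) = dotv (v e.1 e.2) (v e.1 e.2).
Proof.
by rewrite -!sqn_real /edge_l map_mxM sqn_isometry// blockE_isometry.
Qed.

Lemma dotv_edge_r v e : dotv (edge_r v e) (edge_r v e) = dotv (v e.1 e.2) (v e.1 e.2).
Proof.
by rewrite -!sqn_real /edge_r map_mxM sqn_isometry// blockE_isometry.
Qed.

Definition cblock (G : 'M[R[i]]_n) (k l : 'I_r) : 'M[R[i]]_d :=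
  (map_mx toC (blockE k))^T *m G *m map_mx toC (blockE l).

Definition avg_block xi v z (k l : 'I_r) : R[i] :=
  (d%:R^-1)%:C * \tr (cblock (resolvent (Amx xi v) z) k l).

Lemma bil_blockE (G : 'M[R[i]]_n) k l (u w : 'cV[R]_d) :
  bil (blockE k *m u) G (blockE l *m w) = bil u (cblock G k l) w.
Proof. by rewrite /bil /cblock !map_mxM !trmx_mul !mulmxA. Qed.

Definition incident (k : 'I_r) e := (k == e.1) || (k == e.2).

(** Normalized trace of the [(k, k)] block of [z G = A G - 1]. Since [G] is symmetric, an edge
    contributes the same form at either of its ends, so one expression per edge serves for both. *)
Lemma row_equation xi v z k : (0 < d)%N -> 0 < Im z ->
  z * avg_block xi v z k k = -1 + (d%:R^-1)%:C *
    \sum_(e : edge | (e.1 < e.2)%N && incident k e) (xi e.1 e.2)%:C *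
      bil (edge_l v e) (resolvent (Amx xi v) z) (edge_r v e).
Proof.
move=> d0 Imz; have symA := Amx_sym xi v.
have trG := tr_resolvent z symA.
have trVK := resolventVK symA Imz.
set G := resolvent _ z in trG trVK *.
have zG : z *: G = map_mx toC (Amx xi v) *m G - 1%:M.
  rewrite -trVK mulmxBl opprB addrC subrK.
  by rewrite mul_scalar_mx.
rewrite /avg_block mulrCA -linearZ /=.
have -> : z *: cblock G k k = cblock (z *: G) k k.
  by rewrite /cblock -scalemxAr -scalemxAl.
rewrite zG /cblock mulmxBr mulmxBl linearB /= mulmx1 map_trmx -map_mxM.
rewrite blockE_isometry map_mx1 mxtrace1 -map_trmx.
rewrite mulrBr addrC; congr (_ + _).
  have -> : (d%:R : R[i]) = (d%:R : R)%:C by rewrite rmorph_nat.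
  by rewrite -rmorphM /= mulVf ?pnatr_eq0 -?lt0n.
congr (_ * _); rewrite AmxE raddf_sum /= mulmx_suml mulmx_sumr mulmx_suml raddf_sum /=.
rewrite [RHS]big_mkcondr /=; apply: eq_bigr => e he.
rewrite map_mxZ -scalemxAl -scalemxAr -scalemxAl linearZ /=.
have term (x y : 'cV[R]_n) : \tr ((map_mx toC (blockE k))^T *m
    (map_mx toC (x *m y^T) *m G) *m map_mx toC (blockE k)) =
    bil y G (blockE k *m (blockE k)^T *m x).
  rewrite /bil !map_mxM -!map_trmx; set X := map_mx toC x; set Y := map_mx toC y.
  set E := map_mx toC (blockE k).
  transitivity (\tr ((Y^T *m (G *m (E *m E^T *m X)))));
    last by rewrite /mxtrace big_ord1.
  transitivity (\tr ((E^T *m X) *m (Y^T *m (G *m E)))); first by rewrite !mulmxA.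
  by rewrite mxtrace_mulC !mulmxA.
have proj l (u : 'cV[R]_d) : blockE k *m (blockE k)^T *m (blockE l *m u) =
    (k == l)%:R *: (blockE l *m u).
  rewrite -mulmxA (mulmxA _^T) blockE_orth mul_scalar_mx -scalemxAr.
  by have [->|] := eqVneq k l; rewrite ?scale1r// !scale0r.
have bil0 (x : 'cV[R]_n) : bil x G 0 = 0.
  by rewrite /bil map_mx0 mulmx0 mulmx0 mxE.
rewrite /edge_mx map_mxD mulmxDl mulmxDr mulmxDl linearD /= !term !proj.
rewrite -/(edge_l v e) -/(edge_r v e) /incident.
have [k1|k1] := eqVneq k e.1; have [k2|k2] := eqVneq k e.2 => /=.
- by move: he; rewrite -k1 -k2 ltnn.
- by rewrite scale1r scale0r bil0 addr0 (bilC _ _ trG).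
- by rewrite scale1r scale0r bil0 add0r.
- by rewrite !scale0r !bil0 addr0 mulr0.
Qed.

Lemma sum_avg_block xi v z : (0 < d)%N -> (0 < r)%N ->
  (r%:R^-1)%:C * \sum_k avg_block xi v z k k =
  (n%:R^-1)%:C * \tr (resolvent (Amx xi v) z).
Proof.
move=> d0 r0; rewrite /avg_block -mulr_sumr mulrA -rmorphM -invfM -natrM.
have -> : n%:R = (r * d)%:R :> R by rewrite sum_nat_const card_ord.
congr (_ * _).
under eq_bigr do rewrite /cblock -mulmxA mxtrace_mulC -mulmxA map_trmx -map_mxM.
by rewrite -raddf_sum -mulmx_sumr -raddf_sum /= sum_blockE map_mx1 mulmx1.
Qed.

(** The blocks of row [k] have total squared norm [sqn (G *m blockE k)], at most [d / Im z ^ 2], and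
    a squared trace costs a factor [d]. The bound is independent of [r], so a typical off-diagonal
    average is of order [r ^ (-1/2)]. *)
Lemma sum_sqr_avg_block xi v z k : (0 < d)%N -> 0 < Im z ->
  \sum_l normc (avg_block xi v z k l) ^+ 2 <= (Im z ^+ 2)^-1.
Proof.
move=> d0 Imz; set G := resolvent (Amx xi v) z.
have symA := Amx_sym xi v.
have d0R : 0 < (d%:R : R) by rewrite ltr0n.
have le1 l : normc (avg_block xi v z k l) ^+ 2 <= d%:R^-1 * sqn (cblock G k l).
  rewrite /avg_block normcM exprMn normc_real ger0_norm ?invr_ge0 ?ler0n//.
  rewrite expr2 -!mulrA ler_pM2l ?invr_gt0// ler_pdivrMl//.
  exact: trace_le_sqn.
apply: (le_trans (ler_sum _ (fun l _ => le1 l))); rewrite -mulr_sumr.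
rewrite ler_pdivrMl//.
have -> : \sum_l sqn (cblock G k l) = sqn (G *m map_mx toC (blockE k)).
  have fr m (A : 'M[R]_(m, n)) : \sum_l frdot (A *m blockE l) (A *m blockE l) = frdot A A.
    rewrite /frdot -raddf_sum /=.
    under eq_bigr do rewrite trmx_mul.
    transitivity (\tr (A *m A^T)); last by rewrite mxtrace_mulC.
    transitivity (\sum_l \tr (A *m (blockE l *m (blockE l)^T) *m A^T)).
      rewrite raddf_sum; apply: eq_bigr => l _ /=.
      by rewrite mxtrace_mulC !mulmxA.
    by rewrite -raddf_sum /= -mulmx_suml -mulmx_sumr sum_blockE mulmx1.
  rewrite -[RHS]sqn_tr trmx_mul (tr_resolvent _ symA) sqn_ReIm -!fr -big_split.
  apply: eq_bigr => l _; rewrite sqn_ReIm /cblock /= -/G.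
  set B := _ *m G.
  have -> : map_mx Re (B *m map_mx toC (blockE l)) = map_mx Re B *m blockE l.
    apply/matrixP => i j; rewrite !mxE Re_sum; apply: eq_bigr => a _.
    by rewrite !mxE mulrC ReZ mulrC.
  have -> // : map_mx Im (B *m map_mx toC (blockE l)) = map_mx Im B *m blockE l.
  apply/matrixP => i j; rewrite !mxE Im_sum; apply: eq_bigr => a _.
  by rewrite !mxE mulrC ImZ mulrC.
apply: le_trans (sqn_resolvent symA Imz _) _.
rewrite ler_wpM2r ?invr_ge0 ?exprn_ge0 ?(ltW Imz)//.
rewrite -[X in sqn X]mulmx1 sqn_isometry ?blockE_isometry//.
rewrite /sqn (_ : \sum_i _ = d%:R)//.
rewrite -[in RHS](card_ord d) -sum1_card natr_sum; apply: eq_bigr => i _.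
rewrite (bigD1 i)//= big1 ?addr0 => [|j /negPf ji]; rewrite !mxE.
  by rewrite eqxx normc1 expr1n.
by rewrite eq_sym ji normc0 expr0n.
Qed.

End blocks.

(** * The small root of the cubic and the stable row equation *)

Section small_root.
Variables (R : realType) (c : R).
Implicit Types z F : R[i].

Definition psi F : R[i] := F ^+ 2 / (1 - F ^+ 2).

Definition cubic z F : R[i] := z * F ^+ 3 + (1 - c%:C) * F ^+ 2 - z * F - 1.

(** Divided by [z], the cubic is monic with constant term [- z^-1]: its three roots have a product
    of modulus at most [1 / 8], so one of them has modulus at most [1 / 2]. *)
Lemma small_root z : 8 <= Im z -> exists F, normc F <= 2^-1 /\ cubic z F = 0.
Proof.
move=> z8; have z0 : z != 0 by apply/eqP => z0; move: z8; rewrite z0 /=; lra.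
pose p : {poly R[i]} :=
  'X^3 + ((1 - c%:C) / z) *: 'X^2 - 'X - (z^-1)%:P.
have sp : size p = 4.
  rewrite /p -!addrA size_polyDl size_polyXn//.
  apply: leq_ltn_trans (size_polyD _ _) _; rewrite gtn_max.
  rewrite (leq_ltn_trans (size_scale_leq _ _)) ?size_polyXn//=.
  apply: leq_ltn_trans (size_polyD _ _) _; rewrite gtn_max !size_polyN size_polyX.
  by rewrite (leq_ltn_trans (size_polyC_leq1 _)).
have pE x : p.[x] = cubic z x / z.
  rewrite /p !(hornerD, hornerN, hornerZ, hornerXn, hornerX, hornerC) /cubic.
  by field.
have lp : lead_coef p = 1.
  rewrite lead_coefE sp /p !coefD !coefN coefZ !coefXn coefX coefC /=.
  by rewrite mulr0 !subr0 addr0.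
have [rs prs] := closed_field_poly_normal p; rewrite lp scale1r in prs.
have srs : size rs = 3.
  by have := congr1 (size \o polyseq) prs; rewrite /= sp size_prod_XsubC => -[].
have p0 : p.[0] = - z^-1.
  by rewrite pE /cubic !expr0n /= !mulr0 subr0 addr0 sub0r mulN1r.
have [x xrs xs] : exists2 x, x \in rs & normc x <= 2^-1.
  apply: contrapT => /forall2NP nx.
  have {}nx x : x \in rs -> 2^-1 < normc x.
    by move=> xrs; have [//|/negP] := nx x; rewrite -ltNge.
  have : normc p.[0] = \prod_(x <- rs) normc x.
    rewrite prs horner_prod (big_morph _ (@normcM R) (@normc1 R)).
    by apply: eq_bigr => x _; rewrite hornerXsubC sub0r normcN.
  rewrite p0 normcN normcV.
  case: rs srs {prs} nx => [|a [|b [|e [|]]]]//= _ nx.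
  rewrite !big_cons big_nil mulr1.
  have /nx na : a \in [:: a; b; e] by rewrite !inE eqxx.
  have /nx nb : b \in [:: a; b; e] by rewrite !inE eqxx orbT.
  have /nx ne : e \in [:: a; b; e] by rewrite !inE eqxx !orbT.
  have nz : 8 <= normc z by rewrite (le_trans z8)// (le_trans _ (Im_le_normc _))// ler_norm.
  have nz1 : (normc z)^-1 <= 8^-1 by rewrite lef_pV2// posrE; lra.
  have ab : 2^-1 * 2^-1 < normc a * normc b by rewrite ltr_pM.
  have abe : (2^-1 * 2^-1) * 2^-1 < (normc a * normc b) * normc e.
    by rewrite ltr_pM ?mulr_ge0.
  by rewrite mulrA => abE; move: abe; rewrite -abE; lra.
exists x; split=> //.
have : root p x by rewrite prs root_prod_XsubC.
by rewrite /root pE mulf_eq0 invr_eq0 (negPf z0) orbF => /eqP.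
Qed.

(** The cubic is [- ((z F + 1) (1 - F^2) + c F^2)]; dividing by [1 - F^2] gives it the shape of the
    row equation. *)
Lemma small_rootE z F : normc F <= 2^-1 -> cubic z F = 0 ->
  z * F = - 1 - c%:C * psi F.
Proof.
move=> F2 Fz; have F0 : 1 - F ^+ 2 != 0.
  rewrite -normc_eq0 gt_eqF// (lt_le_trans _ (normc_le_sub _ _))// subr_gt0.
  rewrite normc1 normcX expr_lt1// ?normc_ge0//; lra.
apply: (mulIf F0); rewrite mulrBl -[c%:C * _ * _]mulrA /psi divfK//.
apply/eqP; rewrite -subr_eq0 -oppr_eq0 -Fz /cubic; apply/eqP; ring.
Qed.

Lemma normc_psi_le F : normc F <= 2^-1 -> normc (psi F) <= 2 * normc F ^+ 2.
Proof.
move=> F2; rewrite /psi normcM normcV normcX mulrC ler_wpM2r ?sqr_ge0//.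
have F4 : normc F ^+ 2 <= 4^-1.
  rewrite expr2 (_ : 4^-1 = 2^-1 * 2^-1 :> R); last by field.
  by rewrite ler_pM ?normc_ge0.
have nF : 2^-1 <= normc (1 - F ^+ 2).
  by apply: le_trans _ (normc_le_sub _ _); rewrite normc1 normcX; lra.
by rewrite -[leRHS]invrK lef_pV2// posrE ?invr_gt0//; apply: lt_le_trans nF.
Qed.

End small_root.

(** * The row estimate for a fixed realization of the matrix *)

Section local_law.
Variables (R : realType) (r d : nat) (c C0 : R).
Variables (xi : 'I_r -> 'I_r -> R) (v : 'I_r -> 'I_r -> 'cV[R]_d).
Variables (z F : R[i]).
Local Notation edge := ('I_r * 'I_r)%type.
Hypothesis d_gt0 : (0 < d)%N.
Hypothesis xi01 : forall e : edge, (e.1 < e.2)%N -> xi e.1 e.2 = 0 \/ xi e.1 e.2 = 1.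
Hypothesis v_le : forall e : edge, (e.1 < e.2)%N -> dotv (v e.1 e.2) (v e.1 e.2) <= C0.
Hypothesis C0_ge0 : 0 <= C0.
Hypotheses (z_ge8 : 8 <= Im z) (z_geC : C0 <= Im z).
Hypotheses (F_le : normc F <= 2^-1) (F_root : cubic c z F = 0).
Let Imz : 0 < Im z. Proof. by rewrite (lt_le_trans _ z_ge8). Qed.

Definition cut_resolvent (e : edge) := resolvent (Amx (cut xi e) v) z.

(** Distance of the three cut forms to their limits [0], [F], [F]. The weight of [e] itself does not
    enter. *)
Definition edge_err (e : edge) : R :=
  normc (bil (edge_l v e) (cut_resolvent e) (edge_r v e)) +
  normc (bil (edge_l v e) (cut_resolvent e) (edge_l v e) - F) +
  normc (bil (edge_r v e) (cut_resolvent e) (edge_r v e) - F).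

(** Distance of the same forms to normalized block traces of the cut resolvent, which by isotropy
    are their means over the vector of [e] alone. *)
Definition edge_fluct (e : edge) : R :=
  normc (bil (edge_l v e) (cut_resolvent e) (edge_r v e)
         - avg_block (cut xi e) v z e.1 e.2) +
  normc (bil (edge_l v e) (cut_resolvent e) (edge_l v e)
         - avg_block (cut xi e) v z e.1 e.1) +
  normc (bil (edge_r v e) (cut_resolvent e) (edge_r v e)
         - avg_block (cut xi e) v z e.2 e.2).

Lemma edge_gamma_approx (e : edge) : (e.1 < e.2)%N -> xi e.1 e.2 = 1 ->
  normc (bil (edge_l v e) (resolvent (Amx xi v) z) (edge_r v e) + psi F)
    <= 7 * edge_err e.
Proof.
move=> he xie.
have symA := Amx_sym xi v; have symA' := Amx_sym (cut xi e) v.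
have AE : Amx xi v = Amx (cut xi e) v + 1 *: (edge_l v e *m (edge_r v e)^T +
   edge_r v e *m (edge_l v e)^T) by rewrite (Amx_cut _ _ he) xie.
(* The assumption [C0 <= Im z] serves to bring all forms below [1], as [rank_two_approx] demands. *)
have bd M (x y : 'cV[R]_ _) : M^T = M -> dotv x x <= C0 -> dotv y y <= C0 ->
    normc (bil x (resolvent M z) y) <= 1.
  move=> sM xC yC; apply: le_trans (bil_resolvent_le sM Imz xC yC) _.
  by rewrite ler_pdivrMr// mul1r.
have lC : dotv (edge_l v e) (edge_l v e) <= C0 by rewrite dotv_edge_l v_le.
have rC : dotv (edge_r v e) (edge_r v e) <= C0 by rewrite dotv_edge_r v_le.
rewrite /edge_err.
apply: (@rank_two_approx _ _ _ _
  (bil (edge_l v e) (resolvent (Amx xi v) z) (edge_l v e))); rewrite ?bd//.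
- by rewrite {1}AE (bil_rank_two _ _ _ symA' Imz) -AE mul1r.
- rewrite {1}AE (bil_rank_two _ _ _ symA' Imz) -AE mul1r.
  by rewrite (bilC (edge_r v e) (edge_l v e) (tr_resolvent _ symA')).
Qed.

(** Row equation minus [z F = -1 - c psi F]. The difference has two sources: each form is replaced
    by [- psi F], and the degree of [k] divided by [d] is replaced by [c]. *)
Lemma diag_block_approx k :
  normc z * normc (avg_block xi v z k k - F) <=
  d%:R^-1 * (\sum_(e : edge | (e.1 < e.2)%N && incident k e) xi e.1 e.2 * (7 * edge_err e))
  + normc (psi F) *
    `|d%:R^-1 * (\sum_(e : edge | (e.1 < e.2)%N && incident k e) xi e.1 e.2) - c|.
Proof.
rewrite -normcM mulrBr row_equation// (small_rootE F_le F_root).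
set S := \sum_(e | _) _; set T := \sum_(e | _) xi e.1 e.2.
have -> : - 1 + (d%:R^-1)%:C * S - (- 1 - c%:C * psi F) =
   (d%:R^-1)%:C * (\sum_(e : edge | (e.1 < e.2)%N && incident k e) (xi e.1 e.2)%:C *
   (bil (edge_l v e) (resolvent (Amx xi v) z) (edge_r v e) + psi F))
   - psi F * (d%:R^-1 * T - c)%:C.
  under [\sum_(e | _) _ * (_ + _)]eq_bigr do rewrite mulrDr.
  rewrite big_split /= -mulr_suml -/S rmorphB rmorphM /= (_ : T%:C = \sum_(e : edge
    | (e.1 < e.2)%N && incident k e) (xi e.1 e.2)%:C); last by rewrite /T rmorph_sum.
  by ring.
apply: le_trans (le_normcD _ _) _; rewrite normcN !normcM !normc_real lerD2r.
rewrite ger0_norm ?invr_ge0// ler_wpM2l ?invr_ge0//.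
apply: le_trans (le_normc_sum _ _ _) _; apply: ler_sum => e /andP[he _].
rewrite normcM normc_real.
by have [xe|xe] := xi01 he; rewrite xe ?normr0 ?mul0r// normr1 !mul1r edge_gamma_approx.
Qed.

Lemma avg_block_cut (e : edge) k l : (e.1 < e.2)%N ->
  normc (avg_block xi v z k l - avg_block (cut xi e) v z k l) <=
    d%:R^-1 * (2 * C0 / Im z ^+ 2).
Proof.
move=> he; rewrite /avg_block -mulrBr normcM normc_real ger0_norm ?invr_ge0//.
rewrite ler_wpM2l ?invr_ge0//.
have symA' := Amx_sym (cut xi e) v.
rewrite (Amx_cut xi v he) /edge_mx.
apply: le_trans (trace_rank_two (K := C0) _ symA' Imz _ _ _ _) _.
- exact: blockE_isometry.
- exact: blockE_isometry.
- by rewrite dotv_edge_l v_le.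
- by rewrite dotv_edge_r v_le.
have K0 : 0 <= 2 * C0 / Im z ^+ 2 by rewrite divr_ge0 ?mulr_ge0 ?exprn_ge0 ?(ltW Imz).
by have [->|->] := xi01 he;
 rewrite ?normr0 ?normr1 ?mul0r ?mul1r.
Qed.

(** The averages are taken back from the cut to the full resolvent, at a cost of order [1 / d], so
    that the quantities to be estimated occur on both sides of the final inequality. *)
Lemma edge_err_le (e : edge) : (e.1 < e.2)%N ->
  edge_err e <= edge_fluct e + normc (avg_block xi v z e.1 e.2)
    + normc (avg_block xi v z e.1 e.1 - F) + normc (avg_block xi v z e.2 e.2 - F)
    + 3 * (d%:R^-1 * (2 * C0 / Im z ^+ 2)).
Proof.
move=> he; rewrite /edge_err /edge_fluct.
have ck k l : normc (avg_block (cut xi e) v z k l - avg_block xi v z k l) <=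
    d%:R^-1 * (2 * C0 / Im z ^+ 2) by rewrite normcB avg_block_cut.
have t3 (x y w u : R[i]) : normc (x - u) <= normc (x - y) + normc (y - w) + normc (w - u).
  apply: (@le_trans _ _ (normc (x - w) + normc (w - u))).
    by apply: le_trans (le_normcD _ _); rewrite addrA subrK.
  by rewrite lerD2r; apply: le_trans (le_normcD _ _); rewrite addrA subrK.
have t30 (x y w : R[i]) : normc x <= normc (x - y) + normc (y - w) + normc w.
  by have := t3 x y w 0; rewrite !subr0.
have addK (a b f a' b' f' a1 b1 f1 ga gb gf K : R) :
    b <= b' + b1 + gb -> a <= a' + a1 + ga -> f <= f' + f1 + gf ->
    b1 <= K -> a1 <= K -> f1 <= K ->
    b + a + f <= b' + a' + f' + gb + ga + gf + 3 * K by lra.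
exact: (addK _ _ _ _ _ _ _ _ _ _ _ _ _ (t30 _ _ _) (t3 _ _ _ _) (t3 _ _ _ _)
  (ck e.1 e.2) (ck e.1 e.1) (ck e.2 e.2)).
Qed.

Lemma sum_incident (f : edge -> R) :
  \sum_k \sum_(e : edge | (e.1 < e.2)%N && incident k e) f e =
  2 * \sum_(e : edge | (e.1 < e.2)%N) f e.
Proof.
under eq_bigr do rewrite big_mkcondr /=.
rewrite exchange_big /= mulr_sumr; apply: eq_bigr => e he.
have ne : e.1 != e.2 by rewrite neq_ltn he.
rewrite (bigD1 e.1)//= (bigD1 e.2) /=; last by rewrite eq_sym.
rewrite big1 ?addr0 => [|k /andP[/negPf k1 /negPf k2]]; last by rewrite /incident k1 k2.
by rewrite /incident !eqxx orbT /= mulr_natl mulr2n.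
Qed.

Lemma sum_diag_block_approx :
  Im z * \sum_k normc (avg_block xi v z k k - F) <=
  14 * d%:R^-1 * (\sum_(e : edge | (e.1 < e.2)%N) xi e.1 e.2 * edge_err e)
  + \sum_k `|d%:R^-1 * (\sum_(e : edge | (e.1 < e.2)%N && incident k e) xi e.1 e.2) - c|.
Proof.
have nz : Im z <= normc z by rewrite (le_trans _ (Im_le_normc _))// ler_norm.
apply: (@le_trans _ _ (\sum_k normc z * normc (avg_block xi v z k k - F))).
  rewrite -mulr_sumr ler_wpM2r// sumr_ge0// => k _; exact: normc_ge0.
apply: (le_trans (ler_sum _ (fun k _ => diag_block_approx k))).
rewrite big_split /= lerD//.
  (* The [7] of [rank_two_approx] is doubled because every edge is seen from both of its ends. *)
  rewrite -mulr_sumr sum_incident mulrCA mulrA (_ : 14 = 2 * 7); last by ring.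
  rewrite [2 * 7 * _]mulrAC -[leRHS]mulrA ler_wpM2l ?mulr_ge0 ?invr_ge0//.
  by rewrite mulr_sumr ler_sum// => e _; rewrite mulrCA.
apply: ler_sum => k _; rewrite ler_piMl//.
apply: le_trans (normc_psi_le F_le) _.
have F4 : normc F ^+ 2 <= 2^-1 * 2^-1 by rewrite expr2 ler_pM ?normc_ge0.
by lra.
Qed.

End local_law.

(** * Eigenvalues and uniqueness of the root in the upper half-plane *)

Section spectral_trace.
Variable R : realType.
Local Notation toC := (real_complex R).

Lemma char_poly_conj (K : fieldType) n (P D : 'M[K]_n) : P \in unitmx ->
  char_poly (invmx P *m D *m P) = char_poly D.
Proof.
move=> Pu; rewrite /char_poly /char_poly_mx.
have PP : map_mx polyC (invmx P) *m map_mx polyC P = 1%:M.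
  by rewrite -map_mxM mulVmx// map_mx1.
have -> : 'X%:M - map_mx polyC (invmx P *m D *m P) =
    map_mx polyC (invmx P) *m ('X%:M - map_mx polyC D) *m map_mx polyC P.
  rewrite mulmxBr mulmxBl !map_mxM; congr (_ - _).
  by rewrite scalar_mxC -mulmxA PP mulmx1.
rewrite !det_mulmx mulrAC -det_mulmx PP det1 mul1r//.
Qed.

(** The matrix is diagonalized over [R[i]] as a Hermitian one; its eigenvalues are real, so the
    characteristic polynomial already splits over [R]. *)
Lemma sym_spectrum n (M : 'M[R]_n) : M^T = M ->
  exists lam : 'I_n -> R, char_poly M = \prod_i ('X - (lam i)%:P) /\
    forall z, 0 < Im z -> \tr (resolvent M z) = \sum_i ((lam i)%:C - z)^-1.
Proof.
move=> symM; set A := map_mx toC M.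
have Areal : A \is a (mxOver Num.real).
  by apply/mxOverP => i j; rewrite mxE; apply/complex_realP; exists (M i j).
have Aherm : A \is hermsymmx.
  apply: realsym_hermsym => //; apply/is_hermitianmxP.
  rewrite expr0 scale1r map_mx_id; last by move=> ?.
  by rewrite /A map_trmx symM.
have Anorm := hermitian_normalmx Aherm.
have Dreal := hermitian_spectral_diag_real Aherm.
have Pu := spectral_unit A.
have /orthomx_spectralP := Anorm.
set P := spectralmx A in Pu *; set D := spectral_diag A in Dreal * => AE.
pose lam i := Re (D 0 i).
have lamE i : (lam i)%:C = D 0 i.
  by rewrite /lam RRe_real//; have /mxOverP := Dreal; apply.
exists lam; split.
  apply: (map_poly_inj toC); rewrite map_char_poly -/A AE char_poly_conj//.
  rewrite char_poly_trig ?diag_mx_is_trig// rmorph_prod; apply: eq_bigr => i _.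
  by rewrite rmorphB /= map_polyX map_polyC /= lamE mxE eqxx.
move=> z Imz.
have Dz i : D 0 i - z != 0.
  apply/eqP => /(congr1 (@complex.Im _)); rewrite -lamE ImB /= sub0r => /eqP.
  by rewrite oppr_eq0 gt_eqF.
have -> : resolvent M z =
    invmx P *m diag_mx (\row_i (D 0 i - z)^-1) *m P.
  have symA := shift_unit symM Imz.
  apply: (can_inj (mulmxK symA)); rewrite (resolventK symM Imz) -/A AE.
  have -> : invmx P *m diag_mx D *m P - z%:M =
      invmx P *m diag_mx (\row_i (D 0 i - z)) *m P.
    have -> : diag_mx (\row_i (D 0 i - z)) = diag_mx D - z%:M.
      by apply/matrixP => i j; rewrite !mxE -mulrnBl.
    by rewrite mulmxBr mulmxBl scalar_mxC -[z%:M *m _ *m _]mulmxA mulVmx// mulmx1.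
  rewrite -!mulmxA (mulmxA P) mulmxV// mul1mx (mulmxA (diag_mx _)) mulmx_diag.
  rewrite (_ : diag_mx _ = 1%:M); first by rewrite mul1mx mulVmx.
  rewrite -diag_const_mx; congr diag_mx; apply/rowP => i.
  by rewrite !mxE mulVf.
rewrite mxtrace_mulC mulmxA mulmxV// mul1mx mxtrace_diag.
by apply: eq_bigr => i _; rewrite mxE lamE.
Qed.

Lemma mup_prod_XsubC (x : R) (s : seq R) :
  mup x (\prod_(y <- s) ('X - y%:P)) = count_mem x s.
Proof.
elim: s => [|y s IH]; first by rewrite big_nil mupNroot// /root hornerC oner_eq0.
rewrite big_cons mupM ?polyXsubC_eq0 //; last first.
  by rewrite monic_neq0// monic_prod_XsubC.
by rewrite IH /= -[X in mup x X]expr1 mup_XsubCX; case: (y == x).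
Qed.

Lemma eigvals_perm n (M : 'M[R]_n) (lam : 'I_n -> R) :
  char_poly M = \prod_i ('X - (lam i)%:P) -> perm_eq (eigvals M) (map lam (enum 'I_n)).
Proof.
move=> chM; apply/allP => x _ /=.
have chE : char_poly M = \prod_(y <- map lam (enum 'I_n)) ('X - y%:P).
  by rewrite chM big_map enumT.
have ch0 : char_poly M != 0 by rewrite monic_neq0// char_poly_monic.
rewrite -(mup_prod_XsubC x (map lam _)) -chE; apply/eqP.
rewrite /eigvals count_flatten -map_comp /=.
have urs : uniq (rootsR (char_poly M)).
  by apply: (lt_sorted_uniq (sorted_roots _ _ _)).
have [xr|xr] := boolP (x \in rootsR (char_poly M)).
  rewrite (perm_sumn (perm_map _ (perm_to_rem xr))) /= count_nseq /= eqxx mul1n.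
  rewrite (_ : sumn _ = 0%N) ?addn0//.
  rewrite sumnE big_map big_seq big1// => y.
  rewrite mem_rem_uniq// inE => /andP[yx _].
  by rewrite /= count_nseq /= (negPf yx) mul0n.
rewrite mupNroot; last first.
  by apply: contra xr => xr; rewrite -(roots_on_rootsR ch0) xr.
rewrite sumnE big_map big_seq big1// => y yr; rewrite /= count_nseq /=.
by have [yx|] := eqVneq y x; [rewrite -yx yr in xr|rewrite mul0n].
Qed.

Lemma sum_eigvals (V : nmodType) n (M : 'M[R]_n) (lam : 'I_n -> R) (f : R -> V) :
  char_poly M = \prod_i ('X - (lam i)%:P) ->
  \sum_(x <- eigvals M) f x = \sum_i f (lam i).
Proof.
by move=> /eigvals_perm lamP; rewrite (perm_big _ lamP) big_map enumT.
Qed.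

Lemma size_eigvals n (M : 'M[R]_n) : M^T = M -> size (eigvals M) = n.
Proof.
move=> /sym_spectrum[lam [/eigvals_perm/perm_size -> _]].
by rewrite size_map size_enum_ord.
Qed.

Lemma trace_resolvent n (M : 'M[R]_n) z : M^T = M -> 0 < Im z ->
  \tr (resolvent M z) = \sum_(x <- eigvals M) stieltjes_kernel z x.
Proof.
move=> /sym_spectrum[lam [ch trE]] Imz.
by rewrite (sum_eigvals _ ch) trE.
Qed.

End spectral_trace.

Section uniqueness.
Variables (R : realType) (c : R).
Hypothesis c_ge0 : 0 <= c.
Implicit Types z F G : R[i].

Lemma cubic_contractive z F : 0 < Im z -> 0 < Im F -> cubic c z F = 0 ->
  F ^+ 2 - 1 != 0 /\
  c * (normc F ^+ 2 * (normc F ^+ 2 + 1)) < normc (F ^+ 2 - 1) ^+ 2.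
Proof.
move=> Imz ImF Fz.
have F0 : F != 0 by apply/eqP => F0; move: ImF; rewrite F0 /= ltxx.
have F1 : F ^+ 2 - 1 != 0.
  rewrite subr_sqr_1 mulf_neq0//; apply/eqP => /(congr1 (@complex.Im _)).
    by rewrite ImB /= subr0 => /eqP; rewrite gt_eqF.
  by rewrite ImD /= addr0 => /eqP; rewrite gt_eqF.
split=> //.
(* Multiply [(z F + 1)(F^2 - 1) = c F^2] by the conjugate of [F (F^2 - 1)]
   and take imaginary parts. *)
have key : z * (F * F^*%C * ((F ^+ 2 - 1) * (F ^+ 2 - 1)^*%C)) =
   - F^*%C * ((F ^+ 2 - 1) * (F ^+ 2 - 1)^*%C)
   + c%:C * (F * F^*%C) * (F * (F ^+ 2 - 1)^*%C).
  have : (z * F + 1) * (F ^+ 2 - 1) = c%:C * F ^+ 2.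
    by apply/eqP; rewrite -subr_eq0 -Fz /cubic; apply/eqP; ring.
  move=> /(congr1 (fun x => x * (F^*%C * (F ^+ 2 - 1)^*%C))) H.
  apply/eqP; rewrite -subr_eq0; apply/eqP; move/eqP: H; rewrite -subr_eq0 => /eqP <-.
  by ring.
have nsq (x : R[i]) : x * x^*%C = (normc x ^+ 2)%:C.
  by rewrite -sqr_normc normc_def -rmorphXn /= sqr_normc_ReIm sqr_sqrtr// addr_ge0 ?sqr_ge0.
have := congr1 (@complex.Im _) key.
have ImZr a (x : R[i]) : Im (x * a%:C) = a * Im x by rewrite mulrC ImZ.
rewrite !nsq -!rmorphM ImD !ImZr ImZ ImN (ImM F).
have -> : Im (F^*%C) = - Im F by case: (F).
have -> : Im ((F ^+ 2 - 1)^*%C) = - (2 * Re F * Im F).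
  by case: (F) => a b /=; ring.
have -> : Re ((F ^+ 2 - 1)^*%C) = Re F ^+ 2 - Im F ^+ 2 - 1.
  by case: (F) => a b /=; ring.
have n0 : 0 < normc F ^+ 2 by rewrite exprn_gt0// lt_neqAle normc_ge0 eq_sym normc_eq0 F0.
have m0 : 0 < normc (F ^+ 2 - 1) ^+ 2.
  by rewrite exprn_gt0// lt_neqAle normc_ge0 eq_sym normc_eq0 F1.
set m := normc (F ^+ 2 - 1) ^+ 2 in m0 *.
have nE : Re F ^+ 2 = normc F ^+ 2 - Im F ^+ 2 by rewrite sqr_normc_ReIm addrK.
set q := normc F ^+ 2 in n0 nE *.
move=> H; rewrite -(ltr_pM2r ImF).
have : 0 < q * m * Im z by apply: mulr_gt0 => //; apply: mulr_gt0.
rewrite H opprK.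
suff -> : m * Im F + c * q * (Re F * - (2 * Re F * Im F) + Im F * (Re F ^+ 2 - Im F ^+ 2 - 1))
  = m * Im F - c * (q * (q + 1)) * Im F by rewrite subr_gt0.
transitivity (Im F * m + c * q * Im F * (- Re F ^+ 2 - Im F ^+ 2 - 1)); first by ring.
by rewrite nE; ring.
Qed.

(* Two distinct roots satisfy [(F^2 - 1)(G^2 - 1) = c F G (F G + 1)], which
   Cauchy-Schwarz makes incompatible with [cubic_contractive]. *)
Lemma cubic_unique z F G : 0 < Im z -> 0 < Im F -> 0 < Im G ->
  cubic c z F = 0 -> cubic c z G = 0 -> F = G.
Proof.
move=> Imz ImF ImG Fz Gz.
have [F1 Fc] := cubic_contractive Imz ImF Fz.
have [G1 Gc] := cubic_contractive Imz ImG Gz.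
apply/eqP/negPn/negP => FG; have {}FG : F - G != 0 by rewrite subr_eq0.
have F0 : F != 0 by apply/eqP => F0; move: ImF; rewrite F0 /= ltxx.
have G0 : G != 0 by apply/eqP => G0; move: ImG; rewrite G0 /= ltxx.
have key : (F ^+ 2 - 1) * (G ^+ 2 - 1) = c%:C * (F * G * (F * G + 1)).
  have HF : (z * F + 1) * (F ^+ 2 - 1) = c%:C * F ^+ 2.
    by apply/eqP; rewrite -subr_eq0 -Fz /cubic; apply/eqP; ring.
  have HG : (z * G + 1) * (G ^+ 2 - 1) = c%:C * G ^+ 2.
    by apply/eqP; rewrite -subr_eq0 -Gz /cubic; apply/eqP; ring.
  apply: (mulfI FG); apply/eqP; rewrite -subr_eq0; apply/eqP.
  transitivity (F * (F ^+ 2 - 1) * ((z * G + 1) * (G ^+ 2 - 1) - c%:C * G ^+ 2)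
    - G * (G ^+ 2 - 1) * ((z * F + 1) * (F ^+ 2 - 1) - c%:C * F ^+ 2)); first by ring.
  by rewrite HF HG !subrr !mulr0 subrr.
have nF := normc_ge0 F; have nG := normc_ge0 G.
set a := normc F in Fc nF; set b := normc G in Gc nG.
have := congr1 (@normc R) key; rewrite !normcM normc_real ger0_norm// -/a -/b.
set m := normc (F ^+ 2 - 1) in Fc *; set k := normc (G ^+ 2 - 1) in Gc * => E.
have m0 : 0 <= m := normc_ge0 _.
have k0 : 0 <= k := normc_ge0 _.
have le1 : normc (F * G + 1) <= a * b + 1.
  by apply: le_trans (le_normcD _ _) _; rewrite normcM normc1.
have le2 : (m * k) <= c * (a * b * (a * b + 1)).
  by rewrite E ler_wpM2l// ler_wpM2l// mulr_ge0.
have : (m * k) ^+ 2 <= (c * (a * b * (a * b + 1))) ^+ 2.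
  by rewrite ler_pXn2r ?nnegrE ?mulr_ge0 ?addr_ge0 ?mulr_ge0.
have le3 : (a * b + 1) ^+ 2 <= (a ^+ 2 + 1) * (b ^+ 2 + 1).
  rewrite -subr_ge0 (_ : _ - _ = (a - b) ^+ 2) ?sqr_ge0//; ring.
have : (c * (a * b * (a * b + 1))) ^+ 2 <=
  (c * (a ^+ 2 * (a ^+ 2 + 1))) * (c * (b ^+ 2 * (b ^+ 2 + 1))).
  rewrite (_ : (c * (a * b * (a * b + 1))) ^+ 2 = (c * c * (a ^+ 2 * b ^+ 2)) * (a * b + 1) ^+ 2); last by ring.
  rewrite (_ : _ * (c * _) = (c * c * (a ^+ 2 * b ^+ 2)) * ((a ^+ 2 + 1) * (b ^+ 2 + 1))); last by ring.
  by rewrite ler_wpM2l// !mulr_ge0// sqr_ge0.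
have : (c * (a ^+ 2 * (a ^+ 2 + 1))) * (c * (b ^+ 2 * (b ^+ 2 + 1))) < m ^+ 2 * k ^+ 2.
  by rewrite ltr_pM// ?mulr_ge0 ?sqr_ge0 ?addr_ge0 ?sqr_ge0.
move=> A B C; rewrite -exprMn in A.
by have := lt_le_trans A (le_trans C B); rewrite ltxx.
Qed.

End uniqueness.

(** * Function classes generated by Stieltjes kernels *)

Section poisson.
Variable R : realType.
Implicit Types (x t eta : R).

(** Imaginary part of the Stieltjes kernel at [t + i eta]. It is not normalized: its total mass is
    [pi]. *)
Definition poisson eta t x : R := eta / ((x - t) ^+ 2 + eta ^+ 2).

(** The numerator of the difference is controlled by [2 eta |y| <= y^2 + eta^2], applied to [x - t]
    and to [x - s]. *)
Lemma poisson_lip eta t s x : 0 < eta ->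
  `|poisson eta t x - poisson eta s x| <= `|t - s| / eta ^+ 2.
Proof.
move=> eta0; rewrite /poisson; set u := x - t; set w := x - s.
have e2 : 0 < eta ^+ 2 by rewrite exprn_gt0.
have U0 : 0 < u ^+ 2 + eta ^+ 2 by rewrite ltr_wpDl ?sqr_ge0.
have W0 : 0 < w ^+ 2 + eta ^+ 2 by rewrite ltr_wpDl ?sqr_ge0.
have -> : eta / (u ^+ 2 + eta ^+ 2) - eta / (w ^+ 2 + eta ^+ 2) =
   (t - s) * (eta * (w + u)) / ((u ^+ 2 + eta ^+ 2) * (w ^+ 2 + eta ^+ 2)).
  have -> : t - s = w - u by rewrite /w /u; ring.
  by field; rewrite (gt_eqF U0) (gt_eqF W0).
rewrite -mulrA normrM ler_wpM2l//.
rewrite normrM (ger0_norm (x := _^-1)) ?invr_ge0 ?mulr_ge0 ?(ltW U0) ?(ltW W0)//.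
rewrite ler_pdivrMr ?mulr_gt0// ler_pdivlMl// mulrC.
rewrite normrM (gtr0_norm eta0).
have h (y : R) : eta * `|y| *+ 2 <= y ^+ 2 + eta ^+ 2.
  have := sqr_ge0 (`|y| - eta); rewrite sqrrB real_normK ?num_real// mulrC.
  by lra.
have := h u; have := h w; have := ler_normD w u.
set a := `|w|; set b := `|u|; set P := u ^+ 2 + _; set Q := w ^+ 2 + _ => l1 l2 l3.
have PQ : eta ^+ 2 <= P by rewrite lerDr sqr_ge0.
have QP : eta ^+ 2 <= Q by rewrite lerDr sqr_ge0.
have l4 : eta * `|w + u| <= eta * a + eta * b by rewrite -mulrDr ler_pM2l.
have {}l2 : eta * a <= Q / 2 by rewrite ler_pdivlMr// mulr_natr.
have {}l3 : eta * b <= P / 2 by rewrite ler_pdivlMr// mulr_natr.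
have l5 : eta * a * eta ^+ 2 <= (Q / 2) * P.
  by rewrite ler_pM ?mulr_ge0 ?(ltW eta0) ?(ltW e2) ?normr_ge0.
have l6 : eta * b * eta ^+ 2 <= (P / 2) * Q.
  by rewrite ler_pM ?mulr_ge0 ?(ltW eta0) ?(ltW e2) ?normr_ge0.
apply: (@le_trans _ _ ((eta * a + eta * b) * eta ^+ 2)); first by rewrite ler_pM2r.
lra.
Qed.

Lemma poisson_ge0 eta t x : 0 < eta -> 0 <= poisson eta t x.
Proof. by move=> e0; rewrite divr_ge0 ?addr_ge0 ?sqr_ge0// ltW. Qed.

Lemma poisson_far eta t x kappa : 0 < eta -> 0 < kappa -> kappa <= `|x - t| ->
  poisson eta t x <= eta / kappa ^+ 2.
Proof.
move=> e0 k0 kxt; rewrite /poisson ler_wpM2l ?(ltW e0)//.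
have K : kappa ^+ 2 <= (x - t) ^+ 2 + eta ^+ 2.
  rewrite ler_wpDr ?sqr_ge0// -[leRHS]real_normK ?num_real//.
  by rewrite ler_pXn2r ?nnegrE// ltW.
by rewrite lef_pV2 ?posrE// ?exprn_gt0// (lt_le_trans _ K)// exprn_gt0.
Qed.

(** As a function of [t], [poisson] is the derivative of an arctangent. The mean value theorem and
    [poisson_lip] compare a Riemann step with an increment of [atan], so that Riemann sums are
    evaluated by telescoping instead of integration. *)
Lemma poisson_step eta (a b : R) x : 0 < eta -> a <= b ->
  `|(atan ((b - x) / eta) - atan ((a - x) / eta)) - (b - a) * poisson eta a x|
    <= (b - a) ^+ 2 / eta ^+ 2.
Proof.
move=> e0 ab.
pose f s : R := atan ((s - x) / eta).
have df (s : R) : is_derive s 1 f (poisson eta s x).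
  have dg : is_derive s 1 (fun y => (y - x) / eta) (eta^-1).
    rewrite (_ : (fun y => _) = eta^-1 *: (id - cst x)); last first.
      by apply/funext => y; rewrite mulrC.
    by apply: is_derive_eq; rewrite subr0 [LHS]mulr1.
  have := @is_derive1_comp R (@atan R) (fun y => (y - x) / eta) s _ _ (is_derive1_atan _) dg.
  have -> : atan \o (fun y => (y - x) / eta) = f by [].
  congr (is_derive _ _ _ _); rewrite /poisson.
  have e2 : 0 < eta ^+ 2 by rewrite exprn_gt0.
  have n1 : (x - s) ^+ 2 + eta ^+ 2 != 0 by rewrite gt_eqF// ltr_wpDl ?sqr_ge0.
  have n3 := gt_eqF e0.
  have -> : 1 + ((s - x) / eta) ^+ 2 = ((x - s) ^+ 2 + eta ^+ 2) / eta ^+ 2.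
    by field; rewrite n3.
  by field; rewrite n3 n1.
have [s sab ->] : exists2 s, s \in `[a, b]%R & f b - f a = poisson eta s x * (b - a).
  apply: MVT_segment => //.
  by apply: derivable_within_continuous => y _; apply: ex_derive.
rewrite mulrC -mulrBr normrM ger0_norm ?subr_ge0// expr2 -mulrA.
rewrite ler_wpM2l ?subr_ge0//.
apply: le_trans (poisson_lip _ _ _ e0) _.
rewrite ler_wpM2r ?invr_ge0 ?exprn_ge0 ?(ltW e0)//.
move: sab; rewrite in_itv /= => /andP[sa sb].
by rewrite ger0_norm ?subr_ge0// lerD2r.
Qed.

(** Heine's theorem with only [x] confined to the segment: [t] may lie outside. *)
Lemma uniform_continuity (g : R -> R) (a b eps : R) : continuous g -> 0 < eps ->
  exists2 kappa, 0 < kappa &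
    forall x t, a <= x <= b -> `|t - x| < kappa -> `|g t - g x| <= eps.
Proof.
move=> cg eps0.
have /compact_near_coveringP cpt := @segment_compact R a b.
have := cpt R (0^'+) (fun k x => forall t, `|t - x| < k -> `|g t - g x| <= eps)
  (at_right_proper_filter 0).
have : forall x, `[a, b]%classic x -> \forall x' \near x & i \near 0^'+,
    (fun k x => forall t, `|t - x| < k -> `|g t - g x| <= eps) i x'.
  move=> x _.
  have /cvgrPdist_le /(_ (eps / 2)) := cg x; rewrite divr_gt0// => /(_ isT).
  move=> /nbhs_ballP[rho /= rho0 Hrho].
  have r2 : 0 < rho / 2 by rewrite divr_gt0.
  exists (ball x (rho / 2), [set k | k < rho / 2]).
    split; first exact: nbhsx_ballx.
    exact: nbhs_right_lt.
  move=> [x' k] /= [] xx' k2 t tx'.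
  have gx' : `|g x - g x'| <= eps / 2.
    by apply: Hrho; apply: lt_trans xx' _; rewrite ltr_pdivrMr// ltr_pMr// ltr1n.
  have gt : `|g x - g t| <= eps / 2.
    apply: Hrho; rewrite /ball /=.
    have -> : x - t = (x - x') + (x' - t) by rewrite addrA subrK.
    apply: le_lt_trans (ler_normD _ _) _; rewrite [ltRHS]splitr ltrD//.
    by rewrite distrC (lt_trans tx').
  have -> : g t - g x' = (g x - g x') - (g x - g t) by ring.
  by apply: le_trans (ler_normB _ _) _; rewrite [leRHS]splitr lerD.
move=> H1 /(_ H1) H2.
have : \forall k \near 0^'+, 0 < k /\
    `[a, b]%classic `<=` (fun x => forall t, `|t - x| < k -> `|g t - g x| <= eps).
  by near=> k; split; [near: k; exact: nbhs_right_gt|near: k].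
move=> /filter_ex[k [k0 Hk]]; exists k => // x t xab; apply: Hk.
by rewrite /= in_itv.
Unshelve. all: by end_near. Qed.

End poisson.

(** * Uniformly closed linear classes: from kernels high in the half-plane to all kernels *)

Section kernel_class.
Variables (R : realType) (a0 : R) (Phi : (R -> R) -> Prop).
Hypothesis a0_gt0 : 0 < a0.
Hypothesis PhiD : forall f g, Phi f -> Phi g -> Phi (fun x => f x + g x).
Hypothesis PhiZ : forall (a : R) f, Phi f -> Phi (fun x => a * f x).
Hypothesis Phi_lim : forall f,
  (forall eps : R, 0 < eps -> exists2 g, Phi g & forall x, `|f x - g x| <= eps) -> Phi f.
Hypothesis Phi_kernel : forall z, a0 <= Im z ->
  Phi (fun x => Re (stieltjes_kernel z x)) /\ Phi (fun x => Im (stieltjes_kernel z x)).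

Let PhiC (f : R -> R[i]) := Phi (fun x => Re (f x)) /\ Phi (fun x => Im (f x)).

Let PhiCD f g : PhiC f -> PhiC g -> PhiC (fun x => f x + g x).
Proof.
move=> [f1 f2] [g1 g2]; split.
  by under eq_fun do rewrite ReD; apply: PhiD.
by under eq_fun do rewrite ImD; apply: PhiD.
Qed.

Let PhiCZ (a : R[i]) f : PhiC f -> PhiC (fun x => a * f x).
Proof.
move=> [f1 f2]; split.
  under eq_fun do rewrite ReM -mulNr; apply: PhiD; exact: PhiZ.
by under eq_fun do rewrite ImM; apply: PhiD; apply: PhiZ.
Qed.

Let PhiC_lim f :
  (forall eps : R, 0 < eps -> exists2 g, PhiC g & forall x, normc (f x - g x) <= eps) -> PhiC f.
Proof.
move=> H; split; apply: Phi_lim => eps /H[g [g1 g2] fg].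
  exists (fun x => Re (g x)) => // x.
  by rewrite -ReB (le_trans (Re_le_normc _)).
exists (fun x => Im (g x)) => // x.
by rewrite -ImB (le_trans (Im_le_normc _)).
Qed.

Let kernel_den z (x : R) : 0 < Im z -> x%:C - z != 0.
Proof.
move=> Imz; apply/eqP => /(congr1 (@complex.Im _)) /eqP.
by rewrite ImB /= sub0r oppr_eq0 gt_eqF.
Qed.

Lemma normc_kernel_le z (x : R) : 0 < Im z -> normc (stieltjes_kernel z x) <= (Im z)^-1.
Proof.
move=> Imz; rewrite normcV lef_pV2 ?posrE//.
  by rewrite (le_trans _ (Im_le_normc _))// ImB /= sub0r normrN ler_norm.
by rewrite lt_neqAle normc_ge0 eq_sym normc_eq0 kernel_den.
Qed.

Lemma kernel_resolvent_identity z w (x : R) : 0 < Im z -> 0 < Im w ->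
  stieltjes_kernel w x = stieltjes_kernel z x + (w - z) * (stieltjes_kernel z x * stieltjes_kernel w x).
Proof.
move=> Imz Imw; have := kernel_den x Imz; have := kernel_den x Imw.
by rewrite /stieltjes_kernel => ? ?; field; apply/andP.
Qed.

(** Partial fractions: a product of two kernels at distinct points is their difference divided by
    [z1 - z2], which lowers the number of factors by one. *)
Let PhiC_prod zs : (0 < size zs)%N -> uniq zs -> (forall z, z \in zs -> a0 <= Im z) ->
  PhiC (fun x => \prod_(z <- zs) stieltjes_kernel z x).
Proof.
move: {2}(size zs) (leqnn (size zs)) => n.
elim: n zs => [[]//|n IH [//|z1 [_ _ _ H|z2 s]]].
  under eq_fun do rewrite big_cons big_nil mulr1.
  by apply: Phi_kernel; apply: H; rewrite inE eqxx.
move=> /= sn _ /and3P[z12 z2s us] H.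
have I1 : a0 <= Im z1 by apply: H; rewrite inE eqxx.
have I2 : a0 <= Im z2 by apply: H; rewrite !inE eqxx orbT.
have zn : z1 - z2 != 0.
  by rewrite subr_eq0; apply: contra z12 => /eqP ->; rewrite inE eqxx.
have -> : (fun x => \prod_(z <- [:: z1, z2 & s]) stieltjes_kernel z x) =
   (fun x => (z1 - z2)^-1 * \prod_(z <- z1 :: s) stieltjes_kernel z x +
    (- (z1 - z2)^-1) * \prod_(z <- z2 :: s) stieltjes_kernel z x).
  apply/funext => x; rewrite !big_cons mulNr -mulrBr -mulrBl.
  have -> : stieltjes_kernel z1 x - stieltjes_kernel z2 x =
      (z1 - z2) * (stieltjes_kernel z2 x * stieltjes_kernel z1 x).
    rewrite {1}(kernel_resolvent_identity (z := z2) (w := z1)) ?(lt_le_trans a0_gt0)//.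
    by rewrite addrAC subrr add0r.
  by rewrite -!mulrA mulKf// mulrCA.
apply: PhiCD; apply: PhiCZ; apply: IH => //.
- rewrite /= us andbT; apply: contra z12; rewrite inE => ->; exact: orbT.
- by move=> z; rewrite inE => /predU1P[->//|zs]; apply: H; rewrite !inE zs !orbT.
- by rewrite /= z2s us.
- by move=> z; rewrite inE => /predU1P[->//|zs]; apply: H; rewrite !inE zs !orbT.
Qed.

(* Newton interpolation of [w |-> k_w] at distinct nodes above [w]: since
   [|w - z_i| < Im z_i] uniformly, the remainder decays geometrically. *)
Lemma class_kernel w : 0 < Im w ->
  Phi (fun x => Re (stieltjes_kernel w x)) /\ Phi (fun x => Im (stieltjes_kernel w x)).
Proof.
move=> Imw; have [/Phi_kernel//|wa0] := leP a0 (Im w).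
pose y i : R := a0 + i.+1%:R^-1.
pose z i : R[i] := (Re w +i* y i)%C.
have y_gt i : a0 < y i by rewrite ltrDl invr_gt0.
have y_le i : y i <= a0 + 1 by rewrite lerD2l invf_le1// ler1n.
have y0 i : 0 < y i := lt_trans a0_gt0 (y_gt i).
have z_inj : injective z.
  move=> i j [] /addrI/invr_inj/eqP; rewrite eqr_nat => /eqP[] //.
pose N m x := \sum_(j < m) (\prod_(i < j) (w - z i)) *
    \prod_(s <- map z (iota 0 j.+1)) stieltjes_kernel s x.
pose T m (x : R) := \prod_(i < m) ((w - z i) * stieltjes_kernel (z i) x).
have NE m x : stieltjes_kernel w x = N m x + T m x * stieltjes_kernel w x.
  elim: m => [|m IH]; first by rewrite /N /T !big_ord0 mul1r add0r.
  rewrite {1}IH /N /T !big_ord_recr /= -addrA; congr (_ + _).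
  rewrite {1}(kernel_resolvent_identity (z := z m) x _ Imw); last exact: y0.
  have -> : \prod_(s <- map z (iota 0 m.+1)) stieltjes_kernel s x =
      \prod_(i < m.+1) stieltjes_kernel (z i) x.
    by rewrite big_map -(big_mkord xpredT (fun i => stieltjes_kernel (z i) x)) /index_iota subn0.
  rewrite big_ord_recr /= big_split /=.
  by ring.
have PhiN m : PhiC (N m).
  rewrite /N; elim: m => [|m IH].
    under eq_fun do rewrite big_ord0.
    have := PhiCZ 0 (Phi_kernel (z := z 0%N) (ltW (y_gt _))).
    by under eq_fun do rewrite mul0r.
  under eq_fun do rewrite big_ord_recr /=.
  apply: PhiCD => //; apply: PhiCZ; apply: PhiC_prod => //.
    by have : uniq (map z (iota 0 m.+1)); rewrite ?map_inj_uniq ?iota_uniq.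
  by move=> _ /(@mapP _ _ z (iota 0 m.+1))[i _ ->]; exact: ltW (y_gt i).
(* The nodes lie above [w] at heights at most [a0 + 1], so [normc (w - z m) / Im (z m) = 1 - Im w /
   y m] is at most [theta] for every [m]. *)
set theta := 1 - Im w / (a0 + 1).
have th0 : 0 <= theta.
  by rewrite subr_ge0 ler_pdivrMr ?mul1r ?addr_gt0// (le_trans (ltW wa0))// lerDl.
have th1 : theta < 1 by rewrite ltrBlDr ltrDl divr_gt0 ?addr_gt0.
have T_le m x : normc (T m x) <= theta ^+ m.
  rewrite /T; elim: m => [|m IH]; first by rewrite big_ord0 normc1.
  rewrite big_ord_recr /= normcM exprSr ler_pM ?normc_ge0// normcM.
  have -> : normc (w - z m) = y m - Im w.
    have -> : w - z m = (Im w - y m)%:C * 'i%C.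
      by apply: complex_eqP; rewrite ?ReB ?ImB ?ReZ ?ImZ /= ?subrr ?mulr0 ?mulr1.
    rewrite normcM normc_real (_ : normc _ = 1) ?mulr1; last first.
      by rewrite /normc expr0n expr1n add0r sqrtr1.
    by rewrite distrC ger0_norm// subr_ge0 (le_trans (ltW wa0))// ltW.
  apply: (@le_trans _ _ ((y m - Im w) * (y m)^-1)).
    rewrite ler_wpM2l ?subr_ge0 ?(le_trans (ltW wa0)) ?(ltW (y_gt _))//.
    exact: (@normc_kernel_le (z m) x (y0 m)).
  rewrite mulrBl mulfV ?gt_eqF// lerD2l lerN2 ler_wpM2l ?(ltW Imw)//.
  by rewrite lef_pV2 ?posrE ?addr_gt0.
apply: PhiC_lim => eps eps0.
have [m Hm] : exists m, theta ^+ m <= eps * Im w.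
  have /cvgrPdist_le /(_ (eps * Im w)) : (fun m => theta ^+ m) @ \oo --> (0 : R).
    by apply: cvg_expr; rewrite ger0_norm.
  rewrite mulr_gt0// => /(_ isT) [m _ /(_ m (leqnn m))] /=.
  by rewrite sub0r normrN ger0_norm ?exprn_ge0//; exists m.
exists (N m) => // x.
rewrite {1}(NE m) addrAC subrr add0r normcM.
apply: (@le_trans _ _ (theta ^+ m * (Im w)^-1)).
  by rewrite ler_pM ?normc_ge0// normc_kernel_le.
by rewrite ler_pdivrMr.
Qed.

Lemma Im_kernel_poisson eta t (x : R) : 0 < eta ->
  Im (stieltjes_kernel (t +i* eta)%C x) = poisson eta t x.
Proof.
move=> e0; rewrite /stieltjes_kernel /poisson.
have -> : x%:C - (t +i* eta)%C = ((x - t) +i* (- eta))%C.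
  by apply: complex_eqP; rewrite ?ReB ?ImB //= sub0r.
by rewrite /= mulNr opprK sqrrN.
Qed.

End kernel_class.

Section poisson_class.
Variables (R : realType) (Phi : (R -> R) -> Prop).
Hypothesis PhiD : forall f g, Phi f -> Phi g -> Phi (fun x => f x + g x).
Hypothesis PhiZ : forall (a : R) f, Phi f -> Phi (fun x => a * f x).
Hypothesis Phi_lim : forall f,
  (forall eps : R, 0 < eps -> exists2 g, Phi g & forall x, `|f x - g x| <= eps) -> Phi f.
Hypothesis Phi_poisson : forall eta t, 0 < eta -> Phi (poisson eta t).

(** [pi * Q] discretizes the convolution of [g] with the Poisson kernel of width [eta]. The same sum
    [W] with [g] replaced by [1] is close to [pi] on the support of [g] and bounded everywhere, so
    [pi * (g x - Q x)] splits into [g x * (pi - W x)] and a sum weighted by [g x - g (t j)]. *)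
Lemma class_compact_support (g : R -> R) (M B : R) : 0 < M -> continuous g ->
  (forall x, M < `|x| -> g x = 0) -> (forall x, `|g x| <= B) -> Phi g.
Proof.
move=> M0 cg gM gB; pose L := M + 1.
have L0 : 0 < L by rewrite addr_gt0.
have B0 : 0 <= B by rewrite (le_trans _ (gB 0)).
have B1 : 0 < B + 1 by rewrite ltr_wpDl.
(* [3 * B] accounts for the defect [pi - W x], [pi + 1] for the nodes near [x] and [1] for the far
   ones. *)
pose K := pi + 2 + 3 * B : R.
have K0 : 0 < K by have := @pi_gt0 R; rewrite /K; lra.
apply: Phi_lim => eps0 eps00.
pose eps := eps0 * pi / K.
have e0 : 0 < eps by rewrite divr_gt0 ?mulr_gt0 ?pi_gt0.
have [kappa k0 Hk] := uniform_continuity (- L) L cg e0.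
have {}Hk x t : `|t - x| < kappa -> `|g t - g x| <= eps.
  move=> tx; have [xL|xL] := leP `|x| L; first by apply: Hk; rewrite // -ler_norml.
  have [tL|tL] := leP `|t| L; first by rewrite distrC; apply: Hk; rewrite -?ler_norml// distrC.
  rewrite !gM ?subrr ?normr0 ?(ltW e0)//; first by apply: lt_trans xL; rewrite /L ltrDl.
  by apply: lt_trans tL; rewrite /L ltrDl.
have [A A0 HA] : exists2 A : R, 0 < A & forall s, A <= s -> pi / 2 - eps <= atan s.
  have /cvgrPdist_le /(_ eps e0) [A0 [_ H]] := @cvgy_atan R.
  exists (Num.max 1 (A0 + 1)); first by rewrite lt_max ltr01.
  move=> s; rewrite ge_max => /andP[_ As].
  have := H s (lt_le_trans (ltr_pwDr ltr01 (lexx _)) As) => /=.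
  by rewrite ler_norml => /andP[_]; lra.
(* The first bound brings [atan (s / eta)] within [eps] of [pi / 2] for [s >= 1], where [1] is the
   margin [L - M]; the second makes the nodes at distance at least [kappa] from [x] negligible. *)
pose eta := Num.min A^-1 (eps * kappa ^+ 2 / (4 * (B + 1) * L)).
have eta0 : 0 < eta.
  rewrite lt_min invr_gt0 A0 /= divr_gt0//; first by rewrite mulr_gt0// exprn_gt0.
  by apply: mulr_gt0 => //; apply: mulr_gt0.
have etaA s : 1 <= s -> pi / 2 - eps <= atan (s / eta).
  move=> s1; apply: HA; rewrite ler_pdivlMr// (le_trans _ s1)//.
  by rewrite mulrC -ler_pdivlMr// div1r ge_min lexx.
have etaB : 4 * B * L * eta / kappa ^+ 2 <= eps.
  have k2 : 0 < kappa ^+ 2 by rewrite exprn_gt0.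
  have : eta <= eps * kappa ^+ 2 / (4 * (B + 1) * L) by rewrite ge_min lexx orbT.
  have D0 : 0 < 4 * (B + 1) * L by apply: mulr_gt0 => //; apply: mulr_gt0.
  rewrite ler_pdivlMr// => h.
  rewrite ler_pdivrMr// (le_trans _ h)// mulrC ler_pM2l//.
  by rewrite ler_pM2r// ler_pM2l// lerDl.
have e2 : 0 < eta ^+ 2 by rewrite exprn_gt0.
(* The mesh is chosen after the width: [J.+1] steps of length [2 L / J.+1] have a total error of
   [(2 L)^2 / (J.+1 eta^2)]. *)
have [J HJ] : exists J : nat, 4 * L ^+ 2 / eta ^+ 2 <= (Num.min eps 1) * J.+1%:R.
  have m0 : 0 < Num.min eps 1 by rewrite lt_min e0 ltr01.
  exists (Num.bound (4 * L ^+ 2 / eta ^+ 2 / Num.min eps 1)).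
  have X0 : 0 <= 4 * L ^+ 2 / eta ^+ 2 / Num.min eps 1.
    apply: divr_ge0 (ltW m0); apply: divr_ge0 (ltW e2).
    by apply: mulr_ge0 => //; apply: exprn_ge0; exact: ltW.
  rewrite [leRHS]mulrC -ler_pdivrMr// ltW// (lt_le_trans (archi_boundP X0))//.
  by rewrite ler_nat.
pose dl := 2 * L / J.+1%:R.
have dl0 : 0 < dl by rewrite divr_gt0 ?mulr_gt0.
have dlE : dl * J.+1%:R = 2 * L by rewrite /dl divfK.
pose t (j : nat) := - L + dl * j%:R.
have tS j : t j.+1 = t j + dl by rewrite /t -natr1; ring.
pose W x := \sum_(j < J.+1) dl * poisson eta (t j) x.
pose Q x := \sum_(j < J.+1) (pi^-1 * (g (t j) * dl)) * poisson eta (t j) x.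
have PhiQ : Phi Q.
  rewrite /Q; elim: J.+1 => [|n IH].
    under eq_fun do rewrite big_ord0.
    have := PhiZ 0 (Phi_poisson 0 eta0); congr Phi.
    by apply/funext => x; rewrite mul0r.
  under eq_fun do rewrite big_ord_recr /=.
  by apply: PhiD; [exact: IH|apply: PhiZ; exact: Phi_poisson].
have WE x : `|(atan ((L - x) / eta) + atan ((L + x) / eta)) - W x| <= Num.min eps 1.
  have -> : atan ((L - x) / eta) + atan ((L + x) / eta) =
     \sum_(j < J.+1) (atan ((t j.+1 - x) / eta) - atan ((t j - x) / eta)).
    rewrite -(big_mkord xpredT (fun j => atan ((t j.+1 - x) / eta) - atan ((t j - x) / eta))).
    rewrite telescope_sumr//; congr (_ + _).
      by rewrite /t dlE; congr (atan (_ / _)); ring.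
    by rewrite -atanN -mulNr /t mulr0; congr (atan (_ / _)); ring.
  rewrite /W -sumrB; apply: le_trans (ler_norm_sum _ _ _) _.
  apply: (@le_trans _ _ (\sum_(j < J.+1) dl ^+ 2 / eta ^+ 2)).
    apply: ler_sum => j _.
    have := @poisson_step _ eta (t j) (t j.+1) x eta0.
    have dE : t j + dl - t j = dl by ring.
    by rewrite tS dE lerDl => /(_ (ltW dl0)).
  rewrite sumr_const card_ord -[_ *+ _]mulr_natr.
  rewrite -(@ler_pM2r _ J.+1%:R)// (le_trans _ HJ)//.
  rewrite [leLHS](_ : _ = (dl * J.+1%:R) ^+ 2 / eta ^+ 2); last by ring.
  by rewrite dlE (_ : (2 * L) ^+ 2 = 4 * L ^+ 2)//; ring.
have W_le x : W x <= pi + 1.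
  have := WE x; rewrite le_min => /andP[_]; rewrite ler_norml => /andP[w1 _].
  have := atan_ltpi2 ((L - x) / eta); have := atan_ltpi2 ((L + x) / eta).
  by have := splitr (pi : R); set p := pi / 2; lra.
exists Q => // x.
suff H : `|pi * g x - pi * Q x| <= eps * K.
  rewrite -(@ler_pM2l _ pi) ?pi_gt0// -[X in X * `|_|]gtr0_norm ?pi_gt0//.
  rewrite -normrM mulrBr (le_trans H)// /eps divfK ?gt_eqF// mulrC.
  by [].
have -> : pi * g x - pi * Q x = g x * (pi - W x)
   + \sum_(j < J.+1) (g x - g (t j)) * (dl * poisson eta (t j) x).
  have -> : pi * Q x = \sum_(j < J.+1) g (t j) * (dl * poisson eta (t j) x).
    rewrite /Q mulr_sumr; apply: eq_bigr => j _.
    by rewrite !mulrA mulfV ?gt_eqF ?pi_gt0// mul1r.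
  have gW : g x * W x = \sum_(j < J.+1) g x * (dl * poisson eta (t j) x).
    by rewrite /W mulr_sumr.
  under [X in _ = _ + X]eq_bigr do rewrite mulrBl.
  by rewrite sumrB -gW; ring.
apply: le_trans (ler_normD _ _) _.
have -> : eps * K = B * (3 * eps) + (eps * (pi + 1) + eps) by rewrite /K; ring.
apply: lerD.
  have [xM|xM] := leP `|x| M; last first.
    by rewrite gM// mul0r normr0 mulr_ge0// mulr_ge0// ltW.
  rewrite normrM ler_pM// .
  have := WE x; rewrite le_min => /andP[+ _]; rewrite !ler_norml => /andP[w1 w2].
  move: xM; rewrite ler_norml => /andP[x1 x2].
  have a1 : pi / 2 - eps <= atan ((L - x) / eta) by apply: etaA; rewrite /L; lra.
  have a2 : pi / 2 - eps <= atan ((L + x) / eta) by apply: etaA; rewrite /L; lra.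
  have b1 := atan_ltpi2 ((L - x) / eta); have b2 := atan_ltpi2 ((L + x) / eta).
  by have := splitr (pi : R); set p := pi / 2 in a1 a2 b1 b2 * => p2; apply/andP; split; lra.
apply: le_trans (ler_norm_sum _ _ _) _.
apply: (@le_trans _ _ (\sum_(j < J.+1)
   (eps * (dl * poisson eta (t j) x) + 2 * B * (dl * (eta / kappa ^+ 2))))).
  apply: ler_sum => j _; rewrite normrM.
  have p0 := poisson_ge0 (t j) x eta0.
  have dp0 : 0 <= dl * poisson eta (t j) x by rewrite mulr_ge0 ?(ltW dl0).
  have q0 : 0 <= dl * (eta / kappa ^+ 2).
    apply: mulr_ge0; first exact: ltW.
    by apply: divr_ge0; [exact: ltW|apply: exprn_ge0; exact: ltW].
  rewrite (ger0_norm dp0).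
  have [xt|xt] := ltP `|x - t j| kappa.
    rewrite (le_trans (y := eps * (dl * poisson eta (t j) x)))//.
      by rewrite ler_wpM2r// Hk.
    by rewrite lerDl; apply: mulr_ge0 => //; apply: mulr_ge0.
  rewrite (le_trans (y := 2 * B * (dl * (eta / kappa ^+ 2))))//.
    rewrite ler_pM//; last by rewrite ler_pM2l// poisson_far.
    by apply: le_trans (ler_normB _ _) _; rewrite mulr2n mulrDl !mul1r lerD.
  by rewrite lerDr; apply: mulr_ge0 => //; exact: ltW.
rewrite big_split /= -mulr_sumr lerD//; first by rewrite ler_pM2l//; exact: W_le.
rewrite sumr_const card_ord -[_ *+ _]mulr_natr (le_trans _ etaB)//.
rewrite (_ : _ * _%:R = 2 * B * (dl * J.+1%:R) * (eta / kappa ^+ 2)); last by ring.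
rewrite dlE le_eqVlt; apply/orP; left; apply/eqP; ring.
Qed.

End poisson_class.

(** * Expectation and independence *)

Section bounded_expectation.
Context (disp : measure_display) (T : measurableType disp) (R : realType).
Variable P : probability T R.
Implicit Types f g : T -> R.

(** Bounded everywhere and not just almost everywhere: the class is stable under sums and products,
    and all its members are integrable. *)
Definition bmeas f := measurable_fun setT f /\ exists C : R, forall w, `|f w| <= C.

Definition Ex f : R := Rintegral P setT f.

Lemma bmeas_integrable f : bmeas f -> P.-integrable setT (EFin \o f).
Proof.
move=> [mf [C Cf]]; apply: measurable_bounded_integrable => //.
  by apply: le_lt_trans (probability_le1 P measurableT) _; rewrite ltry.
exists C; split; first exact: num_real.
by move=> M CM w _ /=; rewrite (le_trans (Cf w))// ltW.
Qed.

Lemma bmeas_cst (a : R) : bmeas (fun=> a).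
Proof. by split; [exact: measurable_cst|exists `|a|]. Qed.

Lemma bmeasD f g : bmeas f -> bmeas g -> bmeas (fun w => f w + g w).
Proof.
move=> [mf [C Cf]] [mg [D Dg]]; split; first exact: measurable_funD.
by exists (C + D) => w; rewrite (le_trans (ler_normD _ _))// lerD.
Qed.

Lemma bmeasM f g : bmeas f -> bmeas g -> bmeas (fun w => f w * g w).
Proof.
move=> [mf [C Cf]] [mg [D Dg]]; split; first exact: measurable_funM.
by exists (C * D) => w; rewrite normrM ler_pM.
Qed.

Lemma bmeasZ a f : bmeas f -> bmeas (fun w => a * f w).
Proof. exact/bmeasM/bmeas_cst. Qed.

Lemma bmeasN f : bmeas f -> bmeas (fun w => - f w).
Proof.
by move=> /(bmeasZ (-1)); under eq_fun do rewrite mulN1r.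
Qed.

Lemma bmeasB f g : bmeas f -> bmeas g -> bmeas (fun w => f w - g w).
Proof. by move=> bf /bmeasN; exact: bmeasD. Qed.

Lemma bmeas_norm f : bmeas f -> bmeas (fun w => `|f w|).
Proof.
move=> [mf [C Cf]]; split; first exact: measurableT_comp.
by exists C => w; rewrite normr_id.
Qed.

Lemma bmeas_sum (I : Type) (s : seq I) (Q : pred I) (f : I -> T -> R) :
  (forall i, Q i -> bmeas (f i)) -> bmeas (fun w => \sum_(i <- s | Q i) f i w).
Proof.
move=> Hf; elim: s => [|i s IH].
  by under eq_fun do rewrite big_nil; exact: bmeas_cst.
under eq_fun do rewrite big_cons.
by have [Qi|//] := boolP (Q i); apply: bmeasD => //; apply: Hf.
Qed.

Lemma ExD f g : bmeas f -> bmeas g -> Ex (fun w => f w + g w) = Ex f + Ex g.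
Proof. by move=> bf bg; rewrite /Ex RintegralD//; exact: bmeas_integrable. Qed.

Lemma ExB f g : bmeas f -> bmeas g -> Ex (fun w => f w - g w) = Ex f - Ex g.
Proof. by move=> bf bg; rewrite /Ex RintegralB//; exact: bmeas_integrable. Qed.

Lemma ExZ a f : bmeas f -> Ex (fun w => a * f w) = a * Ex f.
Proof. by move=> bf; rewrite /Ex RintegralZl//; exact: bmeas_integrable. Qed.

Lemma Ex_cst a : Ex (fun=> a) = a.
Proof. by rewrite /Ex /Rintegral integral_cst//= probability_setT mule1. Qed.

Lemma Ex_le f g : bmeas f -> bmeas g -> (forall w, f w <= g w) -> Ex f <= Ex g.
Proof. by move=> bf bg fg; apply: le_Rintegral => //; exact: bmeas_integrable. Qed.

Lemma Ex_ge0 f : (forall w, 0 <= f w) -> 0 <= Ex f.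
Proof. by move=> f0; apply: Rintegral_ge0. Qed.

Lemma Ex_sum (I : Type) (s : seq I) (Q : pred I) (f : I -> T -> R) :
  (forall i, Q i -> bmeas (f i)) ->
  Ex (fun w => \sum_(i <- s | Q i) f i w) = \sum_(i <- s | Q i) Ex (f i).
Proof.
move=> Hf; elim: s => [|i s IH].
  by under eq_fun do rewrite big_nil; rewrite Ex_cst big_nil.
under eq_fun do rewrite big_cons.
rewrite big_cons; have [Qi|//] := boolP (Q i).
rewrite ExD ?IH//; first exact: Hf.
exact: bmeas_sum.
Qed.

Lemma Ex_norm_le f : bmeas f -> `|Ex f| <= Ex (fun w => `|f w|).
Proof. by move=> bf; apply: le_normr_Rintegral => //; exact: bmeas_integrable. Qed.

(** The variance of [|f|] is nonnegative. *)
Lemma Ex_norm_sqrt f (s : R) : bmeas f -> 0 <= s -> Ex (fun w => f w ^+ 2) <= s ^+ 2 ->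
  Ex (fun w => `|f w|) <= s.
Proof.
move=> bf s0 fs; set m := Ex (fun w => `|f w|).
have m0 : 0 <= m by apply: Ex_ge0.
have bn := bmeas_norm bf.
have : 0 <= Ex (fun w => (`|f w| - m) ^+ 2) by apply: Ex_ge0 => w; exact: sqr_ge0.
have -> : (fun w => (`|f w| - m) ^+ 2) = (fun w => f w * f w - (2 * m * `|f w| - m ^+ 2)).
  by apply/funext => w; rewrite sqrrB -normrX ger0_norm ?sqr_ge0//; ring.
have b1 : bmeas (fun w => 2 * m * `|f w|) by exact: bmeasZ.
have b2 : bmeas (fun=> m ^+ 2) by exact: bmeas_cst.
rewrite ExB; [|exact: bmeasM|exact: bmeasB].
rewrite ExB// ExZ// Ex_cst -/m => h.
rewrite -(@ler_pXn2r _ 2) ?nnegrE// (le_trans _ fs)//.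
move: h; have -> : (fun w => f w ^+ 2) = (fun w => f w * f w) by apply/funext => w; exact: expr2.
by rewrite -mulrA -expr2; lra.
Qed.

Lemma Ex_indic A : measurable A -> Ex (\1_A) = fine (P A).
Proof. by move=> mA; rewrite /Ex /Rintegral integral_indic// setIT. Qed.

Lemma markov_bmeas f (a : R) : bmeas f -> (forall w, 0 <= f w) -> 0 < a ->
  fine (P [set w | a <= f w]) <= Ex f / a.
Proof.
move=> bf f0 a0.
have mA : measurable [set w | a <= f w].
  by rewrite -[X in measurable X]setTI; apply: (measurable_fun_le (f := fun=> a)) => //; exact: bf.1.
rewrite -Ex_indic// ler_pdivlMr// mulrC -ExZ; last first.
  split; first exact: measurable_indic.
  by exists 1 => w; rewrite indicE; case: (_ \in _); rewrite ?normr1 ?normr0.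
apply: Ex_le => //.
  split; first by apply: measurable_funM => //; exact: measurable_indic.
  exists `|a| => w; rewrite normrM ler_piMr// indicE.
  by case: (_ \in _); rewrite ?normr1 ?normr0.
move=> w; rewrite indicE; have [|] := boolP (w \in _); last by rewrite mulr0.
by rewrite inE /= mulr1.
Qed.

End bounded_expectation.

Section independence_product.
Context (disp : measure_display) (T : measurableType disp) (R : realType).
Variable P : probability T R.

Definition meas_wrt (F : set (set T)) (X : T -> R) :=
  forall B, measurable B -> F (X @^-1` B).

(** The joint law agrees with the product law on rectangles, hence everywhere, and Fubini's theorem
    applies. The clamps [cl] replace the coordinates, unbounded on [R], by bounded functions with
    the same values on the ranges of [X] and [Y]. *)
Lemma Ex_indep_rv (X Y : T -> R) : bmeas X -> bmeas Y ->
  (forall A B, measurable A -> measurable B ->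
     P ((X @^-1` A) `&` (Y @^-1` B)) = P (X @^-1` A) * P (Y @^-1` B))%E ->
  Ex P (fun w => X w * Y w) = Ex P X * Ex P Y.
Proof.
move=> [mX [C CX]] [mY [D DY]] indXY.
pose cl (K x : R) := Num.max (- `|K|) (Num.min `|K| x).
have mcl K : measurable_fun setT (cl K).
  by apply: measurable_maxr => //; apply: measurable_minr.
have cl_le K x : `|cl K x| <= `|K|.
  by rewrite /cl ler_norml ge_max le_max lexx /= ge_min lexx /= (le_trans _ (normr_ge0 K))// oppr_le0.
have clE K x : `|x| <= K -> cl K x = x.
  move=> xK; have K0 : 0 <= K by rewrite (le_trans _ xK).
  rewrite /cl ger0_norm//; move: xK; rewrite ler_norml => /andP[x1 x2].
  by rewrite (min_idPr x2) (max_idPr x1).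
pose mX' := MeasurableFun.Pack (MeasurableFun.Class (isMeasurableFun.Build _ _ _ _ _ mX)).
pose mY' := MeasurableFun.Pack (MeasurableFun.Class (isMeasurableFun.Build _ _ _ _ _ mY)).
have mXY : measurable_fun setT (fun w => (X w, Y w)) by exact: measurable_fun_pair.
pose mXY' := MeasurableFun.Pack (MeasurableFun.Class (isMeasurableFun.Build _ _ _ _ _ mXY)).
pose dX := distribution P mX'; pose dY := distribution P mY'.
pose dXY := distribution P mXY'.
have prodE A : measurable A -> (dX \x dY)%E A = dXY A.
  apply: product_measure_unique => A1 A2 mA1 mA2.
  by rewrite /dXY /dX /dY /distribution /pushforward /= -indXY.
pose h (z : R * R) := cl C z.1 * cl D z.2.
have mh : measurable_fun setT h.
  by apply: measurable_funM; apply: measurableT_comp.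
have bh (mu : probability (R * R)%type R) : mu.-integrable setT (EFin \o h).
  apply: bmeas_integrable; split => //; exists (`|C| * `|D|) => z.
  by rewrite normrM ler_pM.
have bcl K (mu : probability R R) : mu.-integrable setT (EFin \o cl K).
  by apply: bmeas_integrable; split => //; exists `|K|.
have XE w : X w = cl C (X w) by rewrite clE.
have YE w : Y w = cl D (Y w) by rewrite clE.
have exX : Ex P X = fine (\int[dX]_x (cl C x)%:E)%E.
  rewrite /dX integral_distribution /=; last 2 first.
  - exact/measurable_EFinP.
  - apply: bmeas_integrable; split; first exact: measurableT_comp.
    by exists `|C|.
  by rewrite /Ex /Rintegral; congr fine; apply: eq_integral => w _; rewrite /= -XE.
have exY : Ex P Y = fine (\int[dY]_x (cl D x)%:E)%E.
  rewrite /dY integral_distribution /=; last 2 first.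
  - exact/measurable_EFinP.
  - apply: bmeas_integrable; split; first exact: measurableT_comp.
    by exists `|D|.
  by rewrite /Ex /Rintegral; congr fine; apply: eq_integral => w _; rewrite /= -YE.
have exXY : Ex P (fun w => X w * Y w) = fine (\int[dXY]_z (h z)%:E)%E.
  rewrite /dXY integral_distribution /=; last 2 first.
  - exact/measurable_EFinP.
  - apply: bmeas_integrable; split; first exact: measurableT_comp.
    by exists (`|C| * `|D|) => w; rewrite normrM ler_pM.
  by rewrite /Ex /Rintegral; congr fine; apply: eq_integral => w _; rewrite /= /h /= -XE -YE.
rewrite exXY exX exY.
have -> : (\int[dXY]_z (h z)%:E = \int[(dX \x dY)]_z (h z)%:E)%E.
  by apply: eq_measure_integral => A mA _; exact/esym/prodE.
rewrite -integral12_prod_meas1; last exact: bh.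
have fY : (\int[dY]_x (cl D x)%:E)%E \is a fin_num by apply: integrable_fin_num => //; exact: bcl.
have fX : (\int[dX]_x (cl C x)%:E)%E \is a fin_num by apply: integrable_fin_num => //; exact: bcl.
rewrite (eq_integral (fun x => (fine (\int[dY]_x (cl D x)%:E))%:E * (cl C x)%:E)%E).
  rewrite integralZl//; last exact: bcl.
  by rewrite -(fineK fX) fineM// mulrC.
move=> x _; rewrite /fubini_F (fineK fY) muleC.
by rewrite -integralZl//; exact: bcl.
Qed.

End independence_product.

(** * Splitting one index off an independent family *)

Section pi_lambda.
Context (disp : measure_display) (T : measurableType disp) (R : realType).
Variable P : probability T R.

Lemma meas_wrtP (G : set (set T)) (X : T -> R) :
  meas_wrt <<s G >> X <-> measurable_fun [set: g_sigma_algebraType G] X.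
Proof.
split=> [H _ B mB|H B mB]; first by rewrite setTI; exact: H.
by have := H measurableT B mB; rewrite setTI.
Qed.

Variables (I : finType) (D : {set I}) (S : I -> set (set T)).
Hypothesis S_meas : forall i A, i \in D -> S i A -> measurable A.
Hypothesis ST : forall i, S i setT.
Hypothesis SI : forall i A B, S i A -> S i B -> S i (A `&` B).
Hypothesis S_indep : mutually_independent P D S.
Variable j : I.
Hypothesis jD : j \in D.

(** A pi-system that generates everything determined by the indices other than [j]; on it,
    independence from [S j] is a direct instance of the product formula. *)
Definition rest_gen : set (set T) :=
  [set B | exists A : I -> set T, (forall i, S i (A i)) /\
     B = \bigcap_(i in [set` D :\ j]%SET) A i].

Lemma rest_gen_meas B : rest_gen B -> measurable B.
Proof.
move=> [A [SA ->]]; apply: fin_bigcap_measurable => //.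
by move=> i /=; rewrite in_setD1 => /andP[_ iD]; apply: (S_meas iD).
Qed.

Lemma rest_gen_sub i B : i \in D -> i != j -> S i B -> rest_gen B.
Proof.
move=> iD ij SB; exists (fun k => if k == i then B else setT); split.
  by move=> k; case: eqP => [->|].
apply/seteqP; split=> [w Bw k /= _|w /(_ i)]; first by case: eqP.
by rewrite /= in_setD1 ij iD eqxx => /(_ isT).
Qed.

(** For fixed [C], the restriction [m1] of [P] to [C] and the multiple [m2] of [P] by the mass of
    [C] are finite measures that agree on the pi-system [rest_gen]. *)
Lemma rest_indep B C : <<s rest_gen >> B -> S j C -> P (B `&` C) = (P B * P C)%E.
Proof.
move=> sB SC; have mC : measurable C by exact: S_meas SC.
have PfE A : measurable A -> P A = (fine (P A))%:E.
  by move=> mA; rewrite fineK// fin_num_measure.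
pose k := NngNum (fine_ge0 (measure_ge0 P C)).
have kE : (k%:num)%:E = P C by rewrite /= -(PfE C).
pose m1 := mrestr P mC; pose m2 := mscale k P.
have -> : P (B `&` C) = m1 B by [].
have -> : (P B * P C)%E = m2 B by rewrite muleC /m2 /mscale kE.
apply: (@g_sigma_algebra_measure_unique _ _ _ rest_gen _ (fun=> setT)) => //.
- exact: rest_gen_meas.
- move=> _; exists (fun=> setT); split => //.
  by apply/seteqP; split.
- by apply/seteqP; split => // w _; exists 0%N.
- move=> _ _ [A [SA ->]] [A' [SA' ->]]; exists (fun i => A i `&` A' i); split.
    by move=> i; apply: SI.
  by rewrite bigcapI.
- move=> _ [A [SA ->]]; suff E : P (\bigcap_(i in [set` D :\ j]%SET) A i `&` C) =
      (P C * P (\bigcap_(i in [set` D :\ j]%SET) A i))%E.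
    by rewrite -kE in E; exact: E.
  pose A' i := if i == j then C else A i.
  have SA' i : S i (A' i) by rewrite /A'; case: eqP => [->|].
  have -> : \bigcap_(i in [set` D :\ j]%SET) A i `&` C = \bigcap_(i in [set` D]) A' i.
    apply/seteqP; split=> [w [/= Aw Cw] i /= iD|w /= A'w].
      rewrite /A'; case: eqP => [//|/eqP ij].
      by apply: Aw; rewrite /= in_setD1 ij.
    split; last by have := A'w j jD; rewrite /A' eqxx.
    move=> i /=; rewrite in_setD1 => /andP[/negPf ij iD].
    by have := A'w i iD; rewrite /A' ij.
  rewrite (S_indep (subxx _))//.
  rewrite (S_indep (subD1set _ _))//.
  rewrite (big_setD1 j)//= {1}/A' eqxx EFinM -(PfE C)//; congr (_ * (_)%:E)%E.
  apply: eq_bigr => i; rewrite in_setD1 => /andP[/negPf ij _].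
  by rewrite /A' ij.
- move=> _; suff : (P (setT `&` C) < +oo)%E by [].
  by rewrite setTI (le_lt_trans (probability_le1 P mC))// ltry.
Qed.

Lemma Ex_rest_indep (X Y : T -> R) : bmeas X -> bmeas Y ->
  meas_wrt <<s rest_gen >> X -> meas_wrt (S j) Y ->
  Ex P (fun w => X w * Y w) = Ex P X * Ex P Y.
Proof.
move=> bX bY mX mY; apply: Ex_indep_rv => // A B mA mB.
by apply: rest_indep; [exact: mX|exact: mY].
Qed.

End pi_lambda.

Section joint_independence.
Context (disp : measure_display) (T : measurableType disp) (R : realType).
Variable P : probability T R.
Variables (I1 I2 : finType) (D1 : {set I1}) (D2 : {set I2}).
Variables (S1 : I1 -> set (set T)) (S2 : I2 -> set (set T)) (G1 G2 : set (set T)).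

Definition sum_set : {set I1 + I2} :=
  [set x | match x with inl i => i \in D1 | inr i => i \in D2 end]%SET.

Definition sum_fam (x : I1 + I2) : set (set T) :=
  match x with inl i => S1 i | inr i => S2 i end.

Hypothesis ind1 : mutually_independent P D1 S1.
Hypothesis ind2 : mutually_independent P D2 S2.
Hypothesis ind12 : independent2 P <<s G1 >> <<s G2 >>.
Hypothesis S1G : forall i A, i \in D1 -> S1 i A -> <<s G1 >> A.
Hypothesis S2G : forall i A, i \in D2 -> S2 i A -> <<s G2 >> A.

(** Independence within each family and between the two merges into one family over [I1 + I2], from
    which the vector or the weight of a single edge can be split off against all the rest. *)
Lemma joint_independence : mutually_independent P sum_set sum_fam.
Proof.
move=> K A KD SA.
pose K1 : {set I1} := [set i | inl i \in K]%SET.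
pose K2 : {set I2} := [set i | inr i \in K]%SET.
have KD1 : K1 \subset D1.
  by apply/fintype.subsetP => i; rewrite inE => /(fintype.subsetP KD); rewrite inE.
have KD2 : K2 \subset D2.
  by apply/fintype.subsetP => i; rewrite inE => /(fintype.subsetP KD); rewrite inE.
have -> : \bigcap_(i in [set` K]) A i = \bigcap_(i in [set` K1]) A (inl i) `&`
    \bigcap_(i in [set` K2]) A (inr i).
  apply/seteqP; split=> [w Aw|w [Aw1 Aw2] [i|i] /= iK].
  - by split=> i /=; rewrite inE => iK; apply: Aw.
  - by apply: Aw1; rewrite /= inE.
  - by apply: Aw2; rewrite /= inE.
have bG (J : finType) (G : set (set T)) (K0 : {set J}) (A0 : J -> set T) :
    (forall i, i \in K0 -> <<s G >> (A0 i)) -> <<s G >> (\bigcap_(i in [set` K0]) A0 i).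
  move=> H.
  exact: (@fin_bigcap_measurable _ (g_sigma_algebraType G) J [set` K0] A0 (finite_finpred K0) H).
rewrite ind12; first last.
- by apply: bG => i iK; apply: S2G; [exact: (fintype.subsetP KD2 _ iK)|apply: (SA (inr i)); rewrite inE in iK].
- by apply: bG => i iK; apply: S1G; [exact: (fintype.subsetP KD1 _ iK)|apply: (SA (inl i)); rewrite inE in iK].
rewrite ind1//; last by move=> i; rewrite inE => /SA.
rewrite ind2//; last by move=> i; rewrite inE => /SA.
rewrite -EFinM; congr EFin.
rewrite [RHS]big_mkcond big_sumType /= -!big_mkcond /=.
by congr (_ * _); apply: eq_bigl => i; rewrite inE.
Qed.

End joint_independence.

(** * Measurability of resolvents *)

Section complex_measurability.
Context (disp : measure_display) (T : measurableType disp) (R : realType).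
Implicit Types f g : T -> R[i].

Definition cmeas f := measurable_fun setT (fun w => Re (f w)) /\
  measurable_fun setT (fun w => Im (f w)).

Lemma cmeas_cst a : cmeas (fun=> a).
Proof. by split; exact: measurable_cst. Qed.

Lemma cmeas_real (f : T -> R) : measurable_fun setT f -> cmeas (fun w => (f w)%:C).
Proof. by move=> mf; split => //=; exact: measurable_cst. Qed.

Lemma cmeasD f g : cmeas f -> cmeas g -> cmeas (fun w => f w + g w).
Proof.
move=> [f1 f2] [g1 g2]; split.
  by under eq_fun do rewrite ReD; exact: measurable_funD.
by under eq_fun do rewrite ImD; exact: measurable_funD.
Qed.

Lemma cmeasM f g : cmeas f -> cmeas g -> cmeas (fun w => f w * g w).
Proof.
move=> [f1 f2] [g1 g2]; split.
  under eq_fun do rewrite ReM.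
  by apply: measurable_funB; exact: measurable_funM.
under eq_fun do rewrite ImM.
by apply: measurable_funD; exact: measurable_funM.
Qed.

Lemma cmeasN f : cmeas f -> cmeas (fun w => - f w).
Proof.
by move=> /(cmeasM (cmeas_cst (-1))); under eq_fun do rewrite mulN1r.
Qed.

Lemma cmeasB f g : cmeas f -> cmeas g -> cmeas (fun w => f w - g w).
Proof. by move=> cf /cmeasN; exact: cmeasD. Qed.

Lemma cmeas_sum (I : Type) (s : seq I) (Q : pred I) (f : I -> T -> R[i]) :
  (forall i, Q i -> cmeas (f i)) -> cmeas (fun w => \sum_(i <- s | Q i) f i w).
Proof.
move=> Hf; elim: s => [|i s IH].
  by under eq_fun do rewrite big_nil; exact: cmeas_cst.
under eq_fun do rewrite big_cons.
by have [Qi|//] := boolP (Q i); apply: cmeasD => //; apply: Hf.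
Qed.

Lemma cmeas_prod (I : Type) (s : seq I) (Q : pred I) (f : I -> T -> R[i]) :
  (forall i, Q i -> cmeas (f i)) -> cmeas (fun w => \prod_(i <- s | Q i) f i w).
Proof.
move=> Hf; elim: s => [|i s IH].
  by under eq_fun do rewrite big_nil; exact: cmeas_cst.
under eq_fun do rewrite big_cons.
by have [Qi|//] := boolP (Q i); apply: cmeasM => //; apply: Hf.
Qed.

Lemma cmeas_normc_sqr f : cmeas f -> measurable_fun setT (fun w => normc (f w) ^+ 2).
Proof.
move=> [f1 f2]; under eq_fun do rewrite sqr_normc_ReIm.
by apply: measurable_funD; apply: measurable_funX.
Qed.

Lemma measurable_normc f : cmeas f -> measurable_fun setT (fun w => normc (f w)).
Proof.
move=> cf; have -> : (fun w => normc (f w)) = (fun w => Num.sqrt (normc (f w) ^+ 2)).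
  by apply/funext => w; rewrite sqrtr_sqr ger0_norm// normc_ge0.
apply: measurableT_comp (cmeas_normc_sqr cf).
by apply: continuous_measurable_fun; exact: sqrt_continuous.
Qed.

Lemma measurable_invr : measurable_fun setT (fun x : R => x^-1).
Proof.
have -> : [set: R] = [set 0] `|` ~` [set 0] by rewrite setUv.
apply/measurable_funU => //; first exact: measurableC.
split; first exact: measurable_fun_set1.
apply: open_continuous_measurable_fun.
  by rewrite openC; exact: closed_eq.
by move=> x; rewrite inE /= => /eqP; exact: inv_continuous.
Qed.

Lemma cmeasV f : cmeas f -> cmeas (fun w => (f w)^-1).
Proof.
move=> cf; have [f1 f2] := cf.
have mi : measurable_fun setT (fun w => (normc (f w) ^+ 2)^-1).
  exact: measurableT_comp measurable_invr (cmeas_normc_sqr cf).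
have VE (z : R[i]) : Re z^-1 = Re z * (normc z ^+ 2)^-1 /\ Im z^-1 = (- Im z) * (normc z ^+ 2)^-1.
  by rewrite sqr_normc_ReIm; case: z => a b; split => //=; rewrite mulNr.
split.
  by under eq_fun do rewrite (VE _).1; exact: measurable_funM.
under eq_fun do rewrite (VE _).2; apply: measurable_funM => //.
exact: measurableT_comp.
Qed.

Definition mxmeas m n (A : T -> 'M[R[i]]_(m, n)) := forall i j, cmeas (fun w => A w i j).

Lemma mxmeasM m n p (A : T -> 'M[R[i]]_(m, n)) (B : T -> 'M[R[i]]_(n, p)) :
  mxmeas A -> mxmeas B -> mxmeas (fun w => A w *m B w).
Proof.
move=> mA mB i j; under eq_fun do rewrite mxE.
by apply: cmeas_sum => k _; exact: cmeasM.
Qed.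

Lemma mxmeas_tr m n (A : T -> 'M[R[i]]_(m, n)) : mxmeas A -> mxmeas (fun w => (A w)^T).
Proof. by move=> mA i j; under eq_fun do rewrite mxE; exact: mA. Qed.

Lemma mxmeas_cst m n (A : 'M[R[i]]_(m, n)) : mxmeas (fun=> A).
Proof. by move=> i j; exact: cmeas_cst. Qed.

Lemma mxmeas_real m n (A : T -> 'M[R]_(m, n)) :
  (forall i j, measurable_fun setT (fun w => A w i j)) ->
  mxmeas (fun w => map_mx (real_complex R) (A w)).
Proof. by move=> mA i j; under eq_fun do rewrite mxE; exact: cmeas_real. Qed.

Lemma cmeas_trace n (A : T -> 'M[R[i]]_n) : mxmeas A -> cmeas (fun w => \tr (A w)).
Proof. by move=> mA; rewrite /mxtrace; apply: cmeas_sum => i _. Qed.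

Lemma cmeas_det n (A : T -> 'M[R[i]]_n) : mxmeas A -> cmeas (fun w => \det (A w)).
Proof.
move=> mA; rewrite /determinant; apply: cmeas_sum => s _.
by apply: cmeasM; [exact: cmeas_cst|apply: cmeas_prod => i _].
Qed.

(** Cramer's formula: the entries of the inverse are cofactors divided by the determinant. *)
Lemma mxmeas_inv n (A : T -> 'M[R[i]]_n) : mxmeas A ->
  (forall w, A w \in unitmx) -> mxmeas (fun w => invmx (A w)).
Proof.
move=> mA uA i j.
have -> : (fun w => invmx (A w) i j) = (fun w => (\det (A w))^-1 * cofactor (A w) j i).
  by apply/funext => w; rewrite /invmx uA !mxE.
apply: cmeasM; first by apply/cmeasV/cmeas_det.
rewrite /cofactor; apply: cmeasM; first exact: cmeas_cst.
apply: cmeas_det => k l; under eq_fun do rewrite !mxE.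
exact: mA.
Qed.

Lemma mxmeas_resolvent n (M : T -> 'M[R]_n) z : 0 < Im z -> (forall w, (M w)^T = M w) ->
  (forall i j, measurable_fun setT (fun w => M w i j)) ->
  mxmeas (fun w => resolvent (M w) z).
Proof.
move=> Imz symM mM; apply: mxmeas_inv => [i j|w]; last exact: shift_unit.
under eq_fun do rewrite mxE.
apply: cmeasD; first exact: mxmeas_real.
exact: cmeas_cst.
Qed.

Lemma cmeas_bil n (x y : T -> 'cV[R]_n) (G : T -> 'M[R[i]]_n) :
  (forall i, measurable_fun setT (fun w => x w i 0)) ->
  (forall i, measurable_fun setT (fun w => y w i 0)) ->
  mxmeas G -> cmeas (fun w => bil (x w) (G w) (y w)).
Proof.
move=> mx my mG; apply: mxmeasM; last apply: mxmeasM => //.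
  apply: mxmeas_tr; apply: mxmeas_real => i j; rewrite ord1; exact: mx.
by apply: mxmeas_real => i j; rewrite ord1; exact: my.
Qed.

Variables (r d : nat).
Local Notation edge := ('I_r * 'I_r)%type.
Variables (xi : 'I_r -> 'I_r -> T -> R) (v : 'I_r -> 'I_r -> T -> 'cV[R]_d).
Local Notation XI w := (fun k l => xi k l w).
Local Notation V w := (fun k l => v k l w).

Lemma measurable_edge (e : edge) :
  (forall i, measurable_fun setT (fun w => v e.1 e.2 w i 0)) ->
  (forall i, measurable_fun setT (fun w => edge_l (V w) e i 0)) /\
  (forall i, measurable_fun setT (fun w => edge_r (V w) e i 0)).
Proof.
move=> mv; split=> i; rewrite /edge_l /edge_r; under eq_fun do rewrite mxE.
  by apply: measurable_sum => j; apply: measurable_funM => //; exact: mv.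
by apply: measurable_sum => j; apply: measurable_funM => //; exact: mv.
Qed.

(** [Q] marks the visible edges. Where [xi] vanishes nothing is asked of [v], so a matrix with a cut
    edge is measurable for a sigma-algebra that ignores the vector of that edge. *)
Lemma measurable_Amx (Q : pred edge) :
  (forall e : edge, (e.1 < e.2)%N -> ~~ Q e -> forall w, xi e.1 e.2 w = 0) ->
  (forall e : edge, (e.1 < e.2)%N -> Q e -> measurable_fun setT (xi e.1 e.2)) ->
  (forall e : edge, (e.1 < e.2)%N -> Q e ->
     forall i, measurable_fun setT (fun w => v e.1 e.2 w i 0)) ->
  forall i j, measurable_fun setT (fun w => Amx (XI w) (V w) i j).
Proof.
move=> xi0 mxi mv i j; under eq_fun do rewrite AmxE summxE big_mkcond.
apply: measurable_sum => e; have [he|_] := boolP (e.1 < e.2)%N; last exact: measurable_cst.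
have [Qe|Qe] := boolP (Q e); last first.
  by under eq_fun do rewrite (xi0 _ he Qe) scale0r mxE; exact: measurable_cst.
have [ml mr] := measurable_edge (mv _ he Qe).
have E w : (xi e.1 e.2 w *: edge_mx (V w) e) i j =
    xi e.1 e.2 w * (edge_l (V w) e i 0 * edge_r (V w) e j 0 +
      edge_r (V w) e i 0 * edge_l (V w) e j 0).
  have T1 (x y : 'cV[R]_(\sum_(k < r) d)) : (x *m y^T) i j = x i 0 * y j 0.
    by rewrite mxE big_ord1 [y^T _ _]mxE.
  by rewrite mxE /edge_mx mxE !T1.
under eq_fun do rewrite E.
apply: measurable_funM; first exact: mxi.
by apply: measurable_funD; apply: measurable_funM.
Qed.

Lemma mxmeas_cblock (G : T -> 'M[R[i]]_(\sum_(k < r) d)) k l :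
  mxmeas G -> mxmeas (fun w => cblock (d := d) (G w) k l).
Proof.
move=> mG; apply: mxmeasM; last exact: mxmeas_cst.
by apply: mxmeasM => //; exact: mxmeas_cst.
Qed.

End complex_measurability.

(** * Contractions and the uniform variance bound *)

Section operator_norm.
Variables (R : realType) (n : nat).
Implicit Types (D : 'M[R]_n) (x : 'cV[R]_n).

Lemma dotv_ge0 x : 0 <= dotv x x.
Proof. by apply: sumr_ge0 => i _; rewrite -expr2 sqr_ge0. Qed.

Lemma norm2_ge0 x : 0 <= norm2 x. Proof. exact: sqrtr_ge0. Qed.

Lemma sqr_norm2 x : norm2 x ^+ 2 = dotv x x.
Proof. by rewrite sqr_sqrtr// dotv_ge0. Qed.

Lemma dotvZ (a : R) x : dotv (a *: x) (a *: x) = a ^+ 2 * dotv x x.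
Proof. by rewrite /dotv mulr_sumr; apply: eq_bigr => i _; rewrite !mxE; ring. Qed.

Lemma norm2Z (a : R) x : 0 <= a -> norm2 (a *: x) = a * norm2 x.
Proof. by move=> a0; rewrite /norm2 dotvZ sqrtrM ?sqr_ge0// sqrtr_sqr ger0_norm. Qed.

Lemma norm2_0 : norm2 (0 : 'cV[R]_n) = 0.
Proof. by rewrite -(scale0r 0) norm2Z// mul0r. Qed.

Definition contractive D := forall x, dotv (D *m x) (D *m x) <= dotv x x.

Lemma contractive_norm2 D x : contractive D -> norm2 (D *m x) <= norm2 x.
Proof. by move=> cD; rewrite /norm2 ler_sqrt// dotv_ge0. Qed.

Lemma opnorm_le D (K : R) : (forall x, norm2 x <= 1 -> norm2 (D *m x) <= K) ->
  opnorm D <= K.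
Proof.
move=> DK; apply: ge_sup => [|_ [x /= x1 <-]]; last exact: DK.
by exists (norm2 (D *m 0)), 0 => //=; rewrite norm2_0.
Qed.

(** Contractivity supplies an upper bound of the set whose supremum is [opnorm D]. *)
Lemma opnorm_ge D x : contractive D -> norm2 x <= 1 -> norm2 (D *m x) <= opnorm D.
Proof.
move=> cD x1; apply: ub_le_sup; last by exists x.
by exists 1 => _ [y /= y1 <-]; rewrite (le_trans (contractive_norm2 _ cD)).
Qed.

(** The variance condition speaks of matrices of norm exactly [1]; a nonzero contraction is brought
    into that class by rescaling. *)
Lemma opnorm_normalize D : contractive D -> 0 < opnorm D ->
  opnorm ((opnorm D)^-1 *: D) = 1.
Proof.
move=> cD D0; have K1 : 0 <= (opnorm D)^-1 by rewrite invr_ge0 ltW.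
apply/eqP; rewrite eq_le; apply/andP; split.
  apply: opnorm_le => x x1; rewrite -scalemxAl norm2Z// mulrC ler_pdivrMr// mul1r.
  exact: opnorm_ge.
rewrite leNgt; apply/negP => lt1.
pose K := opnorm ((opnorm D)^-1 *: D).
have bnd x : norm2 x <= 1 -> norm2 (D *m x) <= opnorm D * K.
  move=> x1; rewrite mulrC -ler_pdivrMr// mulrC -norm2Z// scalemxAl.
  apply: ub_le_sup; last by exists x.
  exists ((opnorm D)^-1) => _ [y /= y1 <-].
  rewrite -scalemxAl norm2Z// ler_piMr//.
  by rewrite (le_trans (contractive_norm2 _ cD)).
have := opnorm_le bnd; rewrite ler_pMr// => /(lt_le_trans lt1).
by rewrite ltxx.
Qed.

Lemma opnorm0_eq0 D : contractive D -> opnorm D <= 0 -> D = 0.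
Proof.
move=> cD D0; apply/matrixP => i j; rewrite mxE.
pose x : 'cV[R]_n := delta_mx j 0.
have x1 : norm2 x <= 1.
  rewrite /norm2 /dotv (bigD1 j)//= big1 ?addr0 => [|k /negPf kj].
    by rewrite !mxE !eqxx mulr1 sqrtr1.
  by rewrite !mxE kj mul0r.
have := le_trans (opnorm_ge cD x1) D0.
rewrite -(@ler_pXn2r _ 2) ?nnegrE ?norm2_ge0// sqr_norm2 expr0n /= => h.
have : (D *m x) i 0 ^+ 2 <= 0.
  apply: le_trans h; rewrite /dotv (bigD1 i)//= expr2 lerDl.
  by apply: sumr_ge0 => k _; rewrite -expr2 sqr_ge0.
have -> : (D *m x) i 0 = D i j.
  rewrite mxE (bigD1 j)//= big1 ?addr0 => [|k /negPf kj]; rewrite !mxE.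
    by rewrite !eqxx mulr1.
  by rewrite kj mulr0.
by move=> Dij; apply/eqP; rewrite -sqrf_eq0 eq_le Dij sqr_ge0.
Qed.

End operator_norm.

Section uniform_in_matrix.
Variables (R : realType) (d : nat -> nat).
Variable W : forall r, 'M[R]_(d r) -> 'I_r * 'I_r -> \bar R.
Hypothesis d_gt0 : forall r, (0 < d r)%N.
Hypothesis d_oo : d r @[r --> \oo] --> \oo.
Hypothesis W_cvg : forall D : (forall n, 'M[R]_n),
  (forall n, (0 < n)%N -> opnorm (D n) = 1) ->
  ereal_sup [set W (D (d r)) kl | kl in [set kl : 'I_r * 'I_r | (kl.1 < kl.2)%N]]
    @[r --> \oo] --> (0 : \bar R).

Lemma opnorm1 n : (0 < n)%N -> opnorm (1%:M : 'M[R]_n) = 1.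
Proof.
move=> n0; have c1 : contractive (1%:M : 'M[R]_n) by move=> x; rewrite mul1mx.
apply/eqP; rewrite eq_le; apply/andP; split.
  by apply: opnorm_le => x x1; rewrite mul1mx.
pose x : 'cV[R]_n := delta_mx (Ordinal n0) 0.
have x1 : norm2 x = 1.
  rewrite /norm2 /dotv (bigD1 (Ordinal n0))//= big1 ?addr0 => [|k /negPf kj].
    by rewrite !mxE !eqxx mulr1 sqrtr1.
  by rewrite !mxE kj mul0r.
by rewrite -[leLHS]x1 -{1}[x]mul1mx opnorm_ge// x1.
Qed.

(* A failure of uniformity along infinitely many [r] would assemble, since
   [d] tends to infinity, into a single bad sequence [D]. *)
Lemma uniform_in_matrix (eps : R) : 0 < eps ->
  \forall r \near \oo, forall D : 'M[R]_(d r), opnorm D = 1 ->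
    forall kl : 'I_r * 'I_r, (kl.1 < kl.2)%N -> (W D kl <= eps%:E)%E.
Proof.
move=> eps0; apply: contrapT => nfar.
pose bad r := exists2 D : 'M[R]_(d r), opnorm D = 1 &
  exists2 kl : 'I_r * 'I_r, (kl.1 < kl.2)%N & ~ (W D kl <= eps%:E)%E.
have badP N : exists2 r, (N <= r)%N & bad r.
  apply: contrapT => nb; apply: nfar; exists N => // r Nr D D1 kl klt.
  by apply: contrapT => nW; apply: nb; exists r => //; exists D => //; exists kl.
(* One matrix per dimension, not per index: [d] need not be injective, so [M] is bad for some [r] of
   dimension [n] and not for a prescribed one. *)
have pick_ n : exists M : 'M[R]_n, ((0 < n)%N -> opnorm M = 1) /\
    ((exists2 r, d r = n & bad r) -> exists r (e : d r = n),
      exists2 kl : 'I_r * 'I_r, (kl.1 < kl.2)%N &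
        ~ (W (castmx (esym e, esym e) M) kl <= eps%:E)%E).
  have [[r <- [D D1 [kl klt nW]]]|nb] := pselect (exists2 r, d r = n & bad r).
    exists D; split => // _; exists r, erefl; exists kl => //.
  by exists 1%:M; split => //; exact: opnorm1.
pose D n := sval (cid (pick_ n)).
have D1 n : (0 < n)%N -> opnorm (D n) = 1.
  by rewrite /D; case: cid => M [].
have Dbad n : (exists2 r, d r = n & bad r) -> exists r (e : d r = n),
    exists2 kl : 'I_r * 'I_r, (kl.1 < kl.2)%N &
      ~ (W (castmx (esym e, esym e) (D n)) kl <= eps%:E)%E.
  by rewrite /D; case: cid => M [].
have castD m n (e : m = n) : castmx (esym e, esym e) (D n) = D m.
  by case: _ / e; rewrite castmx_id.
have [r0 _ Hr0] : \forall r \near \oo, (ereal_sup [set W (D (d r)) kl | kl in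
    [set kl : 'I_r * 'I_r | (kl.1 < kl.2)%N]] < eps%:E)%E.
  have /(W_cvg D1) : nbhs (0 : \bar R)%E [set y | (y < eps%:E)%E]; last by [].
  apply: open_nbhs_nbhs.
  by split; [exact: open_ereal_lt_ereal|rewrite /= lte_fin].
(* From [r1] on the dimension exceeds every [d i] with [i < r0]. Hence the index [r'] found below,
   which shares the dimension of [r] but may differ from it, is still at least [r0]. *)
have [r1 _ Hr1] : \forall r \near \oo, (\max_(i < r0) d i < d r)%N.
  have /cvgnyPgt := d_oo; apply.
have [r r1r rbad] := badP r1.
have [r' [e [kl klt]]] := Dbad (d r) (ex_intro2 _ _ r erefl rbad).
rewrite castD; apply.
have r0r' : (r0 <= r')%N.
  rewrite leqNgt; apply/negP => r'r0.
  have := Hr1 r r1r; rewrite /= -e ltnNge => /negP; apply.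
  exact: (leq_bigmax (Ordinal r'r0)).
apply: le_trans (ltW (Hr0 _ r0r')).
by apply: ereal_sup_ubound; exists kl.
Qed.

End uniform_in_matrix.

(** * The local law *)

Section fixed_size.
Context (disp : measure_display) (T : measurableType disp) (R : realType).
Variable P : probability T R.
Variables (r d : nat) (c C0 p se : R).
Local Notation edge := ('I_r * 'I_r)%type.
Variables (xi : 'I_r -> 'I_r -> T -> R) (v : 'I_r -> 'I_r -> T -> 'cV[R]_d).
(* [GS (inl e)] generates the sigma-algebra of [v e], [GS (inr e)] that of [xi e];
   [se] bounds standard deviations of quadratic forms. *)
Variable GS : edge + edge -> set (set T).
Definition edges : {set edge} := [set e : edge | (e.1 < e.2)%N]%SET.
Hypotheses (d_gt0 : (0 < d)%N) (r_gt0 : (0 < r)%N) (p01 : 0 <= p <= 1).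
Hypotheses (C0_ge0 : 0 <= C0) (se_ge0 : 0 <= se).
Hypothesis GS_meas : forall j, j \in sum_set edges edges -> GS j `<=` measurable.
Hypothesis GS_indep :
  mutually_independent P (sum_set edges edges) (fun j => <<s GS j >>).
Hypothesis xi01 : forall e : edge, (e.1 < e.2)%N -> forall w, xi e.1 e.2 w = 0 \/ xi e.1 e.2 w = 1.
Hypothesis v_le : forall e : edge, (e.1 < e.2)%N -> forall w,
  dotv (v e.1 e.2 w) (v e.1 e.2 w) <= C0.
Hypothesis xi_wrt : forall e : edge, (e.1 < e.2)%N -> meas_wrt <<s GS (inr e) >> (xi e.1 e.2).
Hypothesis v_wrt : forall e : edge, (e.1 < e.2)%N -> forall i,
  meas_wrt <<s GS (inl e) >> (fun w => v e.1 e.2 w i 0).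
Hypothesis Exi : forall e : edge, (e.1 < e.2)%N -> Ex P (xi e.1 e.2) = p.

(** Entry of [v v^T - d^-1 I]. Paired with a matrix [D], these entries give [(D v, v)] minus its
    mean. *)
Definition cov_entry (e : edge) (a : 'I_d * 'I_d) (w : T) : R :=
  v e.1 e.2 w a.1 0 * v e.1 e.2 w a.2 0 - (a.1 == a.2)%:R / d%:R.

Hypothesis quad_var : forall (e : edge) (D : 'M[R]_d), (e.1 < e.2)%N -> contractive D ->
  Ex P (fun w => (\sum_a D a.1 a.2 * cov_entry e a w) ^+ 2) <= se ^+ 2.

Variables (z F : R[i]).
Hypotheses (z_ge8 : 8 <= Im z) (z_geC : C0 <= Im z).
Hypotheses (F_le : normc F <= 2^-1) (F_root : cubic c z F = 0).

Local Notation XI w := (fun k l => xi k l w).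
Local Notation V w := (fun k l => v k l w).
Local Notation Gcut w e := (cut_resolvent (XI w) (V w) z e).
Local Notation rest j := (rest_gen (sum_set edges edges) (fun i0 => <<s GS i0 >>) j).

Let Imz : 0 < Im z. Proof. by rewrite (lt_le_trans _ z_ge8). Qed.

Let sigma_meas j A : j \in sum_set edges edges -> <<s GS j >> A -> measurable A.
Proof.
move=> jD; apply: smallest_sub; last exact: GS_meas.
exact: sigma_algebra_measurable.
Qed.

Let inlD (e : edge) : (inl e \in sum_set edges edges) = (e.1 < e.2)%N.
Proof. by rewrite !inE. Qed.

Let inrD (e : edge) : (inr e \in sum_set edges edges) = (e.1 < e.2)%N.
Proof. by rewrite !inE. Qed.

Let meas_of_wrt j (X : T -> R) : j \in sum_set edges edges -> meas_wrt <<s GS j >> X -> measurable_fun setT X.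
Proof. by move=> jD HX _ B mB; rewrite setTI; apply: (sigma_meas jD); exact: HX. Qed.

Let rest_of_wrt j i (X : T -> R) : j \in sum_set edges edges -> i \in sum_set edges edges -> i != j ->
  meas_wrt <<s GS i >> X -> meas_wrt <<s rest j >> X.
Proof.
move=> jD iD ij HX B mB; apply: sub_sigma_algebra.
have ST k : (fun j => <<s GS j >>) k setT.
  exact: (@measurableT _ (g_sigma_algebraType (GS k))).
exact: (rest_gen_sub ST iD ij (HX B mB)).
Qed.

Let meas_of_rest j (X : T -> R) : j \in sum_set edges edges -> meas_wrt <<s rest j >> X ->
  measurable_fun setT X.
Proof.
move=> jD HX _ B mB; rewrite setTI.
have : <<s rest j >> `<=` measurable.
  apply: smallest_sub; first exact: sigma_algebra_measurable.
  by move=> A /rest_gen_meas; apply => i A' iD; exact: sigma_meas.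
by apply; exact: HX.
Qed.

Let rest_indepE j (X Y : T -> R) : j \in sum_set edges edges -> bmeas X -> bmeas Y ->
  meas_wrt <<s rest j >> X -> meas_wrt <<s GS j >> Y ->
  Ex P (fun w => X w * Y w) = Ex P X * Ex P Y.
Proof.
move=> jD bX bY; apply: (@Ex_rest_indep _ _ _ P _ _
  (fun j => <<s GS j >>) _ _ _ GS_indep j jD X Y bX bY).
- by move=> i A; exact: sigma_meas.
- by move=> i; exact: (@measurableT _ (g_sigma_algebraType (GS i))).
- move=> i A B SA SB.
  exact: (@measurableI _ (g_sigma_algebraType (GS i)) A B).
Qed.

Let bxi (e : edge) : (e.1 < e.2)%N -> bmeas (xi e.1 e.2).
Proof.
move=> he; split; first by apply: (@meas_of_wrt (inr e)); rewrite ?inrD//; exact: xi_wrt.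
by exists 1 => w; have [->|->] := xi01 he w; rewrite ?normr0 ?normr1.
Qed.

Let sqrt_bound (x K : R) : x ^+ 2 <= K -> `|x| <= Num.sqrt K.
Proof.
move=> xK; rewrite -sqrtr_sqr ler_wsqrtr//.
Qed.

Let bv (e : edge) i : (e.1 < e.2)%N -> bmeas (fun w => v e.1 e.2 w i 0).
Proof.
move=> he; split; first by apply: (@meas_of_wrt (inl e)); rewrite ?inlD//; exact: v_wrt.
exists (Num.sqrt C0) => w; apply: sqrt_bound; apply: le_trans (v_le he w).
rewrite /dotv (bigD1 i)//= -expr2 lerDl.
by apply: sumr_ge0 => k _; rewrite -expr2 sqr_ge0.
Qed.

Let bcov (e : edge) a : (e.1 < e.2)%N -> bmeas (cov_entry e a).
Proof.
move=> he; apply: bmeasB; last exact: bmeas_cst.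
by apply: bmeasM; exact: bv.
Qed.

Let cov_wrt (e : edge) a : (e.1 < e.2)%N -> meas_wrt <<s GS (inl e) >> (cov_entry e a).
Proof.
move=> he; apply/meas_wrtP; apply: measurable_funB; last exact: measurable_cst.
by apply: measurable_funM; apply/meas_wrtP; exact: v_wrt.
Qed.

(** Conditioning on [D] carried out by algebra: the square is expanded, products of entries of [D]
    are independent of products of entries of [cov_entry], and for each [w] the sum regroups into
    the second moment with the deterministic matrix [D w], to which [quad_var] applies. *)
Lemma quad_var_indep (e : edge) (D : T -> 'M[R]_d) (K : R) : (e.1 < e.2)%N -> 0 < K ->
  (forall i j, bmeas (fun w => D w i j)) ->
  (forall i j, meas_wrt <<s rest (inl e) >> (fun w => D w i j)) ->
  (forall w, contractive (K *: D w)) ->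
  Ex P (fun w => `|\sum_a D w a.1 a.2 * cov_entry e a w|) <= se / K.
Proof.
move=> he K0 bD mD cD.
have eD : inl e \in sum_set edges edges by rewrite inlD.
have bDQ : bmeas (fun w => \sum_a D w a.1 a.2 * cov_entry e a w).
  by apply: bmeas_sum => a _; apply: bmeasM => //; exact: bcov.
apply: Ex_norm_sqrt => //; first by rewrite divr_ge0// ltW.
pose q a b := Ex P (fun w => cov_entry e a w * cov_entry e b w).
have bQQ a b : bmeas (fun w => cov_entry e a w * cov_entry e b w).
  by apply: bmeasM; exact: bcov.
have bDD (a b : 'I_d * 'I_d) : bmeas (fun w => D w a.1 a.2 * D w b.1 b.2) by apply: bmeasM.
have sqE (x y : 'I_d * 'I_d -> R) : (\sum_a x a * y a) ^+ 2 =
    \sum_a \sum_b (x a * x b) * (y a * y b).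
  rewrite expr2 big_distrlr; apply: eq_bigr => a _; apply: eq_bigr => b _ /=.
  by rewrite mulrACA.
have qE (M : 'M[R]_d) : Ex P (fun w => (\sum_a M a.1 a.2 * cov_entry e a w) ^+ 2) =
    \sum_a \sum_b (M a.1 a.2 * M b.1 b.2) * q a b.
  under eq_fun do rewrite sqE.
  rewrite Ex_sum => [|a _]; last by apply: bmeas_sum => b _; exact: bmeasZ.
  apply: eq_bigr => a _; rewrite Ex_sum => [|b _]; last exact: bmeasZ.
  by apply: eq_bigr => b _; rewrite ExZ.
have -> : Ex P (fun w => (\sum_a D w a.1 a.2 * cov_entry e a w) ^+ 2) =
    Ex P (fun w => \sum_a \sum_b (D w a.1 a.2 * D w b.1 b.2) * q a b).
  under eq_fun do rewrite sqE.
  rewrite Ex_sum => [|a _]; last by apply: bmeas_sum => b _; exact: bmeasM.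
  rewrite [RHS]Ex_sum => [|a _]; last first.
    by apply: bmeas_sum => b _; apply: bmeasM => //; exact: bmeas_cst.
  apply: eq_bigr => a _; rewrite Ex_sum => [|b _]; last exact: bmeasM.
  rewrite [RHS]Ex_sum => [|b _]; last by apply: bmeasM => //; exact: bmeas_cst.
  apply: eq_bigr => b _.
  rewrite (rest_indepE eD)//.
  - by under [in RHS]eq_fun do rewrite mulrC; rewrite ExZ// mulrC.
  - by apply/meas_wrtP; apply: measurable_funM; apply/meas_wrtP; exact: mD.
  - by apply/meas_wrtP; apply: measurable_funM; apply/meas_wrtP; exact: cov_wrt.
rewrite -[leRHS](Ex_cst P); apply: Ex_le => [||w].
- by apply: bmeas_sum => a _; apply: bmeas_sum => b _; apply: bmeasM => //; exact: bmeas_cst.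
- exact: bmeas_cst.
rewrite -qE expr_div_n ler_pdivlMr ?exprn_gt0// mulrC.
apply: le_trans (quad_var he (cD w)).
rewrite !qE mulr_sumr le_eqVlt; apply/orP; left; apply/eqP.
apply: eq_bigr => a _; rewrite mulr_sumr; apply: eq_bigr => b _.
by rewrite !mxE; ring.
Qed.

(* The resolvent with the edge [e] cut does not see [xi e] nor [v e]. *)
Let cut_rest (j : edge + edge) e : j \in sum_set edges edges ->
  (j = inl e \/ j = inr e) -> forall i k,
  measurable_fun [set: g_sigma_algebraType (rest j)] (fun w => Amx (cut (XI w) e) (V w) i k).
Proof.
move=> jD je.
apply: (@measurable_Amx _ (g_sigma_algebraType (rest j)) R r d
  (fun k l w => cut (XI w) e k l) v (predC1 e)) => f hf.
- by move=> /negPn /= /eqP -> w; rewrite /cut -surjective_pairing eqxx.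
- move=> /= /negPf fe; rewrite /cut -surjective_pairing fe.
  apply/meas_wrtP; apply: (@rest_of_wrt j (inr f)); rewrite ?inrD//; last exact: xi_wrt.
  by case: je => -> //; apply/eqP => -[] /eqP; rewrite fe.
- move=> /= /negPf fe i; apply/meas_wrtP.
  apply: (@rest_of_wrt j (inl f)); rewrite ?inlD//; last exact: v_wrt.
  by case: je => -> //; apply/eqP => -[] /eqP; rewrite fe.
Qed.

Let cut_mxmeas (j : edge + edge) e : j \in sum_set edges edges ->
  (j = inl e \/ j = inr e) ->
  mxmeas (T := g_sigma_algebraType (rest j)) (fun w => Gcut w e).
Proof.
move=> jD je; apply: mxmeas_resolvent => // [w|]; first exact: Amx_sym.
exact: (cut_rest jD je).
Qed.

(** The variance bound concerns real matrices, so the real and imaginary parts of a block are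
    treated separately; on real vectors the complex block dominates each of them. *)
Lemma contractive_cblock (M : 'M[R]_(\sum_(k < r) d)) k l : M^T = M ->
  contractive (Im z *: map_mx Re (cblock (resolvent M z) k l)) /\
  contractive (Im z *: map_mx Im (cblock (resolvent M z) k l)).
Proof.
move=> symM; set B := cblock _ k l.
have sB (x : 'cV[R]_d) : Im z ^+ 2 * sqn (B *m map_mx (real_complex R) x) <= dotv x x.
  rewrite mulrC -ler_pdivlMr ?exprn_gt0// /B /cblock -!mulmxA.
  apply: le_trans (sqn_coisometry _ (blockE_isometry R d k)) _.
  apply: le_trans (sqn_resolvent symM Imz _) _.
  by rewrite sqn_isometry ?blockE_isometry// sqn_real.
have ReB (x : 'cV[R]_d) : map_mx Re (B *m map_mx (real_complex R) x) = map_mx Re B *m x.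
  apply/matrixP => i j; rewrite !mxE Re_sum; apply: eq_bigr => a _.
  by rewrite !mxE mulrC ReZ mulrC.
have ImB (x : 'cV[R]_d) : map_mx Im (B *m map_mx (real_complex R) x) = map_mx Im B *m x.
  apply/matrixP => i j; rewrite !mxE Im_sum; apply: eq_bigr => a _.
  by rewrite !mxE mulrC ImZ mulrC.
have frE (x : 'cV[R]_d) : frdot x x = dotv x x.
  by rewrite frdotE /dotv; apply: eq_bigr => i _; rewrite big_ord1.
split=> x; rewrite -scalemxAl dotvZ (le_trans _ (sB x))// ler_wpM2l ?sqr_ge0//.
  by rewrite sqn_ReIm ReB (frE (map_mx Re B *m x)) lerDl frdot_ge0.
by rewrite sqn_ReIm ImB (frE (map_mx Im B *m x)) lerDr frdot_ge0.
Qed.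

(** Each of the three terms of [edge_fluct] is an instance. The form minus the average is the block
    of the cut resolvent paired with [cov_entry], and the factor [2] adds real and imaginary
    parts. *)
Let fluct_term (e : edge) k l : (e.1 < e.2)%N -> (k = e.1 \/ k = e.2) -> (l = e.1 \/ l = e.2) ->
  bmeas (fun w => normc (bil (blockE R d k *m v e.1 e.2 w) (Gcut w e) (blockE R d l *m v e.1 e.2 w)
     - avg_block (cut (XI w) e) (V w) z k l)) /\
  Ex P (fun w => normc (bil (blockE R d k *m v e.1 e.2 w) (Gcut w e) (blockE R d l *m v e.1 e.2 w)
     - avg_block (cut (XI w) e) (V w) z k l)) <= 2 * se / Im z.
Proof.
move=> he _ _.
have eD : inl e \in sum_set edges edges by rewrite inlD.
pose B w := cblock (Gcut w e) k l.
have E w : bil (blockE R d k *m v e.1 e.2 w) (Gcut w e) (blockE R d l *m v e.1 e.2 w)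
     - avg_block (cut (XI w) e) (V w) z k l = \sum_a B w a.1 a.2 * (cov_entry e a w)%:C.
  rewrite bil_blockE /avg_block -/(cut_resolvent _ _ _ _) -/(B w).
  under [RHS]eq_bigr do rewrite rmorphB mulrBr.
  rewrite sumrB; congr (_ - _).
    rewrite /bil mxE -(pair_big xpredT xpredT (fun i j => B w i j *
      (v e.1 e.2 w i 0 * v e.1 e.2 w j 0)%:C)) /=; apply: eq_bigr => i _.
    rewrite !mxE mulr_sumr; apply: eq_bigr => j _.
    by rewrite !mxE rmorphM /=; ring.
  rewrite -(pair_big xpredT xpredT (fun i j => B w i j * ((i == j)%:R / d%:R)%:C)) /=.
  rewrite /mxtrace mulr_sumr; apply: eq_bigr => i _.
  rewrite (bigD1 i)//= eqxx mul1r big1 ?addr0 1?mulrC// => j /negPf ji.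
  by rewrite eq_sym ji mul0r mulr0.
have mB : mxmeas (T := g_sigma_algebraType (rest (inl e))) B.
  by apply: mxmeas_cblock; apply: cut_mxmeas => //; left.
have sG w : (Amx (cut (XI w) e) (V w))^T = Amx (cut (XI w) e) (V w) by exact: Amx_sym.
have Bb w i j : normc (B w i j) <= Num.sqrt (d%:R / Im z ^+ 2).
  rewrite -[normc _]ger0_norm ?normc_ge0//; apply: sqrt_bound.
  apply: le_trans (entry_le_sqn _ _ _) _.
  rewrite /B /cblock -mulmxA; apply: le_trans (sqn_coisometry _ (blockE_isometry R d k)) _.
  apply: le_trans (sqn_resolvent (sG w) Imz _) _.
  rewrite ler_wpM2r ?invr_ge0 ?exprn_ge0 ?(ltW Imz)//.
  rewrite -[X in sqn X]mulmx1 sqn_isometry ?blockE_isometry//.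
  rewrite /sqn (_ : \sum_i _ = d%:R)//.
  rewrite -[in RHS](card_ord d) -sum1_card natr_sum; apply: eq_bigr => a _.
  rewrite (bigD1 a)//= big1 ?addr0 => [|b /negPf ba]; rewrite !mxE.
    by rewrite eqxx normc1 expr1n.
  by rewrite eq_sym ba normc0 expr0n.
have ReBE i j : (fun w => (map_mx Re (B w)) i j) = (fun w => Re (B w i j)).
  by apply/funext => w; rewrite mxE.
have ImBE i j : (fun w => (map_mx Im (B w)) i j) = (fun w => Im (B w i j)).
  by apply/funext => w; rewrite mxE.
have bRe i j : bmeas (fun w => (map_mx Re (B w)) i j).
  split; last first.
    by exists (Num.sqrt (d%:R / Im z ^+ 2)) => w; rewrite mxE (le_trans (Re_le_normc _)).
  rewrite ReBE; apply: (meas_of_rest eD); apply/meas_wrtP.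
  exact: (mB i j).1.
have bIm i j : bmeas (fun w => (map_mx Im (B w)) i j).
  split; last first.
    by exists (Num.sqrt (d%:R / Im z ^+ 2)) => w; rewrite mxE (le_trans (Im_le_normc _)).
  rewrite ImBE; apply: (meas_of_rest eD); apply/meas_wrtP.
  exact: (mB i j).2.
have qRe : Ex P (fun w => `|\sum_a (map_mx Re (B w)) a.1 a.2 * cov_entry e a w|) <= se / Im z.
  apply: quad_var_indep => // [i j|w]; last exact: (contractive_cblock _ _ (sG w)).1.
  by rewrite ReBE; apply/meas_wrtP; exact: (mB i j).1.
have qIm : Ex P (fun w => `|\sum_a (map_mx Im (B w)) a.1 a.2 * cov_entry e a w|) <= se / Im z.
  apply: quad_var_indep => // [i j|w]; last exact: (contractive_cblock _ _ (sG w)).2.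
  by rewrite ImBE; apply/meas_wrtP; exact: (mB i j).2.
have reE w : Re (\sum_a B w a.1 a.2 * (cov_entry e a w)%:C) =
    \sum_a (map_mx Re (B w)) a.1 a.2 * cov_entry e a w.
  by rewrite Re_sum; apply: eq_bigr => a _; rewrite [in RHS]mxE mulrC ReZ mulrC.
have imE w : Im (\sum_a B w a.1 a.2 * (cov_entry e a w)%:C) =
    \sum_a (map_mx Im (B w)) a.1 a.2 * cov_entry e a w.
  by rewrite Im_sum; apply: eq_bigr => a _; rewrite [in RHS]mxE mulrC ImZ mulrC.
have bS1 : bmeas (fun w => \sum_a (map_mx Re (B w)) a.1 a.2 * cov_entry e a w).
  by apply: bmeas_sum => a _; apply: bmeasM => //; exact: bcov.
have bS2 : bmeas (fun w => \sum_a (map_mx Im (B w)) a.1 a.2 * cov_entry e a w).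
  by apply: bmeas_sum => a _; apply: bmeasM => //; exact: bcov.
have bn : bmeas (fun w => normc (\sum_a B w a.1 a.2 * (cov_entry e a w)%:C)).
  split.
    apply: measurable_normc; split.
      by under eq_fun do rewrite reE; exact: bS1.1.
    by under eq_fun do rewrite imE; exact: bS2.1.
  have [C1 HC1] := bS1.2; have [C2 HC2] := bS2.2.
  exists (C1 + C2) => w; rewrite ger0_norm ?normc_ge0//.
  by rewrite (le_trans (normc_le_ReIm _))// reE imE lerD.
have -> : (fun w => normc (bil (blockE R d k *m v e.1 e.2 w) (Gcut w e)
      (blockE R d l *m v e.1 e.2 w) - avg_block (cut (XI w) e) (V w) z k l)) =
    (fun w => normc (\sum_a B w a.1 a.2 * (cov_entry e a w)%:C)).
  by apply/funext => w; rewrite E.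
split=> //.
apply: (@le_trans _ _ (Ex P (fun w => `|\sum_a (map_mx Re (B w)) a.1 a.2 * cov_entry e a w|
   + `|\sum_a (map_mx Im (B w)) a.1 a.2 * cov_entry e a w|))).
  apply: Ex_le => // [|w]; first by apply: bmeasD; exact: bmeas_norm.
  by rewrite (le_trans (normc_le_ReIm _))// reE imE.
rewrite ExD; [|exact: bmeas_norm|exact: bmeas_norm].
by rewrite -mulrA [2 * _]mulr_natl mulr2n lerD.
Qed.

Lemma Ex_edge_fluct (e : edge) : (e.1 < e.2)%N ->
  bmeas (fun w => edge_fluct (XI w) (V w) z e) /\
  Ex P (fun w => edge_fluct (XI w) (V w) z e) <= 6 * (se / Im z).
Proof.
move=> he.
have [b1 E1] := fluct_term he (or_introl erefl) (or_intror erefl).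
have [b2 E2] := fluct_term he (or_introl erefl) (or_introl erefl).
have [b3 E3] := fluct_term he (or_intror erefl) (or_intror erefl).
rewrite /edge_fluct /edge_l /edge_r; split; first by do 2![apply: bmeasD => //].
rewrite ExD//; last exact: bmeasD.
rewrite ExD//; apply: le_trans (lerD (lerD E1 E2) E3) _.
by rewrite le_eqVlt; apply/orP; left; apply/eqP; ring.
Qed.

Let normc_avg_block_le (X : 'I_r -> 'I_r -> R) (u : 'I_r -> 'I_r -> 'cV[R]_d) k l :
  normc (avg_block X u z k l) <= (Im z)^-1.
Proof.
rewrite -(@ler_pXn2r _ 2) ?nnegrE ?normc_ge0 ?invr_ge0 ?(ltW Imz)//.
rewrite exprVn (le_trans _ (sum_sqr_avg_block X u k d_gt0 Imz))//.
by rewrite (bigD1 l)//= lerDl; apply: sumr_ge0 => j _; exact: sqr_ge0.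
Qed.

Let bavg k l a : bmeas (fun w => normc (avg_block (XI w) (V w) z k l - a)).
Proof.
split; last first.
  exists ((Im z)^-1 + normc a) => w; rewrite ger0_norm ?normc_ge0//.
  by rewrite (le_trans (le_normcD _ _))// normcN lerD2r normc_avg_block_le.
apply: measurable_normc; apply: cmeasB; last exact: cmeas_cst.
apply: cmeasM; first exact: cmeas_cst.
apply: cmeas_trace; apply: mxmeas_cblock; apply: mxmeas_resolvent => // [w|].
  exact: Amx_sym.
apply: (@measurable_Amx _ T R r d xi v predT) => // e he _; first exact: (bxi he).1.
by move=> i; exact: (bv i he).1.
Qed.

(** The cut resolvent and the vector of [e] are independent of the weight of [e], so a factor [p]
    splits off. It turns the sum over at most [r^2] edges, divided by [r d], into a multiple of
    [r p / d]. *)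
Lemma Ex_mul_edge_err (e : edge) : (e.1 < e.2)%N ->
  bmeas (fun w => edge_err (XI w) (V w) z F e) /\
  Ex P (fun w => xi e.1 e.2 w * edge_err (XI w) (V w) z F e) =
    p * Ex P (fun w => edge_err (XI w) (V w) z F e).
Proof.
move=> he.
have eD : inr e \in sum_set edges edges by rewrite inrD.
have leD : inl e \in sum_set edges edges by rewrite inlD.
have mG := cut_mxmeas eD (or_intror erefl).
have mv i : measurable_fun [set: g_sigma_algebraType (rest (inr e))] (fun w => v e.1 e.2 w i 0).
  by apply/meas_wrtP; apply: (rest_of_wrt eD leD) => //; exact: v_wrt.
have [ml mr] := @measurable_edge _ (g_sigma_algebraType (rest (inr e))) R r d v e mv.
have wrt : meas_wrt <<s rest (inr e) >> (fun w => edge_err (XI w) (V w) z F e).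
  apply/meas_wrtP; apply: measurable_funD; first apply: measurable_funD.
  - by apply: measurable_normc; apply: cmeas_bil.
  - by apply: measurable_normc; apply: cmeasB; [apply: cmeas_bil|exact: cmeas_cst].
  - by apply: measurable_normc; apply: cmeasB; [apply: cmeas_bil|exact: cmeas_cst].
have be : bmeas (fun w => edge_err (XI w) (V w) z F e).
  split; first exact: (meas_of_rest eD).
  pose K := C0 / Im z.
  exists (K + (K + normc F) + (K + normc F)) => w.
  rewrite /edge_err ger0_norm ?addr_ge0 ?normc_ge0//.
  have bd (x y : 'cV[R]_(\sum_(k < r) d)) : dotv x x <= C0 -> dotv y y <= C0 ->
      normc (bil x (Gcut w e) y) <= K.
    by move=> xC yC; apply: bil_resolvent_le => //; exact: Amx_sym.
  have lC : dotv (edge_l (V w) e) (edge_l (V w) e) <= C0 by rewrite dotv_edge_l; exact: v_le.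
  have rC : dotv (edge_r (V w) e) (edge_r (V w) e) <= C0 by rewrite dotv_edge_r; exact: v_le.
  apply: lerD; first apply: lerD; first exact: bd.
    by rewrite (le_trans (le_normcD _ _))// normcN lerD// bd.
  by rewrite (le_trans (le_normcD _ _))// normcN lerD// bd.
split => //; under eq_fun do rewrite mulrC.
by rewrite (rest_indepE eD be (bxi he) wrt (xi_wrt he)) Exi// mulrC.
Qed.

Lemma card_incident k :
  (\sum_(e : edge | (e.1 < e.2)%N && incident k e) 1 = r%:R - 1 :> R).
Proof.
transitivity (\sum_(e : edge | (e.1 < e.2)%N) ((k == e.1)%:R + (k == e.2)%:R) : R).
  rewrite big_mkcondr; apply: eq_bigr => e he; rewrite /incident.
  have [ke|ke] := eqVneq k e.1; have [ke2|ke2] := eqVneq k e.2 => //=; rewrite ?addr0 ?add0r//.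
  by move: he; rewrite -ke -ke2 ltnn.
rewrite big_split /= big_mkcond [X in _ + X]big_mkcond /=.
have -> : \sum_(e : edge) (if (e.1 < e.2)%N then (k == e.1)%:R else 0) =
    \sum_(j < r) (k < j)%N%:R :> R.
  rewrite -(pair_big xpredT xpredT (fun i j : 'I_r => if (i < j)%N then (k == i)%:R else 0 : R)) /=.
  rewrite (bigD1 k)//= [X in _ + X]big1 ?addr0.
    by apply: eq_bigr => j _; rewrite eqxx; case: ifP.
  by move=> i /negPf ik; rewrite big1// => j _; rewrite eq_sym ik; case: ifP.
have -> : \sum_(e : edge) (if (e.1 < e.2)%N then (k == e.2)%:R else 0) =
    \sum_(j < r) (j < k)%N%:R :> R.
  rewrite -(pair_big xpredT xpredT (fun i j : 'I_r => if (i < j)%N then (k == j)%:R else 0 : R)) /=.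
  rewrite exchange_big /= (bigD1 k)//= [X in _ + X]big1 ?addr0.
    by apply: eq_bigr => j _; rewrite eqxx; case: ifP.
  by move=> i /negPf ik; rewrite big1// => j _; rewrite eq_sym ik; case: ifP.
rewrite -big_split /= (bigD1 k)//= ltnn addr0 add0r.
transitivity (\sum_(i < r | i != k) 1 : R).
  apply: eq_bigr => i ik; have [] := ltngtP k i; rewrite ?addr0 ?add0r//.
  by move=> ki; move: ik; rewrite (val_inj ki) eqxx.
have : \sum_(i < r) 1 = r%:R :> R by rewrite sumr_const card_ord.
by rewrite (bigD1 k)//= => <-; rewrite addrAC subrr add0r.
Qed.

Lemma sum_edge_ends (f : 'I_r -> R) :
  \sum_(e : edge | (e.1 < e.2)%N) (f e.1 + f e.2) = (r%:R - 1) * \sum_k f k.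
Proof.
rewrite mulr_sumr; under [RHS]eq_bigr => k _ do rewrite -(card_incident k) mulr_suml.
under [RHS]eq_bigr do rewrite big_mkcondr /=.
rewrite exchange_big /=; apply: eq_bigr => e he.
have ne : e.1 != e.2 by rewrite neq_ltn he.
rewrite (bigD1 e.1)//= (bigD1 e.2) /=; last by rewrite eq_sym.
rewrite big1 ?addr0 => [|k /andP[/negPf k1 /negPf k2]]; last by rewrite /incident k1 k2.
by rewrite /incident !eqxx orbT /= !mul1r.
Qed.

(** Covariances of distinct edges vanish and each variance is at most [p], so the degree deviates
    from its mean by at most [sqrt (r p)] on average; the second term is the bias of that mean. *)
Lemma Ex_degree k :
  Ex P (fun w => `|d%:R^-1 * (\sum_(e : edge | (e.1 < e.2)%N && incident k e) xi e.1 e.2 w) - c|)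
  <= Num.sqrt (r%:R * p) / d%:R + `|(r%:R - 1) * p / d%:R - c|.
Proof.
have [p0 p1] := andP p01.
pose Y w := \sum_(e : edge | (e.1 < e.2)%N && incident k e) (xi e.1 e.2 w - p).
have bx (e : edge) : (e.1 < e.2)%N && incident k e -> bmeas (fun w => xi e.1 e.2 w - p).
  by move=> /andP[he _]; apply: bmeasB; [exact: bxi|exact: bmeas_cst].
have bY : bmeas Y by exact: bmeas_sum.
have EY2 : Ex P (fun w => Y w ^+ 2) <= r%:R * p.
  have -> : (fun w => Y w ^+ 2) = (fun w =>
     \sum_(e : edge | (e.1 < e.2)%N && incident k e)
     \sum_(f : edge | (f.1 < f.2)%N && incident k f) (xi e.1 e.2 w - p) * (xi f.1 f.2 w - p)).
    by apply/funext => w; rewrite expr2 big_distrlr.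
  rewrite Ex_sum => [|e he]; last by apply: bmeas_sum => f hf; apply: bmeasM; exact: bx.
  apply: (@le_trans _ _ (\sum_(e : edge | (e.1 < e.2)%N && incident k e) p)); last first.
    have -> : \sum_(e : edge | (e.1 < e.2)%N && incident k e) p = (r%:R - 1) * p.
      by rewrite -(card_incident k) mulr_suml; apply: eq_bigr => e _; rewrite mul1r.
    by rewrite ler_wpM2r// lerBlDr lerDl.
  apply: ler_sum => e he; rewrite Ex_sum => [|f hf]; last by apply: bmeasM; exact: bx.
  rewrite (bigD1 e)//= big1 ?addr0; last first.
    move=> f /andP[hf fe].
    have eD : inr e \in sum_set edges edges by rewrite inrD; have /andP[] := he.
    have fD : inr f \in sum_set edges edges by rewrite inrD; have /andP[] := hf.
    have he' : (e.1 < e.2)%N by have /andP[] := he.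
    have hf' : (f.1 < f.2)%N by have /andP[] := hf.
    under eq_fun do rewrite mulrC.
    rewrite (rest_indepE eD)//.
    - by rewrite ExB ?Exi ?Ex_cst ?subrr ?mul0r//; [exact: bxi|exact: bmeas_cst].
    - exact: bx.
    - exact: bx.
    - apply/meas_wrtP; apply: measurable_funB; last exact: measurable_cst.
      apply/meas_wrtP; apply: (rest_of_wrt eD fD); last exact: xi_wrt.
      by apply: contra fe => /eqP[->].
    - apply/meas_wrtP; apply: measurable_funB; last exact: measurable_cst.
      by apply/meas_wrtP; exact: xi_wrt.
  have he' : (e.1 < e.2)%N by have /andP[] := he.
  have -> : (fun w => (xi e.1 e.2 w - p) * (xi e.1 e.2 w - p)) =
      (fun w => (1 - 2 * p) * xi e.1 e.2 w + p ^+ 2).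
    by apply/funext => w; have [->|->] := xi01 he' w; ring.
  have bz : bmeas (fun w => (1 - 2 * p) * xi e.1 e.2 w) by apply: bmeasZ; exact: bxi.
  rewrite (ExD _ bz (bmeas_cst _ (p ^+ 2))).
  rewrite ExZ ?Exi ?Ex_cst//; last exact: bxi.
  by have : 0 <= p * p; [exact: mulr_ge0|rewrite expr2; lra].
have rp0 : 0 <= r%:R * p by rewrite mulr_ge0.
have EY : Ex P (fun w => `|Y w|) <= Num.sqrt (r%:R * p).
  by apply: Ex_norm_sqrt; rewrite ?sqrtr_ge0// sqr_sqrtr.
apply: (@le_trans _ _ (Ex P (fun w => d%:R^-1 * `|Y w| + `|(r%:R - 1) * p / d%:R - c|))).
  apply: Ex_le => [||w].
  - apply: bmeas_norm; apply: bmeasB; last exact: bmeas_cst.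
    by apply: bmeasZ; apply: bmeas_sum => e /andP[he _]; exact: bxi.
  - by apply: bmeasD; [apply: bmeasZ; exact: bmeas_norm|exact: bmeas_cst].
  have -> : d%:R^-1 * (\sum_(e : edge | (e.1 < e.2)%N && incident k e) xi e.1 e.2 w) - c
     = d%:R^-1 * Y w + ((r%:R - 1) * p / d%:R - c).
    have -> : Y w = \sum_(e : edge | (e.1 < e.2)%N && incident k e) xi e.1 e.2 w - (r%:R - 1) * p.
      rewrite /Y sumrB; congr (_ - _); rewrite -(card_incident k) mulr_suml.
      by apply: eq_bigr => e _; rewrite mul1r.
    by ring.
  by rewrite (le_trans (ler_normD _ _))// lerD2r normrM ger0_norm ?invr_ge0.
rewrite ExD; [|by apply: bmeasZ; exact: bmeas_norm|exact: bmeas_cst].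
rewrite Ex_cst lerD2r ExZ; last exact: bmeas_norm.
by rewrite mulrC ler_wpM2r// invr_ge0.
Qed.

(** Cauchy-Schwarz in each row, on top of [sum_sqr_avg_block]. *)
Lemma sum_offdiag_le (w : T) :
  \sum_(e : edge | (e.1 < e.2)%N) normc (avg_block (XI w) (V w) z e.1 e.2) <=
    r%:R * (Num.sqrt r%:R / Im z).
Proof.
apply: (@le_trans _ _ (\sum_k \sum_l normc (avg_block (XI w) (V w) z k l))).
  rewrite pair_big /= big_mkcond; apply: ler_sum => e _.
  by case: ifP => // _; exact: normc_ge0.
rewrite -[X in X%:R * _]card_ord mulr_natl -sumr_const; apply: ler_sum => k _.
have S0 : 0 <= \sum_l normc (avg_block (XI w) (V w) z k l).
  by apply: sumr_ge0 => l _; exact: normc_ge0.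
rewrite -(@ler_pXn2r _ 2) ?nnegrE ?divr_ge0 ?sqrtr_ge0 ?(ltW Imz)//.
rewrite expr_div_n sqr_sqrtr//.
have -> : \sum_l normc (avg_block (XI w) (V w) z k l) =
  \sum_l 1 * normc (avg_block (XI w) (V w) z k l) by under [RHS]eq_bigr do rewrite mul1r.
apply: le_trans (sum_sqr_le _ _) _.
under eq_bigr do rewrite expr1n.
rewrite sumr_const card_ord ler_wpM2l//.
exact: sum_sqr_avg_block.
Qed.

Definition local_law_err : R :=
  r%:R^-1 * \sum_k Ex P (fun w => normc (avg_block (XI w) (V w) z k k - F)).

(** The error reappears on the right multiplied by [14 * a]: the inequality is a contraction as soon
    as [Im z] exceeds this factor. All other terms tend to [0] with [se], [1 / d], [1 / r] and
    [a - c]. *)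
Lemma local_law_bound (a := r%:R * p / d%:R) :
  Im z * local_law_err <=
    14 * a * (6 * (se / Im z) + 6 * C0 / (d%:R * Im z ^+ 2) + (Num.sqrt r%:R * Im z)^-1)
    + 14 * a * local_law_err
    + (Num.sqrt (a / d%:R) + `|a - c| + a / r%:R).
Proof.
have [p0 p1] := andP p01.
have r0 : 0 < (r%:R : R) by rewrite ltr0n.
have d0 : 0 < (d%:R : R) by rewrite ltr0n.
pose S := \sum_k Ex P (fun w => normc (avg_block (XI w) (V w) z k k - F)).
have S0 : 0 <= S by apply: sumr_ge0 => k _; apply: Ex_ge0 => w; exact: normc_ge0.
pose dev k w := `|d%:R^-1 * (\sum_(e : edge | (e.1 < e.2)%N && incident k e) xi e.1 e.2 w) - c|.
have bdev k : bmeas (dev k).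
  apply: bmeas_norm; apply: bmeasB; last exact: bmeas_cst.
  by apply: bmeasZ; apply: bmeas_sum => e /andP[he _]; exact: bxi.
pose err (e : edge) w := edge_err (XI w) (V w) z F e.
have berr (e : edge) : (e.1 < e.2)%N -> bmeas (err e) by move=> he; exact: (Ex_mul_edge_err he).1.
have bxerr (e : edge) : (e.1 < e.2)%N -> bmeas (fun w => xi e.1 e.2 w * err e w).
  by move=> he; apply: bmeasM; [exact: bxi|exact: berr].
have step1 : Im z * S <= 14 * d%:R^-1 * (p * \sum_(e : edge | (e.1 < e.2)%N) Ex P (err e))
    + \sum_k Ex P (dev k).
  have : Ex P (fun w => Im z * \sum_k normc (avg_block (XI w) (V w) z k k - F)) <=
      Ex P (fun w => 14 * d%:R^-1 * (\sum_(e : edge | (e.1 < e.2)%N) xi e.1 e.2 w * err e w)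
         + \sum_k dev k w).
    apply: Ex_le => [||w].
    - by apply: bmeasZ; apply: bmeas_sum.
    - apply: bmeasD; last exact: bmeas_sum.
      by apply: bmeasZ; apply: bmeas_sum => e; exact: bxerr.
    apply: (sum_diag_block_approx (C0 := C0) d_gt0) => // e he; first exact: xi01.
    exact: v_le.
  rewrite ExZ ?Ex_sum//; last exact: bmeas_sum.
  rewrite ExD; first last.
  - exact: bmeas_sum.
  - by apply: bmeasZ; apply: bmeas_sum => e; exact: bxerr.
  rewrite ExZ; last by apply: bmeas_sum => e; exact: bxerr.
  rewrite Ex_sum// [X in _ + X]Ex_sum//.
  suff -> : \sum_(e : edge | (e.1 < e.2)%N) Ex P (fun w => xi e.1 e.2 w * err e w) =
    p * \sum_(e : edge | (e.1 < e.2)%N) Ex P (err e) by [].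
  by rewrite mulr_sumr; apply: eq_bigr => e he; exact: (Ex_mul_edge_err he).2.
pose K := 3 * (d%:R^-1 * (2 * C0 / Im z ^+ 2)).
have bmid : bmeas (fun w => \sum_(e : edge | (e.1 < e.2)%N) normc (avg_block (XI w) (V w) z e.1 e.2)).
  by apply: bmeas_sum => e _; have := bavg e.1 e.2 0; under eq_fun do rewrite subr0.
have card_edges : \sum_(e : edge | (e.1 < e.2)%N) 1 <= r%:R * r%:R :> R.
  rewrite -natrM -[(r * r)%N]/(r * r)%N.
  have -> : (r * r)%N = #|{: edge}| by rewrite card_prod card_ord.
  rewrite -sumr_const big_mkcond; apply: ler_sum => e _.
  by case: ifP.
(* Only one power of [r] accompanies [S], because each vertex is an end of [r - 1] edges. The
   off-diagonal averages likewise gain a factor [sqrt r] over the trivial count [r * r]. *)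
have step2 : \sum_(e : edge | (e.1 < e.2)%N) Ex P (err e) <=
   r%:R * r%:R * (6 * (se / Im z) + K) + r%:R * (Num.sqrt r%:R / Im z) + r%:R * S.
  have b0 (e : edge) : bmeas (fun w => normc (avg_block (XI w) (V w) z e.1 e.2)).
    by have := bavg e.1 e.2 0; under eq_fun do rewrite subr0.
  apply: (@le_trans _ _ (\sum_(e : edge | (e.1 < e.2)%N) (1 * (6 * (se / Im z) + K) +
     Ex P (fun w => normc (avg_block (XI w) (V w) z e.1 e.2)) +
     (Ex P (fun w => normc (avg_block (XI w) (V w) z e.1 e.1 - F)) +
      Ex P (fun w => normc (avg_block (XI w) (V w) z e.2 e.2 - F)))))).
    apply: ler_sum => e he; have [bf Ef] := Ex_edge_fluct he.
    apply: (@le_trans _ _ (Ex P (fun w => edge_fluct (XI w) (V w) z e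
      + normc (avg_block (XI w) (V w) z e.1 e.2)
      + normc (avg_block (XI w) (V w) z e.1 e.1 - F)
      + normc (avg_block (XI w) (V w) z e.2 e.2 - F) + K))).
      apply: Ex_le => [||w]; first exact: berr.
        by apply: bmeasD; [do 3!apply: bmeasD => //|exact: bmeas_cst].
      by apply: (edge_err_le (C0 := C0)) => // f hf; [exact: xi01|exact: v_le].
    rewrite ExD; [|by do 3!apply: bmeasD => //|exact: bmeas_cst].
    rewrite ExD//; last by do 2!apply: bmeasD => //.
    rewrite ExD//; last by apply: bmeasD => //.
    rewrite ExD// Ex_cst mul1r.
    move: Ef; set x1 := Ex P _; set x2 := Ex P _; set x3 := Ex P _; set x4 := Ex P _.
    move: (6 * (se / Im z)) K x1 x2 x3 x4 => A K1 x1 x2 x3 x4 xA.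
    rewrite -!addrA lerD// [K1 + _]addrC -!addrA lerD//.
  rewrite big_split /= big_split /= -mulr_suml; apply: lerD; first apply: lerD.
  - apply: ler_wpM2r card_edges; rewrite addr_ge0 ?mulr_ge0 ?divr_ge0 ?invr_ge0 ?mulr_ge0 ?exprn_ge0 ?(ltW Imz)//.
  - rewrite -Ex_sum// -[leRHS](Ex_cst P); apply: Ex_le => // [|w]; first exact: bmeas_cst.
    exact: sum_offdiag_le.
  - rewrite (sum_edge_ends (fun k => Ex P (fun w => normc (avg_block (XI w) (V w) z k k - F)))).
    by rewrite ler_wpM2r// gerBl.
have step3 : \sum_k Ex P (dev k) <= r%:R * (Num.sqrt (r%:R * p) / d%:R + `|(r%:R - 1) * p / d%:R - c|).
  rewrite -[X in X%:R * _]card_ord mulr_natl -sumr_const; apply: ler_sum => k _.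
  exact: Ex_degree.
have sE : S = r%:R * local_law_err by rewrite /local_law_err mulrA mulfV ?mul1r ?gt_eqF.
have q0 : 0 <= 14 * d%:R^-1 * p by rewrite !mulr_ge0// invr_ge0 ltW.
have step4 : Im z * S <= 14 * d%:R^-1 * p *
    (r%:R * r%:R * (6 * (se / Im z) + K) + r%:R * (Num.sqrt r%:R / Im z) + r%:R * S)
    + r%:R * (Num.sqrt (r%:R * p) / d%:R + `|(r%:R - 1) * p / d%:R - c|).
  by apply: le_trans step1 _; apply: lerD step3; rewrite [leLHS]mulrA ler_wpM2l.
have sqE : Num.sqrt (r%:R * p) / d%:R = Num.sqrt (a / d%:R).
  have -> : a / d%:R = (r%:R * p) * (d%:R^-1) ^+ 2 by rewrite /a expr2 !mulrA.
  have rp0 : 0 <= r%:R * p by rewrite mulr_ge0.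
  by rewrite [RHS]sqrtrM// sqrtr_sqr ger0_norm// invr_ge0.
have aE : (r%:R - 1) * p / d%:R - c = (a - c) - a / r%:R.
  by rewrite /a; field; rewrite !gt_eqF.
have a0 : 0 <= a by rewrite divr_ge0 ?mulr_ge0.
have le_dev : `|(r%:R - 1) * p / d%:R - c| <= `|a - c| + a / r%:R.
  rewrite aE (le_trans (ler_normB _ _))// lerD2l ger0_norm// divr_ge0//.
have sr : Num.sqrt (r%:R : R) ^+ 2 = r%:R by rewrite sqr_sqrtr.
have sr0 : Num.sqrt (r%:R : R) != 0 by rewrite gt_eqF// sqrtr_gt0.
rewrite -(ler_pM2l r0) [leLHS]mulrCA -sE; apply: le_trans step4 _.
rewrite sqE sE; set L := local_law_err.
have -> : 14 * d%:R^-1 * p * (r%:R * r%:R * (6 * (se / Im z) + K) +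
     r%:R * (Num.sqrt r%:R / Im z) + r%:R * (r%:R * L)) =
   r%:R * (14 * a * (6 * (se / Im z) + 6 * C0 / (d%:R * Im z ^+ 2) + (Num.sqrt r%:R * Im z)^-1)
     + 14 * a * L).
  have Im0 := gt_eqF Imz; have dn0 := gt_eqF d0.
  rewrite /a /K; move: L (Num.sqrt _) sr sr0 => L s <- s0.
  by field; rewrite s0 Im0 dn0.
rewrite [leRHS]mulrDr lerD2l ler_pM2l// -addrA lerD2l.
exact: le_dev.
Qed.

End fixed_size.

Section ae_expectation.
Context (disp : measure_display) (T : measurableType disp) (R : realType).
Variable P : probability T R.

Lemma ae_expectation (f g : T -> R) : measurable_fun setT f -> bmeas g ->
  {ae P, forall w, f w = g w} -> expectation P f = (Ex P g)%:E.
Proof.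
move=> mf bg fg; rewrite unlock.
have -> : (\int[P]_w (f w)%:E = \int[P]_w (g w)%:E)%E.
  apply: ae_eq_integral => //; [exact/measurable_EFinP|exact/measurable_EFinP/bg.1|].
  by apply: filterS fg => w /= -> _.
rewrite /Ex /Rintegral fineK//.
by apply: integrable_fin_num => //; exact: bmeas_integrable.
Qed.

Lemma ae_Ex (f g : T -> R) : bmeas f -> bmeas g ->
  {ae P, forall w, f w = g w} -> Ex P f = Ex P g.
Proof.
move=> bf bg fg; have := ae_expectation bf.1 bg fg.
rewrite (ae_expectation bf.1 bf); first by case.
by apply: aeW.
Qed.

End ae_expectation.

(** * From almost sure to pointwise control of the data *)

Section truncation.
Context (disp : measure_display) (T : measurableType disp) (R : realType).
Variable P : probability T R.
Variables (r d : nat) (c C0 p eps : R).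
Local Notation edge := ('I_r * 'I_r)%type.
Variables (xi : 'I_r -> 'I_r -> T -> R) (v : 'I_r -> 'I_r -> T -> 'cV[R]_d).
Hypotheses (d_gt0 : (0 < d)%N) (r_gt0 : (0 < r)%N) (p01 : 0 <= p <= 1).
Hypotheses (C0_ge0 : 0 <= C0) (eps_ge0 : 0 <= eps).
Hypothesis xi_meas : forall k l : 'I_r, (k < l)%N -> measurable_fun setT (xi k l).
Hypothesis xi_law : forall k l : 'I_r, (k < l)%N ->
  P [set w | xi k l w = 1] = p%:E /\ P [set w | xi k l w = 0] = (1 - p)%:E.
Hypothesis xi_indep :
  mutually_independent P [set kl : 'I_r * 'I_r | (kl.1 < kl.2)%N]%SET
    (fun kl => sigma_gen [set: unit] (fun=> xi kl.1 kl.2)).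
Hypothesis v_meas : forall k l : 'I_r, (k < l)%N -> forall i : 'I_d,
  measurable_fun setT (fun w => v k l w i ord0).
Hypothesis v_indep :
  mutually_independent P [set kl : 'I_r * 'I_r | (kl.1 < kl.2)%N]%SET
    (fun kl => sigma_gen [set: 'I_d] (fun i w => v kl.1 kl.2 w i ord0)).
Hypothesis v_xi_indep : independent2 P
  (sigma_gen [set kli : ('I_r * 'I_r) * 'I_d | (kli.1.1 < kli.1.2)%N]
     (fun kli w => v kli.1.1 kli.1.2 w kli.2 ord0))
  (sigma_gen [set kl : 'I_r * 'I_r | (kl.1 < kl.2)%N]
     (fun kl => xi kl.1 kl.2)).
Hypothesis v_isotropic : forall k l : 'I_r, (k < l)%N -> forall i j : 'I_d,
  expectation P (fun w => (v k l w *m (v k l w)^T) i j) =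
    ((((d%:R^-1)%:M : 'M[R]_d) i j)%:E).
Hypothesis v_bounded : forall k l : 'I_r, (k < l)%N ->
  {ae P, forall w, norm2 (v k l w) ^+ 2 <= C0}.
Hypothesis v_var : forall D : 'M[R]_d, opnorm D = 1 ->
  forall kl : 'I_r * 'I_r, (kl.1 < kl.2)%N ->
  (variance P (fun w => dotv (D *m v kl.1 kl.2 w) (v kl.1 kl.2 w)) <= eps%:E)%E.

(** Both truncations are functions of the original variable of one edge. They therefore inherit
    measurability for the generator of that edge, and with it independence, while the range [{0, 1}]
    and the bound [C0] now hold at every point. *)
Definition trunc_xi (k l : 'I_r) (w : T) : R := \1_[set 1] (xi k l w).
Definition trunc_v (k l : 'I_r) (w : T) : 'cV[R]_d :=
  \1_`]-oo, C0]%classic (dotv (v k l w) (v k l w)) *: v k l w.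

Definition sum_gen (j : edge + edge) : set (set T) :=
  match j with
  | inl e => \bigcup_(i in [set: 'I_d])
       preimage_set_system setT (fun w => v e.1 e.2 w i ord0) measurable
  | inr e => \bigcup_(i in [set: unit]) preimage_set_system setT (xi e.1 e.2) measurable
  end.

Let gen_meas j : j \in sum_set (edges r) (edges r) -> sum_gen j `<=` measurable.
Proof.
rewrite !inE; case: j => e; rewrite inE => he A [i _ [B mB <-]].
  exact: v_meas.
exact: xi_meas.
Qed.

Let sub_sigma_gen (G G' : set (set T)) : G `<=` G' -> <<s G >> `<=` <<s G' >>.
Proof.
move=> GG'; apply: smallest_sub; first exact: smallest_sigma_algebra.
by move=> A GA; apply: sub_sigma_algebra; exact: GG'.
Qed.

Let gen_indep :
  mutually_independent P (sum_set (edges r) (edges r)) (fun j => <<s sum_gen j >>).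
Proof.
have -> : (fun j => <<s sum_gen j >>) =
    sum_fam (fun kl : edge => sigma_gen [set: 'I_d] (fun i w => v kl.1 kl.2 w i ord0))
            (fun kl : edge => sigma_gen [set: unit] (fun=> xi kl.1 kl.2)).
  by apply/funext => -[].
apply: (joint_independence v_indep xi_indep v_xi_indep) => e A; rewrite inE => he.
  apply: sub_sigma_gen => B [i _ HB]; exists (e, i) => //.
by apply: sub_sigma_gen => B [i _ HB]; exists e.
Qed.

Let m_indic (A : set R) : measurable A -> measurable_fun setT (\1_A : R -> R).
Proof. by move=> mA; exact: measurable_indic. Qed.

Let trunc_xi01 (e : edge) : (e.1 < e.2)%N -> forall w,
  trunc_xi e.1 e.2 w = 0 \/ trunc_xi e.1 e.2 w = 1.
Proof.
by move=> _ w; rewrite /trunc_xi indicE; case: (_ \in _); [right|left].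
Qed.

Let trunc_v_le (e : edge) : (e.1 < e.2)%N -> forall w,
  dotv (trunc_v e.1 e.2 w) (trunc_v e.1 e.2 w) <= C0.
Proof.
move=> _ w; rewrite /trunc_v dotvZ indicE.
have [|_] := boolP (_ \in _); last by rewrite expr0n mul0r.
by rewrite inE /= in_itv /= expr1n mul1r.
Qed.

Let trunc_xi_wrt (e : edge) : (e.1 < e.2)%N ->
  meas_wrt <<s sum_gen (inr e) >> (trunc_xi e.1 e.2).
Proof.
move=> he B mB; apply: sub_sigma_algebra; exists tt => //.
exists (\1_[set 1] @^-1` B); last by rewrite setTI.
by rewrite -[X in measurable X]setTI; apply: m_indic.
Qed.

Let v_gen_meas (e : edge) i :
  measurable_fun [set: g_sigma_algebraType (sum_gen (inl e))] (fun w => v e.1 e.2 w i ord0).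
Proof.
move=> _ B mB; apply: sub_sigma_algebra; exists i => //.
by exists B.
Qed.

Let m_dotv (disp' : measure_display) (T' : measurableType disp') (u : T' -> 'cV[R]_d) :
  (forall i, measurable_fun setT (fun w => u w i ord0)) ->
  measurable_fun setT (fun w => dotv (u w) (u w)).
Proof.
by move=> mu; apply: measurable_sum => i; exact: measurable_funM.
Qed.

Let trunc_v_wrt (e : edge) : (e.1 < e.2)%N -> forall i,
  meas_wrt <<s sum_gen (inl e) >> (fun w => trunc_v e.1 e.2 w i 0).
Proof.
move=> he i; apply/meas_wrtP.
have -> : (fun w => trunc_v e.1 e.2 w i 0) = (fun w =>
   \1_`]-oo, C0]%classic (dotv (v e.1 e.2 w) (v e.1 e.2 w)) * v e.1 e.2 w i 0).
  by apply/funext => w; rewrite mxE.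
apply: measurable_funM; last exact: v_gen_meas.
apply: measurableT_comp; first exact: m_indic.
by apply: m_dotv => j; exact: v_gen_meas.
Qed.

Let ae_xi (e : edge) : (e.1 < e.2)%N ->
  {ae P, forall w, xi e.1 e.2 w = trunc_xi e.1 e.2 w}.
Proof.
move=> he; have [P1 P0] := xi_law he.
have m1 : measurable [set w | xi e.1 e.2 w = 1].
  by rewrite -[X in measurable X]setTI; exact: (xi_meas he measurableT (measurable_set1 1)).
have m0 : measurable [set w | xi e.1 e.2 w = 0].
  by rewrite -[X in measurable X]setTI; exact: (xi_meas he measurableT (measurable_set1 0)).
exists (~` ([set w | xi e.1 e.2 w = 1] `|` [set w | xi e.1 e.2 w = 0])); split.
- by apply: measurableC; exact: measurableU.
- rewrite probability_setC; last exact: measurableU.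
  transitivity (1 - (P [set w | xi e.1 e.2 w = 1%R] + P [set w | xi e.1 e.2 w = 0%R]))%E.
    congr (1 - _)%E; apply: measureU => //.
    by apply/seteqP; split => // w [/= ->] /eqP; rewrite oner_eq0.
  by rewrite P1 P0 -EFinD [p + _]addrC subrK subrr.
- move=> w /= nw [w1|w0]; apply: nw; rewrite /trunc_xi indicE.
    by rewrite w1 mem_set.
  by rewrite w0 memNset// => /eqP; rewrite eq_sym oner_eq0.
Qed.

Let ae_v (e : edge) : (e.1 < e.2)%N ->
  {ae P, forall w, v e.1 e.2 w = trunc_v e.1 e.2 w}.
Proof.
move=> he; apply: filterS (v_bounded he) => w; rewrite sqr_norm2 => vC.
by rewrite /trunc_v indicE mem_set ?scale1r//= in_itv.
Qed.

Let Etrunc_xi (e : edge) : (e.1 < e.2)%N -> Ex P (trunc_xi e.1 e.2) = p.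
Proof.
move=> he; have [P1 _] := xi_law he.
have m1 : measurable [set w | xi e.1 e.2 w = 1].
  by rewrite -[X in measurable X]setTI; exact: (xi_meas he measurableT (measurable_set1 1)).
have -> : trunc_xi e.1 e.2 = \1_[set w | xi e.1 e.2 w = 1].
  apply/funext => w; rewrite /trunc_xi !indicE.
  suff -> : (xi e.1 e.2 w \in [set (1 : R)]) = (w \in [set w | xi e.1 e.2 w = 1]) by [].
  by apply/idP/idP; rewrite !inE.
by rewrite Ex_indic// P1.
Qed.

Let btv (e : edge) i : (e.1 < e.2)%N -> bmeas (fun w => trunc_v e.1 e.2 w i 0).
Proof.
move=> he; split.
  have -> : (fun w => trunc_v e.1 e.2 w i 0) = (fun w =>
     \1_`]-oo, C0]%classic (dotv (v e.1 e.2 w) (v e.1 e.2 w)) * v e.1 e.2 w i 0).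
    by apply/funext => w; rewrite mxE.
  apply: measurable_funM; last exact: v_meas.
  apply: measurableT_comp; first exact: m_indic.
  by apply: m_dotv => j; exact: v_meas.
exists (Num.sqrt C0) => w; rewrite -sqrtr_sqr ler_wsqrtr//.
apply: le_trans (trunc_v_le he w).
rewrite /dotv (bigD1 i)//= -expr2 lerDl.
by apply: sumr_ge0 => k _; rewrite -expr2 sqr_ge0.
Qed.

Let Etrunc_v (e : edge) i j : (e.1 < e.2)%N ->
  Ex P (fun w => trunc_v e.1 e.2 w i 0 * trunc_v e.1 e.2 w j 0) = (i == j)%:R / d%:R.
Proof.
move=> he.
have E : (fun w => (v e.1 e.2 w *m (v e.1 e.2 w)^T) i j) =
    (fun w => v e.1 e.2 w i 0 * v e.1 e.2 w j 0).
  by apply/funext => w; rewrite mxE big_ord1 [X in _ * X]mxE.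
have := v_isotropic he i j; rewrite E.
rewrite (@ae_expectation _ _ _ _ _ (fun w => trunc_v e.1 e.2 w i 0 * trunc_v e.1 e.2 w j 0)).
- by rewrite mxE => /(congr1 fine) /= ->; rewrite -[LHS]mulr_natl.
- by apply: measurable_funM; exact: v_meas.
- by apply: bmeasM; exact: btv.
- by apply: filterS (ae_v he) => w ->.
Qed.

Let quad_formE (D : 'M[R]_d) (u : 'cV[R]_d) :
  dotv (D *m u) u = \sum_a D a.1 a.2 * (u a.1 0 * u a.2 0).
Proof.
rewrite /dotv -(pair_big xpredT xpredT (fun i j => D i j * (u i 0 * u j 0))) /=.
apply: eq_bigr => i _; rewrite mxE mulr_suml; apply: eq_bigr => j _.
by ring.
Qed.

Let trunc_cov := @cov_entry _ _ R r d trunc_v.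

Let btc (e : edge) a : (e.1 < e.2)%N -> bmeas (trunc_cov e a).
Proof.
by move=> he; apply: bmeasB; [apply: bmeasM; exact: btv|exact: bmeas_cst].
Qed.

Let variance_trunc (e : edge) (D : 'M[R]_d) : (e.1 < e.2)%N ->
  variance P (fun w => dotv (D *m v e.1 e.2 w) (v e.1 e.2 w)) =
  (Ex P (fun w => (\sum_a D a.1 a.2 * trunc_cov e a w) ^+ 2))%:E.
Proof.
move=> he.
pose X w := dotv (D *m v e.1 e.2 w) (v e.1 e.2 w).
pose Xt w := \sum_a D a.1 a.2 * (trunc_v e.1 e.2 w a.1 0 * trunc_v e.1 e.2 w a.2 0).
have mX : measurable_fun setT X.
  rewrite /X; under eq_fun do rewrite quad_formE.
  apply: measurable_sum => a; apply: measurable_funM; first exact: measurable_cst.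
  by apply: measurable_funM; exact: v_meas.
have bvv (a : 'I_d * 'I_d) : bmeas (fun w => trunc_v e.1 e.2 w a.1 0 * trunc_v e.1 e.2 w a.2 0).
  by apply: bmeasM; exact: btv.
have bXt : bmeas Xt by apply: bmeas_sum => a _; exact: bmeasZ.
have aeX : {ae P, forall w, X w = Xt w}.
  by apply: filterS (ae_v he) => w vE; rewrite /X quad_formE /Xt vE.
have EXt : Ex P Xt = \sum_a D a.1 a.2 * ((a.1 == a.2)%:R / d%:R).
  rewrite Ex_sum => [|a _]; last exact: bmeasZ.
  by apply: eq_bigr => a _; rewrite ExZ// Etrunc_v.
rewrite /variance unlock (ae_expectation mX bXt aeX) /= EXt.
have bs : bmeas (fun w => \sum_a D a.1 a.2 * trunc_cov e a w).
  by apply: bmeas_sum => a _; apply: bmeasZ; exact: btc.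
apply: ae_expectation.
- by apply: measurable_funM; apply: measurable_funB => //; exact: measurable_cst.
- exact: bmeasM.
- apply: filterS aeX => w XE; rewrite expr2.
  pose m := \sum_a D a.1 a.2 * ((a.1 == a.2)%:R / d%:R).
  transitivity ((X w - m) * (X w - m)) => //; rewrite XE /m.
  suff -> : Xt w - \sum_a D a.1 a.2 * ((a.1 == a.2)%:R / d%:R) =
    \sum_a D a.1 a.2 * trunc_cov e a w by [].
  by rewrite /Xt -sumrB; apply: eq_bigr => a _; rewrite -mulrBr.
Qed.

Let trunc_quad_var (e : edge) (D : 'M[R]_d) : (e.1 < e.2)%N -> contractive D ->
  Ex P (fun w => (\sum_a D a.1 a.2 * trunc_cov e a w) ^+ 2) <= Num.sqrt eps ^+ 2.
Proof.
move=> he cD; rewrite sqr_sqrtr//.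
have [D0|D0] := leP (opnorm D) 0.
  rewrite (opnorm0_eq0 cD D0).
  have -> : (fun w => (\sum_a (0 : 'M[R]_d) a.1 a.2 * trunc_cov e a w) ^+ 2) = (fun=> 0).
    by apply/funext => w; rewrite big1 ?expr0n// => a _; rewrite mxE mul0r.
  by rewrite Ex_cst.
have K1 : opnorm D <= 1.
  by apply: opnorm_le => x x1; rewrite (le_trans (contractive_norm2 _ cD)).
have := v_var (opnorm_normalize cD D0) he.
rewrite variance_trunc// lee_fin; apply: le_trans.
have -> : (fun w => (\sum_a ((opnorm D)^-1 *: D) a.1 a.2 * trunc_cov e a w) ^+ 2) =
    (fun w => (opnorm D ^+ 2)^-1 * (\sum_a D a.1 a.2 * trunc_cov e a w) ^+ 2).
  apply/funext => w; rewrite -exprVn -exprMn mulr_sumr; congr (_ ^+ 2).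
  by apply: eq_bigr => a _; rewrite mxE mulrA.
have bs : bmeas (fun w => \sum_a D a.1 a.2 * trunc_cov e a w).
  by apply: bmeas_sum => a _; apply: bmeasZ; exact: btc.
rewrite ExZ; last by under eq_fun do rewrite expr2; exact: bmeasM.
rewrite ler_peMl ?Ex_ge0// => [w|]; first exact: sqr_ge0.
by rewrite invf_ge1 ?exprn_gt0// expr_le1// ltW.
Qed.

Local Notation XI w := (fun k l => xi k l w).
Local Notation V w := (fun k l => v k l w).
Local Notation n := (\sum_(k < r) d)%N.

Definition avg_trace (z : R[i]) (w : T) : R[i] :=
  (n%:R^-1)%:C * \tr (resolvent (Amx (XI w) (V w)) z).

Lemma measurable_Amx_entry i j : measurable_fun setT (fun w => Amx (XI w) (V w) i j).
Proof.
apply: (@measurable_Amx _ T R r d xi v predT) => // e he _; first exact: xi_meas.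
by move=> k; exact: v_meas.
Qed.

Lemma cmeas_avg_trace z : 0 < Im z -> cmeas (avg_trace z).
Proof.
move=> Imz; apply: cmeasM; first exact: cmeas_cst.
apply: cmeas_trace; apply: mxmeas_resolvent => // [w|]; first exact: Amx_sym.
exact: measurable_Amx_entry.
Qed.

Lemma normc_avg_trace_le z w : 0 < Im z -> normc (avg_trace z w) <= (Im z)^-1.
Proof.
move=> Imz; rewrite /avg_trace -sum_avg_block//.
have r0 : 0 < (r%:R : R) by rewrite ltr0n.
rewrite normcM normc_real ger0_norm ?invr_ge0 ?(ltW r0)// ler_pdivrMl//.
apply: le_trans (le_normc_sum _ _ _) _.
rewrite mulr_natl -[X in _ *+ X]card_ord -sumr_const; apply: ler_sum => k _.
rewrite -(@ler_pXn2r _ 2) ?nnegrE ?normc_ge0 ?invr_ge0 ?(ltW Imz)//.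
rewrite exprVn (le_trans _ (sum_sqr_avg_block (XI w) (V w) k d_gt0 Imz))//.
by rewrite (bigD1 k)//= lerDl; apply: sumr_ge0 => j _; exact: sqr_ge0.
Qed.

Lemma bmeas_avg_trace z F : 0 < Im z -> bmeas (fun w => normc (avg_trace z w - F)).
Proof.
move=> Imz; split.
  by apply: measurable_normc; apply: cmeasB; [exact: cmeas_avg_trace|exact: cmeas_cst].
exists ((Im z)^-1 + normc F) => w; rewrite ger0_norm ?normc_ge0//.
by rewrite (le_trans (le_normcD _ _))// normcN lerD2r normc_avg_trace_le.
Qed.

Lemma ae_Amx : {ae P, forall w, Amx (XI w) (V w) =
  Amx (fun k l => trunc_xi k l w) (fun k l => trunc_v k l w)}.
Proof.
have H : {ae P, forall w, forall e : edge, (e.1 < e.2)%N ->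
    xi e.1 e.2 w = trunc_xi e.1 e.2 w /\ v e.1 e.2 w = trunc_v e.1 e.2 w}.
  have : {ae P, forall w, forall e, e \in enum [set: edge]%SET -> (e.1 < e.2)%N ->
      xi e.1 e.2 w = trunc_xi e.1 e.2 w /\ v e.1 e.2 w = trunc_v e.1 e.2 w}.
    elim: (enum _) => [|e s IH]; first by apply: aeW.
    have [he|he] := boolP (e.1 < e.2)%N; last first.
      by apply: filterS IH => w IHw f; rewrite inE => /predU1P[-> /(negP he)//|/IHw].
    apply: filterS3 (ae_xi he) (ae_v he) IH => w H1 H2 IHw f.
    by rewrite inE => /predU1P[->|/IHw].
  by apply: filterS => w Hw e; apply: Hw; rewrite mem_enum inE.
apply: filterS H => w Hw; rewrite !AmxE; apply: eq_bigr => e he.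
have [-> vE] := Hw e he.
by rewrite /edge_mx /edge_l /edge_r vE.
Qed.

Lemma trunc_local_law (z F : R[i]) (a := r%:R * p / d%:R) :
  8 <= Im z -> C0 <= Im z -> normc F <= 2^-1 -> cubic c z F = 0 ->
  exists L : R, Ex P (fun w => normc (avg_trace z w - F)) <= L /\
  Im z * L <=
    14 * a * (6 * (Num.sqrt eps / Im z) + 6 * C0 / (d%:R * Im z ^+ 2) + (Num.sqrt r%:R * Im z)^-1)
    + 14 * a * L + (Num.sqrt (a / d%:R) + `|a - c| + a / r%:R).
Proof.
move=> z8 zC F2 F0; have Imz : 0 < Im z by rewrite (lt_le_trans _ z8).
exists (local_law_err P trunc_xi trunc_v z F); split; last first.
  apply: (@local_law_bound _ T R P r d c C0 p (Num.sqrt eps) trunc_xi trunc_v sum_gen) => //.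
pose g w k := avg_block (fun k l => trunc_xi k l w) (fun k l => trunc_v k l w) z k k.
have r0 : 0 < (r%:R : R) by rewrite ltr0n.
have btx (e : edge) : (e.1 < e.2)%N -> measurable_fun setT (trunc_xi e.1 e.2).
  by move=> he; apply: measurableT_comp; [exact: m_indic|exact: xi_meas].
have bg k : bmeas (fun w => normc (g w k - F)).
  split; last first.
    exists ((Im z)^-1 + normc F) => w; rewrite ger0_norm ?normc_ge0//.
    rewrite (le_trans (le_normcD _ _))// normcN lerD2r.
    rewrite -(@ler_pXn2r _ 2) ?nnegrE ?normc_ge0 ?invr_ge0 ?(ltW Imz)//.
    rewrite exprVn; apply: le_trans
      (sum_sqr_avg_block (fun k l => trunc_xi k l w) (fun k l => trunc_v k l w) k d_gt0 Imz).
    by rewrite [leRHS](bigD1 k)//= lerDl; apply: sumr_ge0 => j _; exact: sqr_ge0.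
  apply: measurable_normc; apply: cmeasB; last exact: cmeas_cst.
  apply: cmeasM; first exact: cmeas_cst.
  apply: cmeas_trace; apply: mxmeas_cblock; apply: mxmeas_resolvent => // [w|].
    exact: Amx_sym.
  apply: (@measurable_Amx _ T R r d trunc_xi trunc_v predT) => // e he _; first exact: btx.
  by move=> i; exact: (btv i he).1.
have bsum : bmeas (fun w => r%:R^-1 * \sum_k normc (g w k - F)).
  by apply: bmeasZ; apply: bmeas_sum.
have -> : local_law_err P trunc_xi trunc_v z F = Ex P (fun w => r%:R^-1 * \sum_k normc (g w k - F)).
  by rewrite ExZ ?Ex_sum//; exact: bmeas_sum.
(* The two quantities compare only almost everywhere, whereas [Ex_le] compares pointwise. Their
   minimum equals the first almost everywhere and lies below the second everywhere. *)
have bmn : bmeas (fun w => Num.min (normc (avg_trace z w - F)) (r%:R^-1 * \sum_k normc (g w k - F))).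
  have [m1 _] := bmeas_avg_trace F Imz; have [m2 [C HC]] := bsum.
  split; first exact: measurable_minr.
  exists C => w; have S0 : 0 <= r%:R^-1 * \sum_k normc (g w k - F).
    by rewrite mulr_ge0 ?invr_ge0 ?(ltW r0)// sumr_ge0// => k _; exact: normc_ge0.
  rewrite ger0_norm; last by rewrite le_min normc_ge0 S0.
  rewrite ge_min; apply/orP; right; apply: le_trans (HC w).
  exact: ler_norm.
have -> : Ex P (fun w => normc (avg_trace z w - F)) =
    Ex P (fun w => Num.min (normc (avg_trace z w - F)) (r%:R^-1 * \sum_k normc (g w k - F))).
  apply: ae_Ex => //; first exact: bmeas_avg_trace.
  apply: filterS ae_Amx => w AE; rewrite min_l//.
  rewrite /avg_trace AE -sum_avg_block// -/(g w _).
  have -> : (r%:R^-1)%:C * \sum_k g w k - F = (r%:R^-1)%:C * \sum_k (g w k - F).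
    rewrite sumrB sumr_const card_ord mulrBr -[F *+ r]mulr_natl mulrA.
    rewrite (_ : (r%:R^-1)%:C * r%:R = 1) ?mul1r//.
    have -> : (r%:R : R[i]) = (r%:R : R)%:C by rewrite rmorph_nat.
    by rewrite -(rmorphM (real_complex R)) mulVf ?gt_eqF// rmorph1.
  rewrite normcM normc_real ger0_norm ?invr_ge0 ?(ltW r0)// ler_wpM2l ?invr_ge0 ?(ltW r0)//.
  exact: le_normc_sum.
by apply: Ex_le => // w; rewrite ge_min lexx orbT.
Qed.

End truncation.

Lemma near_div_natr (R : realType) (u : nat -> nat) (K dl : R) :
  u r @[r --> \oo] --> \oo -> 0 < dl -> \forall r \near \oo, K / (u r)%:R <= dl.
Proof.
move=> u_oo dl0; have /cvgnyPgt /(_ (Num.bound (`|K| / dl))) := u_oo.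
apply: filterS => r ur.
have b0 : `|K| / dl < (u r)%:R.
  have := archi_boundP (divr_ge0 (normr_ge0 K) (ltW dl0)) => /lt_trans; apply.
  by rewrite ltr_nat.
have ur0 : 0 < (u r)%:R :> R by apply: le_lt_trans b0; rewrite divr_ge0// ltW.
rewrite ler_pdivrMr// (le_trans (ler_norm K))// mulrC -ler_pdivrMr//.
exact: ltW.
Qed.

(** As [28 * (c + 1) <= eta], the term [14 * a * L] takes at most half of [eta * L], and [8 <= eta]
    lets the other half dominate [L]. The remaining errors total [14 * (c + 1) * 13 + 3] times [dl],
    where [13 = 6 + 6 + 1]. *)
Lemma absorb_error (R : realFieldType) (c a eta L dl eps x1 x2 x3 x4 x5 x6 : R) :
  0 <= a -> a <= c + 1 -> 8 <= eta -> 28 * (c + 1) <= eta -> 0 <= L -> 0 < dl ->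
  (182 * (c + 1) + 3) * dl = eps ->
  x1 <= dl -> x2 <= 6 * dl -> x3 <= dl -> x4 <= dl -> x5 <= dl -> x6 <= dl ->
  eta * L <= 14 * a * (6 * x1 + x2 + x3) + 14 * a * L + (x4 + x5 + x6) -> L <= eps.
Proof.
move=> a0 ac eta8 etac L0 dl0 <- t1 t2 t3 t4 t5 t6 H.
have h1 : 14 * a * (6 * x1 + x2 + x3) <= 14 * (c + 1) * (13 * dl).
  have u0 : 6 * x1 + x2 + x3 <= 13 * dl by lra.
  apply: le_trans (_ : 14 * a * (13 * dl) <= _); first by rewrite ler_wpM2l// mulr_ge0.
  by rewrite ler_wpM2r ?mulr_ge0 ?(ltW dl0)// ler_wpM2l.
have h2 : 14 * a * L <= eta / 2 * L by rewrite ler_wpM2r//; lra.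
have h3 : L <= eta / 2 * L by rewrite ler_peMl//; lra.
have h5 : eta * L = eta / 2 * L + eta / 2 * L by field.
have h6 : 14 * (c + 1) * (13 * dl) + 3 * dl = (182 * (c + 1) + 3) * dl by ring.
rewrite -h6; move: H; rewrite h5; move: h1 h2 h3.
by set A := 14 * a * (_ + _); set B := 14 * a * L; set Q := 14 * (c + 1) * _; set S := eta / 2 * L; lra.
Qed.

Section local_law.
Variables (R : realType) (disp : nat -> measure_display) (T : forall r, measurableType (disp r)).
Variables (P : forall r, probability (T r) R) (d : nat -> nat) (p : nat -> R) (c C0 : R).
Variables (xi : forall r, 'I_r -> 'I_r -> T r -> R)
  (v : forall r, 'I_r -> 'I_r -> T r -> 'cV[R]_(d r)).
Hypotheses (d_gt0 : forall r, (0 < d r)%N) (p_range : forall r, 0 < p r <= 1).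
Hypotheses (C0_gt0 : 0 < C0) (c_ge0 : 0 <= c).
Hypothesis xi_meas : forall r (k l : 'I_r), (k < l)%N -> measurable_fun setT (xi k l).
Hypothesis xi_law : forall r (k l : 'I_r), (k < l)%N ->
  P r [set w | xi k l w = 1] = (p r)%:E /\ P r [set w | xi k l w = 0] = (1 - p r)%:E.
Hypothesis xi_indep : forall r,
  mutually_independent (P r) [set kl : 'I_r * 'I_r | (kl.1 < kl.2)%N]%SET
    (fun kl => sigma_gen [set: unit] (fun=> xi kl.1 kl.2)).
Hypothesis v_meas : forall r (k l : 'I_r), (k < l)%N -> forall i : 'I_(d r),
  measurable_fun setT (fun w => v k l w i ord0).
Hypothesis v_indep : forall r,
  mutually_independent (P r) [set kl : 'I_r * 'I_r | (kl.1 < kl.2)%N]%SET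
    (fun kl => sigma_gen [set: 'I_(d r)] (fun i w => v kl.1 kl.2 w i ord0)).
Hypothesis v_xi_indep : forall r, independent2 (P r)
  (sigma_gen [set kli : ('I_r * 'I_r) * 'I_(d r) | (kli.1.1 < kli.1.2)%N]
     (fun kli w => v kli.1.1 kli.1.2 w kli.2 ord0))
  (sigma_gen [set kl : 'I_r * 'I_r | (kl.1 < kl.2)%N] (fun kl => xi kl.1 kl.2)).
Hypothesis v_isotropic : forall r (k l : 'I_r), (k < l)%N -> forall i j : 'I_(d r),
  expectation (P r) (fun w => (v k l w *m (v k l w)^T) i j) =
    ((((d r)%:R^-1)%:M : 'M[R]_(d r)) i j)%:E.
Hypothesis v_bounded : forall r (k l : 'I_r), (k < l)%N ->
  {ae P r, forall w, norm2 (v k l w) ^+ 2 <= C0}.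
Hypothesis v_var : forall D : (forall n, 'M[R]_n),
  (forall n, (0 < n)%N -> opnorm (D n) = 1) ->
  ereal_sup [set variance (P r) (fun w =>
       dotv (D (d r) *m v kl.1 kl.2 w) (v kl.1 kl.2 w))
      | kl in [set kl : 'I_r * 'I_r | (kl.1 < kl.2)%N]]
    @[r --> \oo] --> (0 : \bar R).
Hypothesis d_oo : d r @[r --> \oo] --> \oo.
Hypothesis rp_d : r%:R * p r / (d r)%:R @[r --> \oo] --> c.

Lemma local_law (z F : R[i]) :
  8 <= Im z -> C0 <= Im z -> 28 * (c + 1) <= Im z -> normc F <= 2^-1 -> cubic c z F = 0 ->
  Ex (P r) (fun w => normc (avg_trace (@xi r) (@v r) z w - F)) @[r --> \oo] --> (0 : R).
Proof.
move=> z8 zC zc F2 F0; have Imz : 0 < Im z by rewrite (lt_le_trans _ z8).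
apply/cvgr0Pnorm_le => eps eps0.
have K0 : 0 < 182 * (c + 1) + 3 by rewrite ltr_wpDl// mulr_ge0// addr_ge0.
pose dl := eps / (182 * (c + 1) + 3).
have dl0 : 0 < dl by rewrite divr_gt0.
have dl2 : 0 < dl ^+ 2 by rewrite exprn_gt0.
near=> r.
(* Variances enter the estimate through their square roots, hence the bound [dl ^+ 2]. *)
have var_le : forall D : 'M[R]_(d r), opnorm D = 1 -> forall kl : 'I_r * 'I_r, (kl.1 < kl.2)%N ->
    (variance (P r) (fun w => dotv (D *m v kl.1 kl.2 w) (v kl.1 kl.2 w)) <= (dl ^+ 2)%:E)%E.
  near: r.
  exact: (uniform_in_matrix (W := fun r D kl => variance (P r) (fun w =>
       dotv (D *m v kl.1 kl.2 w) (v kl.1 kl.2 w)))).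
have r_gt0 : (0 < r)%N by near: r; exists 1%N.
have d1 : (c + 1) / (d r)%:R <= dl ^+ 2 by near: r; exact: near_div_natr.
have d2 : C0 / (d r)%:R <= dl by near: r; exact: near_div_natr.
have r1 : 1 / r%:R <= dl ^+ 2 by near: r; exact: near_div_natr.
have r2 : (c + 1) / r%:R <= dl by near: r; exact: near_div_natr.
have ac : `|c - r%:R * p r / (d r)%:R| <= Num.min dl 1.
  near: r; move/cvgrPdist_le : rp_d; apply.
  by rewrite lt_min dl0 ltr01.
have p01 : 0 <= p r <= 1 by have /andP[/ltW -> ->] := p_range r.
have [L [EL H]] := trunc_local_law (d_gt0 r) r_gt0 p01 (ltW C0_gt0) (ltW dl2)
  (@xi_meas r) (@xi_law r) (@xi_indep r) (@v_meas r) (@v_indep r) (@v_xi_indep r)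
  (@v_isotropic r) (@v_bounded r) var_le z8 zC F2 F0.
have E0 : 0 <= Ex (P r) (fun w => normc (avg_trace (@xi r) (@v r) z w - F)).
  by apply: Ex_ge0 => w; exact: normc_ge0.
rewrite (ger0_norm E0); apply: (le_trans EL).
have L0 := le_trans E0 EL.
have rr0 : 0 < (r%:R : R) by rewrite ltr0n.
have dd0 : 0 < ((d r)%:R : R) by rewrite ltr0n.
set a := r%:R * p r / (d r)%:R in ac H.
have a0 : 0 <= a.
  by rewrite /a; have /andP[pr0 _] := p01; rewrite !mulr_ge0// invr_ge0 ltW.
move: ac; rewrite le_min => /andP[ac1 ac2].
have ac1' : a <= c + 1.
  by move: ac2; rewrite ler_norml lerNl opprB lerBlDl => /andP[].
have h4 : (182 * (c + 1) + 3) * dl = eps by rewrite /dl mulrC divfK// gt_eqF.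
have Iz : (Im z)^-1 <= 1 by rewrite invf_le1// (le_trans _ z8)// ler1n.
have t1 : Num.sqrt (dl ^+ 2) / Im z <= dl.
  by rewrite sqrtr_sqr gtr0_norm// ler_piMr// ltW.
have t2 : 6 * C0 / ((d r)%:R * Im z ^+ 2) <= 6 * dl.
  rewrite -[6 * C0 / _]mulrA ler_pM2l// invfM mulrA; apply: le_trans d2.
  rewrite ler_piMr//; first by rewrite divr_ge0// ltW.
  by rewrite invf_le1 ?exprn_gt0// exprn_ege1// (le_trans _ z8)// ler1n.
have t3 : (Num.sqrt r%:R * Im z)^-1 <= dl.
  rewrite invfM; apply: (@le_trans _ _ ((Num.sqrt r%:R)^-1)).
    by rewrite ler_piMr// invr_ge0 sqrtr_ge0.
  rewrite -(@ler_pXn2r _ 2) ?nnegrE ?invr_ge0 ?sqrtr_ge0 ?(ltW dl0)//.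
  by rewrite exprVn sqr_sqrtr ?(ltW rr0)// -div1r.
have t4 : Num.sqrt (a / (d r)%:R) <= dl.
  rewrite -(@ler_pXn2r _ 2) ?nnegrE ?sqrtr_ge0 ?(ltW dl0)//.
  rewrite sqr_sqrtr; last by rewrite divr_ge0// ltW.
  by rewrite (le_trans _ d1)// ler_pM2r// invr_gt0.
have t5 : a / r%:R <= dl by rewrite (le_trans _ r2)// ler_pM2r// invr_gt0.
have t6 : `|a - c| <= dl by rewrite distrC.
exact: (absorb_error (dl := dl) a0 ac1' z8 zc L0 dl0 h4 t1 t2 t3 t4 t6 t5 H).
Unshelve. all: by end_near. Qed.

End local_law.

(** * The limit measure *)

Section step_functional.
Variables (R : realType) (D : (R -> R) -> Prop) (Lam : (R -> R) -> R).
Hypothesis DD : forall f g, D f -> D g -> D (fun x => f x + g x).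
Hypothesis DZ : forall (a : R) f, D f -> D (fun x => a * f x).
Hypothesis LamD : forall f g, D f -> D g -> Lam (fun x => f x + g x) = Lam f + Lam g.
Hypothesis LamZ : forall (a : R) f, D f -> Lam (fun x => a * f x) = a * Lam f.
Hypothesis Lam_le : forall f g, D f -> D g -> (forall x, f x <= g x) -> Lam f <= Lam g.
Hypotheses (D1 : D (fun=> 1)) (Lam1 : Lam (fun=> 1) = 1).

Definition below (a x : R) : R := (x <= a)%R%:R.

Hypothesis D_below : forall a, D (below a).

(** Differences are written with [(-1) *] so that [DD] and [DZ] apply as they stand. *)
Let step (u y : nat -> R) J x :=
  \sum_(j < J) y j * (below (u j.+1) x + (-1) * below (u j) x).

Let D_step u y J : D (step u y J) /\
  Lam (step u y J) = \sum_(j < J) y j * (Lam (below (u j.+1)) - Lam (below (u j))).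
Proof.
rewrite /step; elim: J => [|J [DJ LJ]].
  have -> : (fun x => \sum_(j < 0) y j * (below (u j.+1) x + (-1) * below (u j) x))
      = (fun x => 0 * below 0 x) by apply/funext => x; rewrite big_ord0 mul0r.
  by split; [exact: DZ|rewrite LamZ// mul0r big_ord0].
have -> : (fun x => \sum_(j < J.+1) y j * (below (u j.+1) x + (-1) * below (u j) x)) =
    (fun x => \sum_(j < J) y j * (below (u j.+1) x + (-1) * below (u j) x) +
       y J * (below (u J.+1) x + (-1) * below (u J) x)).
  by apply/funext => x; rewrite big_ord_recr.
have DJ1 : D (fun x => below (u J.+1) x + (-1) * below (u J) x).
  by apply: DD => //; exact: DZ.
split; first by apply: DD => //; exact: DZ.
rewrite LamD//; last exact: DZ.
rewrite LJ big_ord_recr /= LamZ// LamD//; last exact: DZ.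
by rewrite LamZ// mulN1r.
Qed.

Let step_approx (g : R -> R) (u y : nat -> R) J (eps B : R) x :
  {homo u : i j / (i <= j)%N >-> i <= j} -> 0 <= eps -> `|g x| <= B ->
  (forall j, (j < J)%N -> u j < x <= u j.+1 -> `|g x - y j| <= eps) ->
  `|g x - step u y J x| <= B * (1 + (-1) * (below (u J) x + (-1) * below (u 0%N) x)) + eps.
Proof.
move=> um eps0 gB gy.
pose w j := below (u j.+1) x + (-1) * below (u j) x.
have below_le a b : a <= b -> below a x <= below b x.
  rewrite /below => ab; have [xa|//] := boolP (x <= a).
  by rewrite (le_trans xa ab).
have w0 j : 0 <= w j by rewrite /w mulN1r subr_ge0; apply: below_le; exact: um.
have sw : \sum_(j < J) w j = below (u J) x + (-1) * below (u 0%N) x.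
  rewrite -(big_mkord xpredT w) mulN1r -(telescope_sumr (fun j => below (u j) x))//.
  by apply: eq_bigr => j _; rewrite /w mulN1r.
have gE : g x - step u y J x =
    g x * (1 + (-1) * \sum_(j < J) w j) + \sum_(j < J) (g x - y j) * w j.
  rewrite /step -/w; under [X in _ = _ + X]eq_bigr do rewrite mulrBl.
  by rewrite sumrB -mulr_sumr; ring.
have sw1 : \sum_(j < J) w j <= 1.
  rewrite sw mulN1r /below; case: (x <= u J); case: (x <= u 0%N); rewrite ?subrr ?subr0//.
  by rewrite sub0r (le_trans _ (@ler01 R))// lerN10.
rewrite gE -sw; apply: le_trans (ler_normD _ _) _; apply: lerD.
  by rewrite normrM [X in _ * X <= _]ger0_norm ?ler_wpM2r// mulN1r subr_ge0.
apply: le_trans (ler_norm_sum _ _ _) _.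
apply: (@le_trans _ _ (\sum_(j < J) eps * w j)); last first.
  by rewrite -mulr_sumr ler_piMr.
apply: ler_sum => j _; rewrite normrM (ger0_norm (w0 j)).
have [uxu|nux] := boolP (u j < x <= u j.+1); first by rewrite ler_wpM2r// gy.
suff -> : w j = 0 by rewrite !mulr0.
rewrite /w /below mulN1r; move: nux; rewrite negb_and -leNgt -ltNge => /orP[xu|ux].
  by rewrite xu (le_trans xu) ?subrr//; exact: um.
by rewrite !leNgt ux (le_lt_trans _ ux) ?subrr//; exact: um.
Qed.

(** The assumptions on [Lam] are shared by integration against a measure and by a limit of averages
    that is only finitely additive; the lemma is applied to both. The error consists of [B] times
    the mass outside the grid and of the oscillation [eps] inside. *)
Lemma functional_step (g : R -> R) (u y : nat -> R) J (eps B : R) : D g ->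
  {homo u : i j / (i <= j)%N >-> i <= j} -> 0 <= eps -> (forall x, `|g x| <= B) ->
  (forall x j, (j < J)%N -> u j < x <= u j.+1 -> `|g x - y j| <= eps) ->
  `|Lam g - \sum_(j < J) y j * (Lam (below (u j.+1)) - Lam (below (u j)))| <=
   B * (1 - (Lam (below (u J)) - Lam (below (u 0%N)))) + eps.
Proof.
move=> Dg um eps0 gB gy; have [DS <-] := D_step u y J.
pose out x := B * (1 + (-1) * (below (u J) x + (-1) * below (u 0%N) x)) + eps * 1.
have Db : D (fun x => below (u J) x + (-1) * below (u 0%N) x) by apply: DD => //; exact: DZ.
have Db1 : D (fun x => 1 + (-1) * (below (u J) x + (-1) * below (u 0%N) x)).
  by apply: (DD D1); exact: DZ.
have De : D (fun=> eps * 1) by exact: DZ.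
have DBb := DZ B Db1.
have Do : D out by exact: (DD DBb De).
have <- : Lam out = B * (1 - (Lam (below (u J)) - Lam (below (u 0%N)))) + eps.
  have -> := LamD DBb De; have -> := LamZ B Db1; have -> := LamD D1 (DZ (-1) Db).
  have -> := LamZ (-1) Db; have -> := LamD (D_below (u J)) (DZ (-1) (D_below (u 0%N))).
  have -> := LamZ (-1) (D_below (u 0%N)); have -> := LamZ eps D1.
  by rewrite Lam1 !mulN1r mulr1.
have H x : `|g x - step u y J x| <= out x.
  by rewrite /out mulr1; apply: step_approx => // j jJ; exact: gy.
rewrite ler_norml lerNl opprB; apply/andP; split.
  rewrite lerBlDl -LamD//; apply: Lam_le => // [|x]; first exact: DD.
  by have := H x; rewrite ler_norml => /andP[+ _]; lra.
rewrite lerBlDl -LamD//; apply: Lam_le => // [|x]; first exact: DD.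
by have := H x; rewrite ler_norml => /andP[_]; lra.
Qed.

End step_functional.

Section sequence_average.
Variable R : realType.
Implicit Types (s : seq R) (f g : R -> R).

Definition avg s f : R := (size s)%:R^-1 * \sum_(x <- s) f x.

Lemma avgD s f g : avg s (fun x => f x + g x) = avg s f + avg s g.
Proof. by rewrite /avg big_split mulrDr. Qed.

Lemma avgZ s a f : avg s (fun x => a * f x) = a * avg s f.
Proof. by rewrite /avg -mulr_sumr mulrCA. Qed.

Lemma avg_le s f g : (forall x, f x <= g x) -> avg s f <= avg s g.
Proof.
by move=> fg; rewrite ler_wpM2l ?invr_ge0//; apply: ler_sum => x _; exact: fg.
Qed.

Lemma avg1 s : (0 < size s)%N -> avg s (fun=> 1) = 1.
Proof.
by move=> s0; rewrite /avg big_const_seq count_predT iter_addr_0 mulVf// pnatr_eq0 -lt0n.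
Qed.

Lemma avg_norm_le s f B : 0 <= B -> (forall x, `|f x| <= B) -> `|avg s f| <= B.
Proof.
move=> B0 fB; have [s0|s0] := posnP (size s).
  by rewrite /avg s0 invr0 mul0r normr0.
rewrite -[B]mulr1 -(avg1 s0) -avgZ ler_norml -mulN1r -avgZ !avg_le// => x.
  by have := fB x; rewrite ler_norml => /andP[_]; rewrite mulr1.
by have := fB x; rewrite ler_norml => /andP[+ _]; rewrite mulr1 mulN1r.
Qed.

End sequence_average.

(** * Limits along an ultrafilter and the distribution function *)

Section ultralimit.
Variables (R : realType) (I : Type) (U : set_system I).
Context {UU : UltraFilter U}.

Lemma cvg_ultra_bounded (u : I -> R) (B : R) : (forall i, `|u i| <= B) -> cvg (u @ U).
Proof.
move=> uB.
have cpt := @segment_compact R (- B) B.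
have [//|p [_ pc]] := cpt (u @ U) (fmap_proper_filter _ _).
  by apply: (@filterE _ U) => i; rewrite /= in_itv /= -ler_norml.
apply/cvg_ex; exists p; apply/cvgrPdist_lt => eps eps0.
have [//|UA] := in_ultra_setVsetC [set i | `|p - u i| < eps] UU.
have UA' : (u @ U) [set y | ~ `|p - y| < eps] by [].
by have [y [] + /=] := pc _ _ UA' (nbhsx_ballx p eps eps0).
Qed.

End ultralimit.

Lemma probability_of_cdf (R : realType) (H : R -> R) : nondecreasing H ->
  right_continuous H -> H @ -oo --> (0 : R) -> H @ +oo --> (1 : R) ->
  exists N : probability R R, forall x, N `]-oo, x]%classic = (H x)%:E.
Proof.
move=> nd rc Ny Hy.
pose m1 := isCumulative.Build R _ R H nd rc.
pose m2 := isCumulativeBounded.Build R 0 1 H Ny Hy.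
pose f : cumulativeBounded (0 : R) (1 : R) := HB.pack H m1 m2.
pose P : probability (measurableTypeR R) R := lebesgue_stieltjes_measure f.
(* The identity transports the Lebesgue-Stieltjes measure from [measurableTypeR R] to [R]. *)
pose idTR : measurableTypeR R -> R := idfun.
pose m3 := @isMeasurableFun.Build _ _ _ _ idTR (@measurable_id _ _ setT).
pose X : {mfun measurableTypeR R >-> R} := HB.pack idTR m3.
exists (distribution P X) => x.
exact: (cdf_lebesgue_stieltjes_id f x).
Qed.

Section limit_law.
Variables (R : realType) (I : Type) (U : set_system I).
Context {UU : UltraFilter U}.
Variable s : I -> seq R.
Hypothesis s_gt0 : \forall i \near U, (0 < size (s i))%N.

Definition bnd (f : R -> R) := exists2 B : R, 0 <= B & forall x, `|f x| <= B.
(** The ultrafilter makes the limit exist for all bounded [f] at once, without subsequences. The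
    functional is linear and positive but only finitely additive, so it does not give a measure
    directly. *)
Definition lim_avg (f : R -> R) : R := lim (avg (s i) f @[i --> U]).
Local Notation L := lim_avg.

Lemma cvg_avg f : bnd f ->
  avg (s i) f @[i --> U] --> L f.
Proof.
by move=> [B B0 fB]; apply: (@cvg_ultra_bounded _ _ _ _ _ B) => i; exact: avg_norm_le.
Qed.

Lemma lim_avgE f (l : R) : avg (s i) f @[i --> U] --> l -> L f = l.
Proof. exact: cvg_lim. Qed.

Lemma bndD f g : bnd f -> bnd g -> bnd (fun x => f x + g x).
Proof.
move=> [B B0 fB] [C C0 gC]; exists (B + C) => [|x]; first exact: addr_ge0.
by rewrite (le_trans (ler_normD _ _))// lerD.
Qed.

Lemma bndZ (a : R) f : bnd f -> bnd (fun x => a * f x).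
Proof.
by move=> [B B0 fB]; exists (`|a| * B) => [|x]; [exact: mulr_ge0|rewrite normrM ler_wpM2l].
Qed.

Lemma lim_avgD f g : bnd f -> bnd g -> L (fun x => f x + g x) = L f + L g.
Proof.
move=> bf bg; apply: lim_avgE; under eq_fun do rewrite avgD.
by apply: cvgD; exact: cvg_avg.
Qed.

Lemma lim_avgZ (a : R) f : bnd f -> L (fun x => a * f x) = a * L f.
Proof.
move=> bf; apply: lim_avgE; under eq_fun do rewrite avgZ.
by apply: cvgMr; exact: cvg_avg.
Qed.

Lemma lim_avg_le f g : bnd f -> bnd g -> (forall x, f x <= g x) -> L f <= L g.
Proof.
move=> bf bg fg.
have fgU : \forall i \near U, 0 <= avg (s i) g - avg (s i) f.
  by apply: (@filterE _ U) => i; rewrite subr_ge0 avg_le.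
rewrite -subr_ge0; exact: (closed_cvg [set y : R | 0 <= y] (@closed_ge R 0) fgU _ (cvgB (cvg_avg bg) (cvg_avg bf))).
Qed.

Lemma bnd1 : bnd (fun=> 1). Proof. by exists 1 => // x; rewrite normr1. Qed.

Lemma lim_avg1 : L (fun=> 1) = 1.
Proof.
apply: lim_avgE; apply: cvg_near_cst.
by apply: filterS s_gt0 => i si; rewrite avg1.
Qed.

Lemma bnd_below a : bnd (below a).
Proof.
by exists 1 => // x; rewrite /below normr_nat lern1 leq_b1.
Qed.

#[local] Hint Resolve bnd1 bnd_below : core.

Let G (a : R) := L (below a).

Let below_le (a b x : R) : a <= b -> below a x <= below b x.
Proof.
rewrite /below => ab; have [xa|//] := boolP (x <= a).
by rewrite (le_trans xa ab).
Qed.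

Let G_nd a b : a <= b -> G a <= G b.
Proof. by move=> ab; apply: lim_avg_le => // x; exact: below_le. Qed.

Let G_ge0 a : 0 <= G a.
Proof.
have -> : 0 = L (fun x => 0 * 1) by rewrite (lim_avgZ 0 bnd1) mul0r.
by apply: lim_avg_le => // [|x]; [exact: bndZ|rewrite mul0r ler0n].
Qed.

Hypothesis tight : forall eps : R, 0 < eps ->
  exists M : R, L (fun x => (M < `|x|)%R%:R) <= eps.

(** [G] need not be right-continuous; [H] is its limit from the right. *)
Let H (x : R) := inf (G @` `]x, +oo[%classic).

Let H_inf x : has_inf (G @` `]x, +oo[%classic).
Proof.
split; first by exists (G (x + 1)), (x + 1) => //=; rewrite in_itv /= andbT ltrDl.
by exists 0 => _ [y _ <-]; exact: G_ge0.
Qed.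

Let H_le x y : x < y -> H x <= G y.
Proof.
move=> xy; apply: ge_inf; first exact: (H_inf x).2.
by exists y => //=; rewrite in_itv /= xy.
Qed.

Let G_le_H x : G x <= H x.
Proof.
apply: lb_le_inf; first exact: (H_inf x).1.
by move=> _ [y /= + <-]; rewrite in_itv /= andbT => xy; apply: G_nd; exact: ltW.
Qed.

Let H_approx x e : 0 < e -> exists2 y, x < y & G y <= H x + e.
Proof.
move=> e0; have [_ [y /= + <-] yH] := inf_adherent e0 (H_inf x).
by rewrite in_itv /= andbT => xy; exists y => //; exact: ltW.
Qed.

Let H_nd : nondecreasing H.
Proof.
move=> x y xy; apply: lb_le_inf; first exact: (H_inf y).1.
by move=> _ [z /= + <-]; rewrite in_itv /= andbT => yz; apply: H_le; exact: le_lt_trans yz.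
Qed.

Let H_rc : right_continuous H.
Proof.
move=> x; apply/cvgrPdist_le => e e0.
have [y xy Hy] := H_approx x e0.
near=> z.
have xz : x < z by near: z; exact: nbhs_right_gt.
have zy : z < y by near: z; exact: nbhs_right_lt.
rewrite distrC ger0_norm ?subr_ge0 ?H_nd ?(ltW xz)// lerBlDl.
exact: le_trans (H_le zy) Hy.
Unshelve. all: by end_near. Qed.

Lemma bnd_tail (M : R) : bnd (fun x => (M < `|x|)%R%:R).
Proof.
by exists 1 => // x; rewrite normr_nat lern1 leq_b1.
Qed.

#[local] Hint Resolve bnd_tail : core.

Let H_tail eps : 0 < eps -> exists2 M : R, 0 < M &
  forall x, (x <= - M -> H x <= eps) /\ (M <= x -> 1 - eps <= H x).
Proof.
move=> e0; have [M0 tM0] := tight e0.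
pose m := Num.max M0 0 + 2^-1.
have mM0 : M0 < m by rewrite ltr_pwDr// le_max lexx.
have m0 : 0 < m by rewrite ltr_pwDr// le_max lexx orbT.
exists (m + 1) => [|x]; first by rewrite addr_gt0.
have mm1 : m < m + 1 by rewrite ltrDl.
split => xM.
  apply: le_trans (H_le (y := - m) _) _.
    by rewrite (le_lt_trans xM)// ltrN2.
  apply: le_trans tM0; apply: lim_avg_le => // y.
  rewrite /below; have [ym|_] := boolP (y <= - m); last by rewrite ler0n.
  by rewrite (lt_le_trans mM0)// -normrN (le_trans _ (ler_norm _))// lerNr.
apply: le_trans (G_le_H x).
apply: (@le_trans _ _ (L (fun y => 1 + (-1) * (M0 < `|y|)%R%:R))).
  rewrite lim_avgD//; last exact: bndZ.
  by rewrite lim_avgZ// lim_avg1 mulN1r lerD2l lerN2.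
apply: lim_avg_le => // [|y]; first by apply: bndD => //; exact: bndZ.
rewrite /below mulN1r; have [yx|yx] := leP y x; first by rewrite lerBlDr lerDl ler0n.
rewrite (_ : M0 < `|y|) ?subrr//.
rewrite (lt_le_trans mM0)// (le_trans _ (ler_norm _))// (le_trans _ (ltW yx))//.
by rewrite (le_trans (ltW mm1)).
Qed.

(** [Ex N g] and [L g] are both close to Riemann-Stieltjes sums with the same values [g (t j)], and
    these sums are close to each other. Uniform continuity of [g] allows one mesh for the whole
    grid. *)
Lemma limit_law : exists N : probability R R, forall (g : R -> R) (B : R),
  measurable_fun setT g -> (forall x, `|g x| <= B) ->
  (forall eps, 0 < eps -> exists2 dl, 0 < dl &
     forall x y, `|x - y| <= dl -> `|g x - g y| <= eps) ->
  Ex N g = L g.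
Proof.
have H_Ny : H @ -oo --> (0 : R).
  apply/cvgr0Pnorm_le => e e0; have [M M0 HM] := H_tail e0.
  near=> x; rewrite ger0_norm; last exact: le_trans (G_ge0 x) (G_le_H x).
  by apply: (HM x).1; near: x; apply: nbhs_ninfty_le; exact: num_real.
have H_y : H @ +oo --> (1 : R).
  apply/cvgrPdist_le => e e0; have [M M0 HM] := H_tail e0.
  near=> x; rewrite ger0_norm ?subr_ge0.
    by rewrite lerBlDl -lerBlDr; apply: (HM x).2; near: x; apply: nbhs_pinfty_ge; exact: num_real.
  apply: le_trans (H_le (y := x + 1) _) _; first by rewrite ltrDl.
  rewrite -lim_avg1; apply: lim_avg_le => // y; rewrite /below lern1; exact: leq_b1.
have [N NH] := probability_of_cdf H_nd H_rc H_Ny H_y.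
exists N => g B mg gB guc.
have below_indic (a : R) : below a = \1_`]-oo, a]%classic :> (R -> R).
  apply/funext => x; rewrite indicE /below.
  suff -> : (x \in `]-oo, a]%classic) = (x <= a) by [].
  by apply/idP/idP; rewrite inE /= in_itv.
have mb (a : R) : @bmeas _ R R (below a).
  rewrite below_indic; split; first exact: measurable_indic.
  by exists 1 => x; rewrite indicE normr_nat lern1 leq_b1.
have ExH (a : R) : Ex N (below a) = H a.
  by rewrite below_indic Ex_indic// NH.
have B0 : 0 <= B by rewrite (le_trans _ (gB 0)).
have bg : bmeas g by split => //; exists B.
have bndg : bnd g by exists B.
(* The three errors below are [2 * B + 1], [2 * B] and [4 * B + 1] times [eps]. *)
have K0 : 0 < 8 * B + 2 by rewrite ltr_wpDl// mulr_ge0.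
apply/eqP; rewrite -subr_eq0 -normr_le0; apply/ler_addgt0Pl => eps0 eps00.
rewrite addr0; pose eps := eps0 / (8 * B + 2).
have e0 : 0 < eps by rewrite divr_gt0.
have [M M0 HM] := H_tail e0.
have [dl dl0 gdl] := guc _ e0.
(* Half of [dl], because a cell of the shifted grid [t'] may extend over two cells of [t]. *)
pose h := dl / 2; have h0 : 0 < h by rewrite divr_gt0.
pose t (j : nat) := - M + h * j%:R.
have tS j : t j.+1 = t j + h by rewrite /t -natr1; ring.
have t_lt j : t j < t j.+1 by rewrite tS ltrDl.
have t_mono : {homo t : i j / (i <= j)%N >-> i <= j}.
  by move=> i j ij; rewrite lerD2l ler_pM2l// ler_nat.
have [J HJ] : exists J : nat, M <= t J.
  exists (Num.bound (2 * M / h)); rewrite /t.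
  have X0 : 0 <= 2 * M / h by apply: divr_ge0 (ltW h0); apply: mulr_ge0 => //; exact: ltW.
  have := ltW (archi_boundP X0); rewrite ler_pdivrMr// [leRHS]mulrC => hJ.
  by rewrite addrC lerBrDr (le_trans _ hJ)// mulr2n mulrDl !mul1r.
(* The discrepancies between [H] and [G] add up over the nodes, so each must be small relative to
   their number. *)
pose kappa := eps / J.+1%:R.
have k0 : 0 < kappa by rewrite divr_gt0.
have keps : kappa <= eps by rewrite ler_piMr ?(ltW e0)// invf_le1// ler1n.
(* The grid [t] serves for [N] and the grid [t'], slightly to its right, for the
   limit functional: [H (t j)] and [G (t' j)] nearly agree even at a jump. *)
have pick_ j : exists y, [/\ t j < y, y < t j.+1 & `|G y - H (t j)| <= kappa].
  have [y1 ty1 Gy1] := H_approx (t j) k0.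
  pose y := (t j + Num.min y1 (t j.+1)) / 2.
  have tm : t j < Num.min y1 (t j.+1) by rewrite lt_min ty1 t_lt.
  have [ty ym] := (midf_lt tm).
  have /andP[yy1 yt] : (y < y1) && (y < t j.+1) by rewrite -lt_min.
  exists y; split => //.
  rewrite ger0_norm ?subr_ge0 ?H_le// lerBlDl (le_trans _ Gy1)//.
  by apply: G_nd; exact: ltW.
pose t' j := sval (cid (pick_ j)).
have t'P j : [/\ t j < t' j, t' j < t j.+1 & `|G (t' j) - H (t j)| <= kappa].
  by rewrite /t'; case: cid.
have t'_mono : {homo t' : i j / (i <= j)%N >-> i <= j}.
  apply: homo_leq => [//|x y z /le_trans|j]; first exact.
  by have [_ a _] := t'P j; have [b _ _] := t'P j.+1; rewrite ltW// (lt_trans a).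
pose sumH := \sum_(j < J) g (t j) * (H (t j.+1) - H (t j)).
pose sumG := \sum_(j < J) g (t j) * (G (t' j.+1) - G (t' j)).
have outH : 1 - (H (t J) - H (t 0%N)) <= 2 * eps.
  have h1 := (HM _).2 HJ; have h2 : H (t 0%N) <= eps by apply: (HM _).1; rewrite /t mulr0 addr0.
  by move: h1 h2; set a := H _; set b := H _; lra.
have outG : 1 - (G (t' J) - G (t' 0%N)) <= 4 * eps.
  have [_ _ +] := t'P J; have [_ _ +] := t'P 0%N; rewrite !ler_norml => /andP[_ a] /andP[b _].
  by move: a b outH keps; set x1 := G _; set x2 := H _; set x3 := G _; set x4 := H _; lra.
have stepN : `|Ex N g - sumH| <= B * (2 * eps) + eps.
  have := @functional_step R (@bmeas _ R R) (Ex N)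
    (@bmeasD _ _ _) (@bmeasZ _ _ _) (@ExD _ _ _ N) (@ExZ _ _ _ N) (@Ex_le _ _ _ N)
    (bmeas_cst R (1 : R)) (Ex_cst N 1) mb g t (fun j => g (t j)) J eps B bg t_mono (ltW e0) gB.
  have -> : \sum_(j < J) g (t j) * (Ex N (below (t j.+1)) - Ex N (below (t j))) = sumH.
    by apply: eq_bigr => j _; rewrite !ExH.
  rewrite !ExH => stepH; apply: le_trans (stepH _) _; last by rewrite lerD2r ler_wpM2l.
  move=> x j _ /andP[tx xt]; apply: gdl; rewrite ger0_norm ?subr_ge0 ?(ltW tx)//.
  by move: xt; rewrite tS -lerBlDl => /le_trans; apply; rewrite /h ler_pdivrMr// ler_peMr ?(ltW dl0)// ler1n.
have stepL : `|L g - sumG| <= B * (4 * eps) + eps.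
  have := @functional_step R bnd L bndD bndZ lim_avgD lim_avgZ lim_avg_le bnd1 lim_avg1 bnd_below
    g t' (fun j => g (t j)) J eps B bndg t'_mono (ltW e0) gB.
  move=> stepG; apply: le_trans (stepG _) _; last by rewrite lerD2r ler_wpM2l.
  move=> x j _ /andP[tx xt]; have [a _ _] := t'P j; have [_ b _] := t'P j.+1.
  have tx' := lt_trans a tx.
  apply: gdl; rewrite ger0_norm ?subr_ge0 ?(ltW tx')// lerBlDl (le_trans xt)// (le_trans (ltW b))//.
  by rewrite !tS -addrA lerD2l /h -splitr.
have stepD : `|sumH - sumG| <= 2 * B * eps.
  rewrite /sumH /sumG -sumrB; apply: le_trans (ler_norm_sum _ _ _) _.
  apply: (@le_trans _ _ (\sum_(j < J) B * (kappa + kappa))).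
    apply: ler_sum => j _; rewrite -mulrBr normrM ler_pM//.
    have [_ _ a] := t'P j; have [_ _ b] := t'P j.+1.
    rewrite (_ : H (t j.+1) - H (t j) - (G (t' j.+1) - G (t' j)) = (G (t' j) - H (t j)) - (G (t' j.+1) - H (t j.+1))); last by ring.
    by rewrite (le_trans (ler_normB _ _))// lerD.
  rewrite sumr_const card_ord -[_ *+ J]mulr_natr.
  rewrite [leLHS](_ : _ = 2 * B * (kappa * J%:R)); last by ring.
  apply: ler_wpM2l; first exact: mulr_ge0.
  by rewrite /kappa mulrAC ler_pdivrMr// ler_pM2l// ler_nat.
have -> : Ex N g - L g = (Ex N g - sumH) + (sumH - sumG) - (L g - sumG) by ring.
have -> : eps0 = B * (2 * eps) + eps + 2 * B * eps + (B * (4 * eps) + eps).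
  by rewrite /eps; field; rewrite gt_eqF.
apply: le_trans (ler_normB _ _) _; apply: lerD => //.
by apply: le_trans (ler_normD _ _) _; apply: lerD.
Unshelve. all: by end_near. Qed.

End limit_law.

Section kernel_regularity.
Variables (R : realType) (z : R[i]).
Hypothesis Imz : 0 < Im z.

Lemma kernel_lip (x y : R) :
  normc (stieltjes_kernel z x - stieltjes_kernel z y) <= `|x - y| / Im z ^+ 2.
Proof.
have kd (u : R) : u%:C - z != 0.
  apply/eqP => /(congr1 (@complex.Im _)) /eqP.
  by rewrite ImB /= sub0r oppr_eq0 gt_eqF.
have -> : stieltjes_kernel z x - stieltjes_kernel z y =
    (y - x)%:C * (stieltjes_kernel z x * stieltjes_kernel z y).
  rewrite /stieltjes_kernel rmorphB; have := kd x; have := kd y => ? ?.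
  by field; apply/andP.
rewrite normcM normc_real distrC ler_wpM2l// normcM expr2 invfM.
by rewrite ler_pM ?normc_ge0// normc_kernel_le.
Qed.

Let unif (g : R -> R) :
  (forall x y, `|g x - g y| <= normc (stieltjes_kernel z x - stieltjes_kernel z y)) ->
  forall eps, 0 < eps -> exists2 dl, 0 < dl & forall x y, `|x - y| <= dl -> `|g x - g y| <= eps.
Proof.
move=> gk eps eps0; have z2 : 0 < Im z ^+ 2 by rewrite exprn_gt0.
exists (eps * Im z ^+ 2) => [|x y xy]; first exact: mulr_gt0.
apply: le_trans (gk x y) _; apply: le_trans (kernel_lip x y) _.
by rewrite ler_pdivrMr.
Qed.

Lemma kernel_unif : let g1 x := Re (stieltjes_kernel z x) in let g2 x := Im (stieltjes_kernel z x) in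
  forall g : R -> R, g = g1 \/ g = g2 ->
  (forall eps, 0 < eps -> exists2 dl, 0 < dl &
     forall x y, `|x - y| <= dl -> `|g x - g y| <= eps) /\
  (forall x, `|g x| <= (Im z)^-1).
Proof.
move=> g1 g2 g [->|->]; split.
- by apply: unif => x y; rewrite -ReB Re_le_normc.
- by move=> x; rewrite (le_trans (Re_le_normc _))// normc_kernel_le.
- by apply: unif => x y; rewrite -ImB Im_le_normc.
- by move=> x; rewrite (le_trans (Im_le_normc _))// normc_kernel_le.
Qed.

End kernel_regularity.

Lemma unif_continuous (R : realType) (g : R -> R) :
  (forall eps, 0 < eps -> exists2 dl, 0 < dl &
     forall x y, `|x - y| <= dl -> `|g x - g y| <= eps) -> continuous g.
Proof.
move=> gu x; apply/cvgrPdist_le => eps /gu[dl dl0 gdl].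
near=> y; apply: gdl; near: y.
by apply: cvgr_dist_le => //; exact: cvg_id.
Unshelve. all: by end_near. Qed.

Lemma continuous_measurableR (R : realType) (g : R -> R) :
  continuous g -> measurable_fun setT g.
Proof. exact: continuous_measurable_fun. Qed.

Section kernel_average.
Variable R : realType.

Definition kavg (t : seq R) (z : R[i]) : R[i] :=
  (avg t (fun x => Re (stieltjes_kernel z x)) +i* avg t (fun x => Im (stieltjes_kernel z x)))%C.

Lemma kavgE t z : kavg t z = ((size t)%:R^-1)%:C * \sum_(x <- t) stieltjes_kernel z x.
Proof. by apply: complex_eqP; rewrite ?ReZ ?ImZ ?Re_sum ?Im_sum. Qed.

Variable c : R.
Hypothesis c_ge0 : 0 <= c.

(** Tightness estimate: when [F] is a mean of Stieltjes kernels at [i M], [1 - M * Im F] is the mean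
    of [x^2 / (x^2 + M^2)]. Taking real parts in [z F = -1 - c psi F] at [z = i M] expresses it by
    [psi F], which is of order [M^-2]. *)
Lemma small_root_Im (M : R) F : 8 <= M -> normc F <= 2^-1 -> cubic c (0 +i* M)%C F = 0 ->
  1 - M * Im F <= 2 * c * (1 + c) ^+ 2 / M.
Proof.
move=> M8 F2 F0; have M0 : 0 < M by rewrite (lt_le_trans _ M8).
have zF := small_rootE F2 F0; have psF := normc_psi_le F2.
have F0' := normc_ge0 F.
have MF : normc F <= (1 + c) / M.
  rewrite ler_pdivlMr// mulrC.
  have -> : M = normc (0 +i* M)%C by rewrite /normc expr0n add0r sqrtr_sqr gtr0_norm.
  rewrite -normcM zF -opprD normcN (le_trans (le_normcD _ _))// normc1 lerD2l.
  rewrite normcM normc_real ger0_norm// ler_piMr// (le_trans psF)//.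
  have : normc F ^+ 2 <= 2^-1 ^+ 2 by rewrite ler_pXn2r ?nnegrE// invr_ge0.
  by set q := normc F ^+ 2; rewrite expr2; lra.
have ImE : M * Im F = 1 + c * Re (psi F).
  have := congr1 Re zF; rewrite ReM ReB ReZ /= mul0r sub0r => h.
  by rewrite -[LHS]opprK h opprD !opprK.
rewrite ImE opprD addNKr -mulrN.
apply: (@le_trans _ _ (c * (2 * normc F ^+ 2))).
  rewrite ler_wpM2l// (le_trans _ psF)// (le_trans _ (Re_le_normc _))//.
  by rewrite -normrN ler_norm.
rewrite mulrCA -mulrA -mulrA ler_pM2l// ler_wpM2l//.
apply: (@le_trans _ _ (((1 + c) / M) ^+ 2)).
  by rewrite ler_pXn2r ?nnegrE// divr_ge0 ?addr_ge0// ltW.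
rewrite expr_div_n ler_wpM2l ?sqr_ge0// lef_pV2 ?posrE ?exprn_gt0//.
by rewrite expr2 ler_peMl ?(ltW M0)// (le_trans _ M8)// ler1n.
Qed.

End kernel_average.

Lemma cvg_sum0 (R : realType) (I : Type) (l : seq I) (Q : pred I) (u : nat -> I -> R) :
  (forall i, Q i -> u r i @[r --> \oo] --> (0 : R)) ->
  \sum_(i <- l | Q i) u r i @[r --> \oo] --> (0 : R).
Proof.
move=> Hu; elim: l => [|i l IH].
  by under eq_fun do rewrite big_nil; exact: cvg_cst.
under eq_fun do rewrite big_cons.
have [Qi|//] := boolP (Q i).
by have H := cvgD (Hu i Qi) IH; rewrite addr0 in H; exact: H.
Qed.

Section empirical_limit.
Variables (R : realType) (disp : nat -> measure_display) (T : forall r, measurableType (disp r)).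
Variables (P : forall r, probability (T r) R) (s : forall r, T r -> seq R) (c eta0 : R).
Hypothesis c_ge0 : 0 <= c.
Hypothesis eta0_ge8 : 8 <= eta0.
Hypothesis s_gt0 : forall r w, (0 < r)%N -> (0 < size (@s r w))%N.
Hypothesis kavg_bmeas : forall r z F, 0 < Im z -> bmeas (fun w => normc (kavg (@s r w) z - F)).

Let valid (zF : R[i] * R[i]) :=
  [/\ eta0 <= Im zF.1, normc zF.2 <= 2^-1 & cubic c zF.1 zF.2 = 0].

Hypothesis kavg_cvg : forall zF, valid zF ->
  Ex (P r) (fun w => normc (kavg (@s r w) zF.1 - zF.2)) @[r --> \oo] --> (0 : R).

(* Working with pairs [(r, w)], all late pairs with good averages at finitely many
   [z] form a filter, proper because the expectations tend to 0; the limit measure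
   is then built from deterministic averages. *)
Let base (l : seq (R[i] * R[i])) (r0 : nat) (eps : R) : set {r & T r} :=
  [set i | (r0 <= projT1 i)%N /\
     forall zF, zF \in l -> normc (kavg (s (projT2 i)) zF.1 - zF.2) <= eps].

Let Fl : set_system {r & T r} :=
  [set A | exists l r0 eps, [/\ 0 < eps, forall zF, zF \in l -> valid zF & base l r0 eps `<=` A]].

Let Fl_filter : Filter Fl.
Proof.
split.
- by exists [::], 0%N, 1.
- move=> A B [l [r0 [e [e0 lv lA]]]] [l' [r0' [e' [e'0 lv' lB]]]].
  exists (l ++ l'), (maxn r0 r0'), (Num.min e e'); split.
  + by rewrite lt_min e0.
  + by move=> zF; rewrite mem_cat => /orP[/lv|/lv'].
  + move=> i [+ il]; rewrite geq_max => /andP[r1 r2].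
    by split; [apply: lA|apply: lB]; split => // zF zFl;
      have := il zF; rewrite mem_cat zFl ?orbT => /(_ isT);
      rewrite le_min => /andP[].
- move=> A B AB [l [r0 [e [e0 lv lA]]]]; exists l, r0, e; split => //.
  exact: subset_trans AB.
Qed.

Let Fl_proper : ProperFilter Fl.
Proof.
apply: Build_ProperFilter_ex Fl_filter => A [l [r0 [e [e0 lv lA]]]].
have Imz zF : zF \in l -> 0 < Im zF.1.
  by move=> /lv[+ _ _]; apply: lt_le_trans; rewrite (lt_le_trans _ eta0_ge8).
pose X r (w : T r) := \sum_(zF <- l | zF \in l) normc (kavg (s w) zF.1 - zF.2).
have EX : Ex (P r) (@X r) @[r --> \oo] --> (0 : R).
  have -> : (fun r => Ex (P r) (@X r)) =
     (fun r => \sum_(zF <- l | zF \in l) Ex (P r) (fun w => normc (kavg (@s r w) zF.1 - zF.2))).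
    by apply/funext => r; apply: Ex_sum => zF /Imz; exact: kavg_bmeas.
  by apply: cvg_sum0 => zF /lv; exact: kavg_cvg.
have [r1 _ Hr1] : \forall r \near \oo, Ex (P r) (@X r) < e by exact: (cvgr_lt 0).
pose r := maxn r0 r1.
have [w Xw] : exists w : T r, X r w <= e.
  apply: contrapT => /forallNP nX.
  have := Hr1 r (leq_maxr _ _); apply/negP; rewrite -leNgt -[leLHS](Ex_cst (P r) e).
  apply: Ex_le => [|| w]; [exact: bmeas_cst| |].
    by apply: bmeas_sum => zF /Imz; exact: kavg_bmeas.
  by have /negP := nX w; rewrite -ltNge => /ltW.
exists (existT _ r w); apply: lA; split => [|zF zFl] /=; first exact: leq_maxl.
apply: le_trans Xw; rewrite /X (big_rem zF)//= zFl lerDl.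
by apply: sumr_ge0 => *; exact: normc_ge0.
Qed.

Lemma empirical_limit : exists N : probability R R,
  forall z F, eta0 <= Im z -> normc F <= 2^-1 -> cubic c z F = 0 -> stieltjes N z = F.
Proof.
have [U [UU FlU]] := ultraFilterLemma Fl_proper.
pose S (i : {r & T r}) := s (projT2 i).
have S_gt0 : \forall i \near U, (0 < size (S i))%N.
  by apply: FlU; exists [::], 1%N, 1; split => // i [i1 _]; exact: s_gt0.
have kcvg z F : eta0 <= Im z -> normc F <= 2^-1 -> cubic c z F = 0 ->
    lim_avg U S (fun x => Re (stieltjes_kernel z x)) = Re F /\
    lim_avg U S (fun x => Im (stieltjes_kernel z x)) = Im F.
  move=> z0 F2 F0.
  have near_ eps : 0 < eps -> \forall i \near U, normc (kavg (S i) z - F) <= eps.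
    move=> e0; apply: FlU; exists [:: (z, F)], 0%N, eps; split => //.
      by move=> zF; rewrite inE => /eqP ->.
    by move=> i [_ /(_ (z, F))]; rewrite inE eqxx => /(_ isT).
  split; apply: lim_avgE; apply/cvgrPdist_le => eps /near_; apply: filterS => i;
    apply: le_trans; rewrite distrC.
    by apply: le_trans (Re_le_normc _); rewrite ReB.
  by apply: le_trans (Im_le_normc _); rewrite ImB.
have tight eps : 0 < eps -> exists M : R, lim_avg U S (fun x => (M < `|x|)%R%:R) <= eps.
  (* The outer factor [2] reflects that [x^2 / (x^2 + M^2)] is at least [1 / 2] when [|x| > M]. *)
  move=> e0; pose K := 2 * (2 * c * (1 + c) ^+ 2).
  pose M := Num.max eta0 (K / eps).
  have M8 : 8 <= M by rewrite le_max eta0_ge8.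
  have M0 : 0 < M by rewrite (lt_le_trans _ M8).
  have Me : K / M <= eps by rewrite ler_pdivrMr// -ler_pdivrMl// mulrC le_max lexx orbT.
  have [F [F2 F0]] : exists F, normc F <= 2^-1 /\ cubic c (0 +i* M)%C F = 0.
    exact: small_root.
  exists M; apply: le_trans Me.
  have M_ge : eta0 <= M by rewrite le_max lexx.
  have [_ ImF] := kcvg (0 +i* M)%C F M_ge F2 F0.
  pose g x := Im (stieltjes_kernel (0 +i* M)%C x).
  have bg : bnd g.
    exists M^-1 => [|x]; first by rewrite invr_ge0 ltW.
    by rewrite (le_trans (Im_le_normc _))// normc_kernel_le.
  have bMg := bndZ (- M) bg; have b1Mg := bndD (bnd1 R) bMg.
  have bt := bnd_tail M.
  have LE : lim_avg U S (fun x => 2 * (1 + - M * g x)) = 2 * (1 - M * Im F).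
    by rewrite lim_avgZ// (lim_avgD S (bnd1 R) bMg) lim_avgZ// lim_avg1// ImF mulNr.
  apply: (@le_trans _ _ (2 * (1 - M * Im F))); last first.
    by rewrite /K -mulrA ler_pM2l//; exact: small_root_Im.
  rewrite -LE; apply: lim_avg_le => // [|x]; first exact: bndZ.
  rewrite /g Im_kernel_poisson// /poisson subr0.
  have q0 : 0 < x ^+ 2 + M ^+ 2 by rewrite ltr_wpDl ?sqr_ge0 ?exprn_gt0.
  have -> : 1 + - M * (M / (x ^+ 2 + M ^+ 2)) = x ^+ 2 / (x ^+ 2 + M ^+ 2).
    by field; rewrite gt_eqF.
  have [Mx|_] := ltP M `|x|; last by rewrite mulr_ge0// divr_ge0 ?sqr_ge0 ?(ltW q0).
  have x2 : M ^+ 2 <= x ^+ 2 by rewrite -[x ^+ 2]real_normK ?num_real// ler_pXn2r ?nnegrE ?(ltW M0) ?(ltW Mx).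
  by rewrite mulrA ler_pdivlMr// mul1r mulr2n mulrDl !mul1r lerD2l.
have [N HN] := limit_law S_gt0 tight.
exists N => z F z0 F2 F0.
have Imz : 0 < Im z by rewrite (lt_le_trans _ z0)// (lt_le_trans _ eta0_ge8).
have [ReF ImF] := kcvg z F z0 F2 F0.
have ku := kernel_unif Imz.
have HRe := ku _ (or_introl erefl); have HIm := ku _ (or_intror erefl).
apply: complex_eqP => /=.
  rewrite -ReF -(HN _ (Im z)^-1)//; [|exact: HRe.2|exact: HRe.1].
  by apply: continuous_measurableR; apply: unif_continuous; exact: HRe.1.
rewrite -ImF -(HN _ (Im z)^-1)//; [|exact: HIm.2|exact: HIm.1].
by apply: continuous_measurableR; apply: unif_continuous; exact: HIm.1.
Qed.

End empirical_limit.

(** * Continuation of the cubic equation *)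

Section weighted_norm.
Variable R : realType.
Implicit Types (p q : {poly R[i]}) (rho : R).

(** Weighted sum of the moduli of the coefficients: submultiplicative and an upper bound on the disk
    of radius [rho]. It allows power series estimates with polynomials alone. *)
Definition wnorm rho p : R := \sum_(k < size p) normc p`_k * rho ^+ k.

Lemma wnorm_wide rho p n : (size p <= n)%N -> wnorm rho p = \sum_(k < n) normc p`_k * rho ^+ k.
Proof.
move=> pn; rewrite /wnorm (big_ord_widen n (fun k => normc p`_k * rho ^+ k) pn) big_mkcond.
apply: eq_bigr => k _; have [//|kp] := ltnP k (size p).
by rewrite nth_default// normc0 mul0r.
Qed.

Lemma wnorm_ge0 rho p : 0 <= rho -> 0 <= wnorm rho p.
Proof. by move=> r0; apply: sumr_ge0 => k _; rewrite mulr_ge0 ?normc_ge0 ?exprn_ge0. Qed.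

Lemma wnormD rho p q : 0 <= rho -> wnorm rho (p + q) <= wnorm rho p + wnorm rho q.
Proof.
move=> r0; pose n := maxn (size p) (size q).
rewrite (@wnorm_wide _ _ n) ?size_polyD// (@wnorm_wide _ p n) ?leq_maxl//.
rewrite (@wnorm_wide _ q n) ?leq_maxr// -big_split; apply: ler_sum => k _ /=.
by rewrite coefD -mulrDl ler_wpM2r ?exprn_ge0// le_normcD.
Qed.

Lemma wnormN rho p : wnorm rho (- p) = wnorm rho p.
Proof. by rewrite /wnorm size_polyN; apply: eq_bigr => k _; rewrite coefN normcN. Qed.

Lemma wnormB rho p q : 0 <= rho -> wnorm rho (p - q) <= wnorm rho p + wnorm rho q.
Proof. by move=> r0; rewrite -(wnormN _ q) wnormD. Qed.

Lemma wnormMXaddC rho p a : wnorm rho (p * 'X + a%:P) = rho * wnorm rho p + normc a.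
Proof.
have sz : (size (p * 'X + a%:P)%R <= (size p).+1)%N.
  by rewrite size_MXaddC; case: ifP.
rewrite (wnorm_wide _ sz) big_ord_recl expr0 mulr1 coefD coefMX coefC add0r addrC.
congr (_ + _); rewrite /wnorm mulr_sumr; apply: eq_bigr => k _.
by rewrite coefD coefMX coefC /= addr0 exprS mulrCA.
Qed.

Lemma wnormC rho a : wnorm rho a%:P = normc a.
Proof. by have := wnormMXaddC rho 0 a; rewrite mul0r add0r /wnorm size_poly0 big_ord0 mulr0 add0r. Qed.

Lemma wnormMX rho p : wnorm rho (p * 'X) = rho * wnorm rho p.
Proof. by have := wnormMXaddC rho p 0; rewrite addr0 normc0 addr0. Qed.

Lemma wnormZ rho a p : wnorm rho (a *: p) <= normc a * wnorm rho p.
Proof.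
rewrite (wnorm_wide _ (size_scale_leq a p)) /wnorm mulr_sumr.
by apply: ler_sum => k _; rewrite coefZ normcM mulrA.
Qed.

Lemma wnormM rho p q : 0 <= rho -> wnorm rho (p * q) <= wnorm rho p * wnorm rho q.
Proof.
move=> r0; elim/poly_ind: p => [|p a IH].
  by rewrite mul0r /wnorm size_poly0 !big_ord0 mul0r.
have -> : (p * 'X + a%:P) * q = p * q * 'X + a *: q.
  by rewrite mulrDl mulrAC mul_polyC.
rewrite (le_trans (wnormD _ _ r0))// wnormMX wnormMXaddC mulrDl lerD ?wnormZ//.
by rewrite -mulrA ler_wpM2l.
Qed.

Lemma wnormMXn rho p n : wnorm rho (p * 'X^n) = rho ^+ n * wnorm rho p.
Proof.
by elim: n => [|n IH]; rewrite ?expr0 ?mulr1 ?mul1r// exprSr mulrA wnormMX IH exprS mulrA.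
Qed.

Lemma wnorm_le rho rho' p : 0 <= rho -> rho <= rho' -> wnorm rho p <= wnorm rho' p.
Proof.
move=> r0 rr; apply: ler_sum => k _; rewrite ler_wpM2l ?normc_ge0//.
by rewrite lerXn2r ?nnegrE// (le_trans r0).
Qed.

Lemma normc_horner p z : normc p.[z] <= wnorm (normc z) p.
Proof.
rewrite horner_coef (le_trans (le_normc_sum _ _ _))//.
by apply: ler_sum => k _; rewrite normcM normcX.
Qed.

(* Smallness of order [s^n] along a ray forces divisibility by ['X^n]. *)
Lemma poly_vanish p (C : R) n : 0 <= C ->
  (forall s, 0 < s < 1 -> normc p.[(0 +i* s)%C] <= C * s ^+ n) -> exists q, p = q * 'X^n.
Proof.
move=> C0; elim: n p => [|n IH] p Hp; first by exists p; rewrite mulr1.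
have ns (s : R) : 0 < s -> normc (0 +i* s)%C = s.
  by move=> s0; rewrite /normc expr0n add0r sqrtr_sqr gtr0_norm.
have [p' [a pE]] : exists p' a, p = p' * 'X + a%:P.
  by elim/poly_ind: {IH Hp} p => [|p' a _]; [exists 0, 0; rewrite mul0r add0r|exists p', a].
have pEs s : p.[(0 +i* s)%C] = p'.[(0 +i* s)%C] * (0 +i* s)%C + a.
  by rewrite pE !hornerE.
have a0 : a = 0.
  pose K := C + wnorm 1 p' + 1.
  have K0 : 0 < K by rewrite ltr_wpDl// addr_ge0// wnorm_ge0.
  apply/eqP; rewrite -normc_eq0 eq_le normc_ge0 andbT leNgt; apply/negP => a_gt0.
  pose s := Num.min 2^-1 (normc a / (2 * K)).
  have s0 : 0 < s by rewrite lt_min invr_gt0 ltr0n divr_gt0// mulr_gt0.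
  have s1 : s < 1 by rewrite gt_min invf_lt1// ltr1n.
  have sa : s * K <= normc a / 2.
    by rewrite -ler_pdivlMr// -mulrA -invfM ge_min lexx orbT.
  have aE : a = p.[(0 +i* s)%C] - p'.[(0 +i* s)%C] * (0 +i* s)%C by rewrite pEs addrC addKr.
  have : normc a <= s * K.
    rewrite {1}aE (le_trans (le_normcD _ _))// normcN normcM ns//.
    rewrite /K !mulrDr mulr1 (@le_trans _ _ (s * C + s * wnorm 1 p'))//; last by rewrite lerDl ltW.
    apply: lerD.
      rewrite (le_trans (Hp s _)) ?s0// mulrC ler_wpM2r// exprS ler_piMr ?(ltW s0)//.
      by rewrite exprn_ile1 ?(ltW s0) ?(ltW s1).
    rewrite mulrC ler_wpM2l ?(ltW s0)// (le_trans (normc_horner _ _))// ns//.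
    by apply: wnorm_le; rewrite ltW.
  move=> /le_trans /(_ sa); rewrite leNgt => /negP; apply.
  by rewrite ltr_pdivrMr// ltr_pMr// ltr1n.
have [q qE] : exists q, p' = q * 'X^n.
  apply: IH => s /andP[s0 s1].
  have := Hp s; rewrite s0 s1 => /(_ isT).
  rewrite pEs a0 addr0 normcM ns// exprSr mulrA ler_pM2r//.
by exists q; rewrite pE a0 polyC0 addr0 qE exprSr mulrA.
Qed.

End weighted_norm.

(** * Propagating the cubic equation through Taylor polynomials *)

Section continuation.
Variables (R : realType) (c rho : R) (f : R[i] -> R[i]) (z0 : R[i]) (m : nat -> R[i]).
Hypotheses (c_ge0 : 0 <= c) (rho_ge2 : 2 <= rho).
Hypothesis m_le : forall k, normc (m k) <= 2 * (rho^-1) ^+ k.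
Hypothesis f_taylor : forall w n, 0 < Im w ->
  normc (f w - \sum_(k < n) m k * (w - z0) ^+ k) <= 2 / Im w * (normc (w - z0) / rho) ^+ n.
Hypothesis f_cubic : forall w, rho <= Im w -> cubic c w (f w) = 0.
Hypothesis Im_z0 : Im z0 = rho.

Let rho_gt0 : 0 < rho. Proof. exact: lt_le_trans rho_ge2. Qed.

Let trunc n : {poly R[i]} := \poly_(k < n) m k.
(** The left side of the cubic for the Taylor polynomial of [f], as a polynomial in the displacement
    from [z0]. *)
Let tcubic n : {poly R[i]} :=
  (z0%:P + 'X) * trunc n ^+ 3 + (1 - c%:C)%:P * trunc n ^+ 2 - (z0%:P + 'X) * trunc n - 1.

Let tcubicE n x : (tcubic n).[x] = cubic c (z0 + x) (trunc n).[x].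
Proof. by rewrite /tcubic /cubic !(hornerE, horner_exp). Qed.

Let truncE n x : (trunc n).[x] = \sum_(k < n) m k * x ^+ k.
Proof. by rewrite horner_poly. Qed.

Let cubic_lip z F G (K L : R) : normc z <= L -> normc F <= K -> normc G <= K ->
  normc (cubic c z F - cubic c z G) <= (L * (3 * K ^+ 2) + (1 + c) * (2 * K) + L) * normc (F - G).
Proof.
move=> zL FK GK; have K0 := le_trans (normc_ge0 _) FK; have L0 := le_trans (normc_ge0 _) zL.
have -> : cubic c z F - cubic c z G =
   (z * (F ^+ 2 + F * G + G ^+ 2) + (1 - c%:C) * (F + G) - z) * (F - G).
  by rewrite /cubic; ring.
rewrite normcM ler_wpM2r ?normc_ge0// (le_trans (le_normcD _ _))// normcN lerD//.
rewrite (le_trans (le_normcD _ _))// lerD// normcM ler_pM ?normc_ge0//.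
- rewrite (le_trans (le_normcD _ _))// [3 * _](_ : _ = K ^+ 2 + K ^+ 2 + K ^+ 2); last by ring.
  rewrite lerD// ?normcX ?ler_pXn2r ?nnegrE ?normc_ge0//.
  rewrite (le_trans (le_normcD _ _))// lerD// ?normcX ?ler_pXn2r ?nnegrE ?normc_ge0//.
  by rewrite normcM expr2 ler_pM ?normc_ge0.
- rewrite (le_trans (le_normcD _ _))// normc1 lerD2l normcN normc_real ger0_norm//.
- by rewrite (le_trans (le_normcD _ _))// mulr2n mulrDl !mul1r lerD.
Qed.

Let wnorm_trunc r1 n : 0 <= r1 < rho -> wnorm r1 (trunc n) <= 2 / (1 - r1 / rho).
Proof.
move=> /andP[r0 r1rho].
have x1 : r1 / rho < 1 by rewrite ltr_pdivrMr// mul1r.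
rewrite (@wnorm_wide _ _ _ n) ?size_poly//.
apply: (@le_trans _ _ (2 * \sum_(k < n) (r1 / rho) ^+ k)).
  rewrite mulr_sumr; apply: ler_sum => k _.
  rewrite coef_poly ltn_ord [r1 / rho]mulrC exprMn mulrA ler_wpM2r ?exprn_ge0//.
rewrite ler_pM2l// -[leRHS]div1r ler_pdivlMr ?subr_gt0// mulrC.
have -> : (1 - r1 / rho) * \sum_(k < n) (r1 / rho) ^+ k = 1 - (r1 / rho) ^+ n.
  by rewrite -opprB mulNr -subrX1 opprB.
by rewrite lerBlDr lerDl exprn_ge0// divr_ge0// ltW.
Qed.

Let trunc_le n x : normc x < rho -> normc (trunc n).[x] <= 2 / (1 - normc x / rho).
Proof.
by move=> xr; rewrite (le_trans (normc_horner _ _))// wnorm_trunc// normc_ge0.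
Qed.

(** On the vertical ray above [z0] the function [f] solves the cubic exactly, so [tcubic n] reflects
    only the Taylor remainder there, which is of order [s ^+ n]. *)
Let tcubic_factor n : exists q, tcubic n = q * 'X^n.
Proof.
(* [4 = 2 / (1 - 1 / 2)], since [s / rho] is at most [1 / 2] along the ray. *)
pose L := normc z0 + 1; pose K : R := 4.
apply: (@poly_vanish _ _ ((L * (3 * K ^+ 2) + (1 + c) * (2 * K) + L) * 1)).
  by rewrite mulr1 !addr_ge0 ?mulr_ge0 ?exprn_ge0 ?addr_ge0 ?normc_ge0.
move=> s /andP[s0 s1].
have nx : normc (0 +i* s)%C = s by rewrite /normc expr0n add0r sqrtr_sqr gtr0_norm.
have sr : s < rho by rewrite (lt_trans s1)// (lt_le_trans _ rho_ge2)// ltr1n.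
have Imw : Im (z0 + (0 +i* s)%C) = rho + s by rewrite ImD Im_z0.
have Imw0 : 0 < Im (z0 + (0 +i* s)%C) by rewrite Imw addr_gt0.
have fT := f_taylor n Imw0; rewrite addrAC subrr add0r nx -truncE in fT.
have TK : normc (trunc n).[(0 +i* s)%C] <= K.
  rewrite (le_trans (trunc_le n _)) ?nx// ler_pdivrMr ?subr_gt0 ?ltr_pdivrMr ?mul1r//.
  have : s / rho <= 2^-1.
    by rewrite ler_pdivrMr// (le_trans (ltW s1))// -ler_pdivrMl ?invr_gt0// invrK mulr1.
  by rewrite /K; lra.
have err : normc (f (z0 + (0 +i* s)%C) - (trunc n).[(0 +i* s)%C]) <= s ^+ n.
  apply: le_trans fT _; rewrite -[leRHS]mul1r ler_pM ?exprn_ge0 ?divr_ge0 ?(ltW s0) ?(ltW rho_gt0) ?(ltW Imw0)//.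
    rewrite ler_pdivrMr// mul1r Imw (le_trans rho_ge2)// lerDl ltW//.
  apply: lerXn2r; rewrite ?nnegrE ?divr_ge0 ?(ltW s0) ?(ltW rho_gt0)// ler_piMr ?(ltW s0)//.
  by rewrite invf_le1// (le_trans _ rho_ge2)// ler1n.
have fK : normc (f (z0 + (0 +i* s)%C)) <= K.
  have := f_taylor 0 Imw0; rewrite big_ord0 subr0 expr0 mulr1 => /le_trans; apply.
  rewrite ler_pdivrMr// Imw /K; have := rho_ge2; lra.
rewrite tcubicE -[cubic _ _ _]subr0 -(f_cubic (w := z0 + (0 +i* s)%C)); last by rewrite Imw lerDl ltW.
rewrite (le_trans (@cubic_lip _ _ _ K L _ TK fK))//.
  by rewrite (le_trans (le_normcD _ _))// nx lerD2l ltW.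
rewrite mulr1 normcB ler_wpM2l//.
by rewrite !addr_ge0 ?mulr_ge0 ?exprn_ge0 ?addr_ge0 ?normc_ge0.
Qed.

(* [tcubic n] is divisible by ['X^n] and of bounded weighted norm, so that it decays
   geometrically inside the disk of radius [rho]. *)
Lemma cubic_continuation w : Re w = Re z0 -> 0 < Im w -> cubic c w (f w) = 0.
Proof.
move=> wx Imw; have [/f_cubic//|wrho] := leP rho (Im w).
pose x := w - z0.
have xE : x = (0 +i* (Im w - rho))%C.
  by apply: complex_eqP; rewrite ?ReB ?ImB /= ?wx ?subrr ?Im_z0.
have nx : normc x = rho - Im w.
  by rewrite xE /normc expr0n add0r sqrtr_sqr ltr0_norm ?opprB// subr_lt0.
have x0 : 0 <= normc x by exact: normc_ge0.
have xr : normc x < rho by rewrite nx gtrBl.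
have wE : w = z0 + x by rewrite addrC subrK.
(* An intermediate radius: below [rho] the weighted norms stay bounded in [n], and above [normc x]
   the factor ['X^n] gains [(normc x / r1) ^+ n]. *)
pose r1 := (normc x + rho) / 2.
have [xr1 r1r] := midf_lt xr; rewrite -/r1 in xr1 r1r.
have r10 : 0 <= r1 by rewrite (le_trans x0) ?ltW.
have r1p : 0 < r1 by exact: le_lt_trans xr1.
pose th := normc x / r1.
have th0 : 0 <= th by rewrite divr_ge0.
have th1 : th < 1 by rewrite ltr_pdivrMr// mul1r.
pose W := 2 / (1 - r1 / rho).
pose A := (normc z0 + r1) * W ^+ 3 + (1 + c) * W ^+ 2 + (normc z0 + r1) * W + 1.
have wA n : wnorm r1 (tcubic n) <= A.
  have wT : wnorm r1 (trunc n) <= W by apply: wnorm_trunc; rewrite r10.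
  have wTn k : wnorm r1 (trunc n ^+ k) <= W ^+ k.
    elim: k => [|k IH]; first by rewrite !expr0 (wnormC r1 1) normc1.
    rewrite !exprS (le_trans (wnormM _ _ r10))// ler_pM// wnorm_ge0//.
  have wz : wnorm r1 (z0%:P + 'X) <= normc z0 + r1.
    rewrite (le_trans (wnormD _ _ r10))// wnormC lerD2l -['X]mul1r wnormMX.
    by rewrite (wnormC r1 1) normc1 mulr1.
  have wc : wnorm r1 (1 - c%:C)%:P <= 1 + c.
    rewrite wnormC (le_trans (le_normcD _ _))// normc1 lerD2l normcN normc_real ger0_norm//.
  rewrite /tcubic (le_trans (wnormB _ _ r10))// lerD//; last by rewrite (wnormC r1 1) normc1.
  rewrite (le_trans (wnormB _ _ r10))// lerD//; last first.
    by rewrite (le_trans (wnormM _ _ r10))// ler_pM// wnorm_ge0.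
  by rewrite (le_trans (wnormD _ _ r10))// lerD// (le_trans (wnormM _ _ r10))// ler_pM// wnorm_ge0.
pose K := 2 / (1 - normc x / rho) + 2 / Im w.
pose L := normc w.
pose B := (L * (3 * K ^+ 2) + (1 + c) * (2 * K) + L) * (2 / Im w).
have i0 : 0 < 2 / Im w by rewrite divr_gt0.
have xr' : normc x / rho < 1 by rewrite ltr_pdivrMr// mul1r.
have j0 : 0 < 2 / (1 - normc x / rho) by rewrite divr_gt0// subr_gt0.
have K0 : 0 <= K by rewrite addr_ge0 ?ltW.
have bound n : normc (cubic c w (f w)) <= (A + B) * th ^+ n.
  have fT := f_taylor n Imw; rewrite -/x -truncE in fT.
  have TK : normc (trunc n).[x] <= K.
    by rewrite (le_trans (trunc_le n xr))// lerDl ltW.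
  have fK : normc (f w) <= K.
    have := f_taylor 0 Imw; rewrite big_ord0 subr0 expr0 mulr1 => /le_trans; apply.
    by rewrite lerDr ltW.
  have -> : cubic c w (f w) = (tcubic n).[x] + (cubic c w (f w) - (tcubic n).[x]).
    by rewrite addrC subrK.
  rewrite (le_trans (le_normcD _ _))// mulrDl lerD//.
    rewrite (le_trans (normc_horner _ _))//; have [q qE] := tcubic_factor n.
    rewrite qE wnormMXn /th expr_div_n mulrA ler_pdivlMr ?exprn_gt0//.
    rewrite [A * _]mulrC -mulrA ler_wpM2l ?exprn_ge0//.
    rewrite mulrC (le_trans _ (wA n))// qE wnormMXn ler_wpM2l ?exprn_ge0//.
    by apply: wnorm_le => //; exact: ltW.
  rewrite tcubicE -wE (le_trans (@cubic_lip _ _ _ K L (lexx _) fK TK))//.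
  rewrite /B -mulrA ler_wpM2l//; last first.
    rewrite (le_trans fT)// ler_wpM2l ?(ltW i0)//.
    apply: lerXn2r; rewrite ?nnegrE ?divr_ge0 ?(addr_ge0 x0) ?(ltW rho_gt0)// /th.
    by rewrite ler_wpM2l// lef_pV2 ?posrE// ltW.
  have L0 : 0 <= L by exact: normc_ge0.
  by do 2?apply: addr_ge0 => //; repeat apply: mulr_ge0 => //; rewrite ?exprn_ge0 ?addr_ge0.
apply/eqP; rewrite -normc_eq0 eq_le normc_ge0 andbT.
have thn : (fun n => (A + B) * th ^+ n) @ \oo --> (0 : R).
  by rewrite -(mulr0 (A + B)); apply: cvgMr; apply: cvg_expr; rewrite ger0_norm.
apply: (ler_cvg_to (cvg_cst _) thn).
by near=> n; exact: bound.
Unshelve. all: by end_near. Qed.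

End continuation.

Section complex_expectation.
Variables (R : realType) (N : probability R R).
Implicit Types g h : R -> R[i].

Definition cbounded g := cmeas g /\ exists B : R, forall x, normc (g x) <= B.

Definition CEx g : R[i] := (Ex N (fun x => Re (g x)) +i* Ex N (fun x => Im (g x)))%C.

Lemma cbounded_bmeas g : cbounded g ->
  bmeas (fun x => Re (g x)) /\ bmeas (fun x => Im (g x)).
Proof.
move=> [[m1 m2] [B gB]]; split; split => //; exists B => x; apply: le_trans (gB x).
  exact: Re_le_normc.
exact: Im_le_normc.
Qed.

Lemma cboundedM g h : cbounded g -> cbounded h -> cbounded (fun x => g x * h x).
Proof.
move=> [mg [B gB]] [mh [C hC]]; split; first exact: cmeasM.
by exists (B * C) => x; rewrite normcM ler_pM ?normc_ge0.
Qed.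

Lemma cbounded_cst a : cbounded (fun=> a).
Proof. by split; [exact: cmeas_cst|exists (normc a)]. Qed.

Lemma cboundedX g n : cbounded g -> cbounded (fun x => g x ^+ n).
Proof.
move=> cg; elim: n => [|n IH]; first exact: cbounded_cst.
by under eq_fun do rewrite exprS; exact: cboundedM.
Qed.

Lemma CExD g h : cbounded g -> cbounded h -> CEx (fun x => g x + h x) = CEx g + CEx h.
Proof.
move=> /cbounded_bmeas[g1 g2] /cbounded_bmeas[h1 h2].
apply: complex_eqP; rewrite ?ReD ?ImD /= -ExD//.
  by under eq_fun do rewrite ReD.
by under eq_fun do rewrite ImD.
Qed.

Lemma CExZ a g : cbounded g -> CEx (fun x => a * g x) = a * CEx g.
Proof.
move=> /cbounded_bmeas[g1 g2].
apply: complex_eqP; rewrite ?ReM ?ImM /= -!ExZ//.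
  rewrite -ExB; [|exact: bmeasZ|exact: bmeasZ].
  by under eq_fun do rewrite ReM.
rewrite -ExD; [|exact: bmeasZ|exact: bmeasZ].
by under eq_fun do rewrite ImM.
Qed.

(** Real and imaginary parts are bounded separately; this is the origin of the factors [2] in the
    assumptions of the continuation argument. *)
Lemma normc_CEx_le g (B : R) : cbounded g -> (forall x, normc (g x) <= B) -> normc (CEx g) <= 2 * B.
Proof.
move=> /cbounded_bmeas[g1 g2] gB; rewrite (le_trans (normc_le_ReIm _))//= mulr2n mulrDl !mul1r.
apply: lerD.
  apply: (le_trans (Ex_norm_le N g1)); rewrite -[leRHS](Ex_cst N).
  apply: Ex_le => [||x]; [exact: bmeas_norm|exact: bmeas_cst|].
  by rewrite (le_trans (Re_le_normc _)).
apply: (le_trans (Ex_norm_le N g2)); rewrite -[leRHS](Ex_cst N).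
apply: Ex_le => [||x]; [exact: bmeas_norm|exact: bmeas_cst|].
by rewrite (le_trans (Im_le_normc _)).
Qed.

Lemma cbounded_kernel z : 0 < Im z -> cbounded (stieltjes_kernel z).
Proof.
move=> Imz; have ku := kernel_unif Imz; split; last first.
  by exists (Im z)^-1 => x; exact: normc_kernel_le.
split; apply: continuous_measurableR; apply: unif_continuous.
  exact: (ku _ (or_introl erefl)).1.
exact: (ku _ (or_intror erefl)).1.
Qed.

(** Iterating the resolvent identity produces the expansion with an exact remainder, so the estimate
    holds for every [w] in the half-plane, inside or outside the disk of convergence. *)
Lemma stieltjes_taylor z0 w n : 0 < Im z0 -> 0 < Im w ->
  normc (stieltjes N w - \sum_(k < n) CEx (fun x => stieltjes_kernel z0 x ^+ k.+1) * (w - z0) ^+ k)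
    <= 2 / Im w * (normc (w - z0) / Im z0) ^+ n.
Proof.
move=> Imz Imw; have cz := cbounded_kernel Imz; have cw := cbounded_kernel Imw.
pose rest n x := (w - z0) ^+ n * (stieltjes_kernel z0 x ^+ n * stieltjes_kernel w x).
have c0 k : cbounded (fun x => stieltjes_kernel z0 x ^+ k * stieltjes_kernel w x).
  by apply: cboundedM => //; exact: cboundedX.
have crest k : cbounded (rest k) by apply: cboundedM => //; exact: cbounded_cst.
have -> : stieltjes N w = \sum_(k < n) CEx (fun x => stieltjes_kernel z0 x ^+ k.+1) * (w - z0) ^+ k
    + CEx (rest n).
  elim: n => [|n IH].
    rewrite big_ord0 add0r /rest; under [in RHS]eq_fun do rewrite !expr0 !mul1r.
    by [].
  rewrite IH big_ord_recr /= -addrA; congr (_ + _).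
  rewrite mulrC -CExZ; last exact: cboundedX.
  rewrite -CExD//; last first.
    by apply: cboundedM; [exact: cbounded_cst|exact: cboundedX].
  congr CEx; apply/funext => x; rewrite /rest.
  rewrite {1}(@kernel_resolvent_identity _ z0 w x Imz Imw) !exprS; ring.
rewrite addrAC subrr add0r (le_trans (normc_CEx_le (B := (Im w)^-1 * (normc (w - z0) / Im z0) ^+ n) _ _))//.
  move=> x; rewrite /rest !normcM !normcX expr_div_n mulrA [leRHS]mulrC ler_pM//.
  - by rewrite mulr_ge0 ?exprn_ge0 ?normc_ge0.
  - exact: normc_ge0.
  - rewrite ler_wpM2l ?exprn_ge0 ?normc_ge0// -exprVn.
    by apply: lerXn2r; rewrite ?nnegrE ?normc_ge0 ?invr_ge0 ?(ltW Imz)// normc_kernel_le.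
  - exact: normc_kernel_le.
by rewrite mulrA.
Qed.

Lemma stieltjes_continuation (c rho : R) : 0 <= c -> 2 <= rho ->
  (forall w, rho <= Im w -> cubic c w (stieltjes N w) = 0) ->
  forall w, 0 < Im w -> cubic c w (stieltjes N w) = 0.
Proof.
move=> c0 rho2 Hrho w Imw; have rho0 : 0 < rho by rewrite (lt_le_trans _ rho2).
pose z0 : R[i] := (Re w +i* rho)%C.
apply: (@cubic_continuation R c rho (stieltjes N) z0
  (fun k => CEx (fun x => stieltjes_kernel z0 x ^+ k.+1))) => //.
- move=> k; apply: (@le_trans _ _ (2 * rho^-1 ^+ k.+1)).
    apply: normc_CEx_le; first by apply: cboundedX; exact: cbounded_kernel.
    move=> x; rewrite normcX; apply: lerXn2r; rewrite ?nnegrE ?normc_ge0 ?invr_ge0 ?(ltW rho0)//.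
    exact: normc_kernel_le.
  rewrite ler_wpM2l// exprS ler_piMl ?exprn_ge0 ?invr_ge0 ?(ltW rho0)//.
  by rewrite invf_le1// (le_trans _ rho2)// ler1n.
- by move=> u n Imu; exact: stieltjes_taylor.
Qed.

Lemma has_stieltjes_pos z : 0 < Im z ->
  N.-integrable setT (fun x => (Re (stieltjes_kernel z x))%:E) /\
  N.-integrable setT (fun x => (Im (stieltjes_kernel z x))%:E).
Proof.
by move=> /cbounded_kernel/cbounded_bmeas[b1 b2]; split; exact: bmeas_integrable.
Qed.

End complex_expectation.

(** * Reflection to the lower half-plane and uniqueness of the transform *)

Section stieltjes_uniqueness.
Variables (R : realType) (c : R).
Implicit Type mu : {measure set R -> \bar R}.

Let ReJ (z : R[i]) : Re (conjc z) = Re z. Proof. by case: z. Qed.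
Let ImJ (z : R[i]) : Im (conjc z) = - Im z. Proof. by case: z. Qed.

Lemma kernel_conj (z : R[i]) (x : R) : stieltjes_kernel (conjc z) x = conjc (stieltjes_kernel z x).
Proof. by rewrite /stieltjes_kernel conjc_inv rmorphB /= oppr0. Qed.

Lemma stieltjes_conj mu (z : R[i]) :
  mu.-integrable setT (fun x => (Im (stieltjes_kernel z x))%:E) ->
  stieltjes mu (conjc z) = conjc (stieltjes mu z).
Proof.
move=> iI; apply: complex_eqP; rewrite ?ReJ ?ImJ /=.
  by congr Rintegral; apply/funext => x; rewrite kernel_conj ReJ.
rewrite -mulN1r -RintegralZl//; congr Rintegral; apply/funext => x.
by rewrite kernel_conj ImJ mulN1r.
Qed.

Lemma cubic_conj (z F : R[i]) : cubic c (conjc z) (conjc F) = conjc (cubic c z F).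
Proof.
have MJ (a b : R[i]) : conjc (a * b) = conjc a * conjc b by rewrite rmorphM.
have BJ (a b : R[i]) : conjc (a - b) = conjc a - conjc b by rewrite rmorphB.
have DJ (a b : R[i]) : conjc (a + b) = conjc a + conjc b by rewrite rmorphD.
have H (x y u : R[i]) : x * y ^+ 3 + u * y ^+ 2 - x * y - 1 =
    x * (y * (y * y)) + u * (y * y) - x * y - 1 by ring.
by rewrite /cubic !H !BJ DJ !MJ BJ conjc1 conjc_real.
Qed.

Lemma Im_stieltjes_gt0 mu (z : R[i]) : has_stieltjes mu -> 0 < Im z ->
  cubic c z (stieltjes mu z) = 0 -> 0 < Im (stieltjes mu z).
Proof.
move=> hmu Imz F0.
have [iR iI] := hmu z (lt0r_neq0 Imz).
have pos x : 0 < Im (stieltjes_kernel z x).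
  have -> : z = (Re z +i* Im z)%C by case: (z).
  by rewrite (Im_kernel_poisson (Re z) x Imz) /poisson divr_gt0// ltr_wpDl ?sqr_ge0 ?exprn_gt0.
rewrite lt_neqAle Rintegral_ge0 ?andbT//; last by move=> x _; exact: ltW.
apply/eqP => I0.
have I0' : (\int[mu]_x `|(Im (stieltjes_kernel z x))%:E| = 0)%E.
  under eq_integral do rewrite abse_EFin ger0_norm ?ltW//.
  have := integrable_fin_num measurableT iI => /fineK <-.
  by rewrite -[fine _]I0.
have mI : measurable_fun setT (fun x => (Im (stieltjes_kernel z x))%:E).
  exact: measurable_int iI.
(* The kernel has positive imaginary part everywhere, so [mu] would vanish. *)
have aeF : {ae mu, forall x, False}.
  have /(ae_eq_integral_abs mu measurableT mI) := I0'.
  by apply: filterS => x /(_ Logic.I) [] H; have := pos x; rewrite H ltxx.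
have R0 : Rintegral mu setT (fun x => Re (stieltjes_kernel z x)) = 0.
  rewrite /Rintegral (ae_eq_integral (cst 0)%E) ?integral0//.
  - exact: measurable_int iR.
  - by apply: filterS aeF.
have s0 : stieltjes mu z = 0 by apply: complex_eqP => /=; [exact: R0|exact: esym I0].
move: F0; rewrite s0 /cubic !expr0n /= !mulr0 addr0 subr0 sub0r => /eqP.
by rewrite oppr_eq0 oner_eq0.
Qed.

Lemma cubic_all_of_upper mu : has_stieltjes mu ->
  (forall z, 0 < Im z -> cubic c z (stieltjes mu z) = 0) -> satisfies_cubic c (stieltjes mu).
Proof.
move=> hmu H z; rewrite neq_lt => /orP[z0|/H//].
have z0' : 0 < Im (conjc z) by rewrite ImJ oppr_gt0.
rewrite -/(cubic c z _) -[z]conjcK stieltjes_conj; last exact: (hmu _ (lt0r_neq0 z0')).2.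
by rewrite cubic_conj H// rmorph0.
Qed.

Hypothesis c_ge0 : 0 <= c.

Lemma stieltjes_unique mu nu : has_stieltjes mu -> has_stieltjes nu ->
  satisfies_cubic c (stieltjes mu) -> satisfies_cubic c (stieltjes nu) ->
  forall z, Im z != 0 -> stieltjes mu z = stieltjes nu z.
Proof.
move=> hmu hnu cmu cnu.
have up z : 0 < Im z -> stieltjes mu z = stieltjes nu z.
  move=> Imz; have z0 := lt0r_neq0 Imz; have Fm := cmu z z0; have Fn := cnu z z0.
  by apply: (cubic_unique c_ge0 Imz) => //; exact: Im_stieltjes_gt0.
move=> z; rewrite neq_lt => /orP[z0|/up//].
have z0' : 0 < Im (conjc z) by rewrite ImJ oppr_gt0.
rewrite -[z]conjcK (stieltjes_conj (hmu _ (lt0r_neq0 z0')).2).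
by rewrite (stieltjes_conj (hnu _ (lt0r_neq0 z0')).2) up.
Qed.

Lemma has_stieltjes_prob (N : probability R R) : has_stieltjes N.
Proof.
move=> z; rewrite neq_lt => /orP[z0|z0]; last exact: has_stieltjes_pos.
have z0' : 0 < Im (conjc z) by rewrite ImJ oppr_gt0.
have [b1 b2] := cbounded_bmeas (cbounded_kernel z0').
rewrite -[z]conjcK; split.
  by under eq_fun do rewrite kernel_conj ReJ; exact: bmeas_integrable.
under eq_fun do rewrite kernel_conj ImJ.
by have := bmeas_integrable N (bmeasN b2).
Qed.

End stieltjes_uniqueness.

(** * Weak convergence in probability *)

Section esd_integral.
Variables (R : realType) (n : nat) (M : 'M[R]_n).
Hypothesis M_sym : M^T = M.

Lemma Rintegral_esd (f : R -> R) : measurable_fun setT f ->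
  Rintegral (esd M) setT f = avg (eigvals M) f.
Proof.
move=> mf.
have pos (g : R -> \bar R) (h : R -> R) : measurable_fun setT g ->
    (forall x, 0 <= g x)%E -> (forall x, g x = (h x)%:E) ->
    (\int[esd M]_x g x = (avg (eigvals M) h)%:E)%E.
  move=> mg g0 gh; rewrite /esd ge0_integral_mscale//= ge0_integral_measure_sum//.
  rewrite /avg size_eigvals// EFinM; congr (_ * _)%E.
  rewrite (big_nth 0) big_mkord size_eigvals// -sumEFin; apply: eq_bigr => i _.
  by rewrite integral_dirac// diracT mul1e gh.
rewrite /Rintegral integralE.
rewrite (pos _ (fun x => Num.max (f x) 0))//; last 2 first.
- exact/measurable_funepos/measurable_EFinP.
- by move=> x; rewrite funeposE EFin_max.
rewrite (pos _ (fun x => Num.max (- f x) 0))//; last 2 first.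
- exact/measurable_funeneg/measurable_EFinP.
- by move=> x; rewrite funenegE EFin_max.
rewrite -EFinB /= -mulN1r -avgZ -avgD; congr avg; apply/funext => x.
by rewrite mulN1r; case: (leP (f x) 0) => f0; case: (leP (- f x) 0) => f1; lra.
Qed.

End esd_integral.

Section cutoff.
Variable R : realType.

Definition cutoff (M x : R) : R := Num.max 0 (Num.min 1 (M + 1 - `|x|)).

Lemma cutoff_ge0 M x : 0 <= cutoff M x. Proof. by rewrite le_max lexx. Qed.

Lemma cutoff_le1 M x : cutoff M x <= 1.
Proof. by rewrite ge_max ler01 ge_min lexx. Qed.

Lemma cutoff_out M x : M + 1 < `|x| -> cutoff M x = 0.
Proof.
move=> Mx; rewrite /cutoff max_l// ge_min; apply/orP; right.
by rewrite subr_le0 ltW.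
Qed.

Lemma cutoff_in M x : `|x| <= M -> cutoff M x = 1.
Proof.
by move=> xM; rewrite /cutoff min_l ?max_r// -addrA addrCA lerDl subr_ge0.
Qed.

Lemma cutoff_continuous M : continuous (cutoff M).
Proof.
move=> x; apply: (@continuous_max _ _ (fun=> 0) (fun x => Num.min 1 (M + 1 - `|x|))).
  exact: cvg_cst.
apply: (@continuous_min _ _ (fun=> 1) (fun x => M + 1 - `|x|)); first exact: cvg_cst.
by apply: cvgB; [exact: cvg_cst|exact: norm_continuous].
Qed.

Lemma bmeas_cutoff M : bmeas (cutoff M).
Proof.
split; first by apply: continuous_measurableR; exact: cutoff_continuous.
by exists 1 => x; rewrite ger0_norm ?cutoff_ge0 ?cutoff_le1.
Qed.

End cutoff.

Lemma bmeas_kavg (disp : measure_display) (T : measurableType disp) (R : realType)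
    (s : T -> seq R) (z F : R[i]) : 0 < Im z -> cmeas (fun w => kavg (s w) z) ->
  bmeas (fun w => normc (kavg (s w) z - F)).
Proof.
move=> Imz mk; have ku := kernel_unif Imz; split.
  by apply: measurable_normc; apply: cmeasB => //; exact: cmeas_cst.
exists (2 * (Im z)^-1 + normc F) => w; rewrite ger0_norm ?normc_ge0//.
rewrite (le_trans (le_normcD _ _))// normcN lerD2r (le_trans (normc_le_ReIm _))//.
rewrite mulr2n mulrDl !mul1r; apply: lerD; apply: avg_norm_le; rewrite ?invr_ge0 ?(ltW Imz)//.
  exact: (ku _ (or_introl erefl)).2.
exact: (ku _ (or_intror erefl)).2.
Qed.

(** [a] and [n] are the sample and limit means of [f], [a'] and [n'] those of its cutoff, [A] and
    [C] are [B] times the means of the cutoff function. Splitting [B - A] into [B - C] and [C - A]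
    bounds the mass escaping from the sample by that of the limit, so no separate tightness of the
    samples is required. *)
Lemma cutoff_split (R : realDomainType) (a a' n n' B A C q D : R) :
  `|a - a'| <= B - A -> `|n - n'| <= B - C -> B - C <= q -> C - A <= D ->
  `|a - n| <= (`|a' - n'| + D) + 2 * q.
Proof.
move=> h1 h2 h3 h4; have -> : a - n = (a - a') + (a' - n') - (n - n') by ring.
have := ler_normB ((a - a') + (a' - n')) (n - n'); have := ler_normD (a - a') (a' - n').
by move: h1 h2; set y1 := `|_ - _|; set y2 := `|_|; set y3 := `|_|; set y4 := `|_|; set y5 := `|_|; lra.
Qed.

Section weak_convergence.
Variables (R : realType) (disp : nat -> measure_display) (T : forall r, measurableType (disp r)).
Variables (P : forall r, probability (T r) R) (s : forall r, T r -> seq R).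
Variables (N : probability R R) (a0 : R).
Hypothesis a0_gt0 : 0 < a0.
Hypothesis s_gt0 : forall r w, (0 < r)%N -> (0 < size (@s r w))%N.
Hypothesis kavg_meas : forall r z, 0 < Im z -> cmeas (fun w => kavg (@s r w) z).
Hypothesis kavg_cvg : forall z, a0 <= Im z ->
  Ex (P r) (fun w => normc (kavg (@s r w) z - stieltjes N z)) @[r --> \oo] --> (0 : R).

(** Convergence in mean, unlike convergence in probability, is handled by linear estimates and
    passes to uniform limits, as the function class argument demands. Measurability of the averages
    belongs to the class because it is initially known for resolvent traces only. *)
Definition avg_cvg (f : R -> R) :=
  [/\ bmeas f, forall r, bmeas (fun w => avg (@s r w) f) &
    Ex (P r) (fun w => `|avg (@s r w) f - Ex N f|) @[r --> \oo] --> (0 : R)].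

Let bd r f : bmeas (fun w => avg (@s r w) f) -> bmeas (fun w => `|avg (@s r w) f - Ex N f|).
Proof. by move=> b; apply: bmeas_norm; apply: bmeasB => //; exact: bmeas_cst. Qed.

Let cvg0_squeeze (u v : nat -> R) : (forall r, 0 <= u r <= v r) ->
  v r @[r --> \oo] --> (0 : R) -> u r @[r --> \oo] --> (0 : R).
Proof.
move=> uv; apply: squeeze_cvgr; last exact: cvg_cst.
by near=> r; exact: uv.
Unshelve. all: by end_near. Qed.

Let avg_cvgD f g : avg_cvg f -> avg_cvg g -> avg_cvg (fun x => f x + g x).
Proof.
move=> [bf mf cf] [bg mg cg]; split; first exact: bmeasD.
  by move=> r; under eq_fun do rewrite avgD; exact: bmeasD.
have C : Ex (P r) (fun w => `|avg (@s r w) f - Ex N f|) +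
    Ex (P r) (fun w => `|avg (@s r w) g - Ex N g|) @[r --> \oo] --> (0 : R).
  by have H := cvgD cf cg; rewrite addr0 in H; exact: H.
apply: cvg0_squeeze C => r.
rewrite Ex_ge0//= -[X in _ <= X]ExD; [|exact: bd|exact: bd].
have bfg : bmeas (fun w => avg (@s r w) (fun x => f x + g x)).
  by under eq_fun do rewrite avgD; exact: bmeasD.
apply: Ex_le => [||w]; [exact: bd|by apply: bmeasD; exact: bd|].
rewrite avgD ExD// opprD addrACA; exact: ler_normD.
Qed.

Let avg_cvgZ (a : R) f : avg_cvg f -> avg_cvg (fun x => a * f x).
Proof.
move=> [bf mf cf]; split; first exact: bmeasZ.
  by move=> r; under eq_fun do rewrite avgZ; exact: bmeasZ.
have C : `|a| * Ex (P r) (fun w => `|avg (@s r w) f - Ex N f|) @[r --> \oo] --> (0 : R).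
  by rewrite -(mulr0 `|a|); exact: cvgMr.
apply: cvg0_squeeze C => r.
rewrite Ex_ge0//= -[X in _ <= X]ExZ; last exact: bd.
have bfa : bmeas (fun w => avg (@s r w) (fun x => a * f x)).
  by under eq_fun do rewrite avgZ; exact: bmeasZ.
apply: Ex_le => [||w]; [exact: bd|by apply: bmeasZ; exact: bd|].
by rewrite avgZ ExZ// -mulrBr normrM.
Qed.

Let avg_cvg_lim f :
  (forall eps : R, 0 < eps -> exists2 g, avg_cvg g & forall x, `|f x - g x| <= eps) -> avg_cvg f.
Proof.
move=> Hf.
have pick_ k : exists g, avg_cvg g /\ forall x, `|f x - g x| <= k.+1%:R^-1.
  by have [|g] := Hf k.+1%:R^-1; [rewrite invr_gt0|exists g].
pose g k := sval (cid (pick_ k)).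
have gP k : avg_cvg (g k) /\ forall x, `|f x - g k x| <= k.+1%:R^-1.
  by rewrite /g; case: cid.
have avg_close t k : `|avg t f - avg t (g k)| <= k.+1%:R^-1.
  rewrite -mulN1r -avgZ -avgD; apply: avg_norm_le => [|x]; first by rewrite invr_ge0.
  by rewrite mulN1r; exact: (gP k).2.
have inv_cvg (h : R) (u : nat -> R) : (forall k, `|h - u k| <= k.+1%:R^-1) -> u k @[k --> \oo] --> h.
  move=> hu; apply/cvgrPdist_le => e e0.
  near=> k; apply: le_trans (hu k) _; near: k.
  by near=> k; rewrite ltW//; near: k; exact: near_infty_natSinv_lt (PosNum e0).
have bf : bmeas f.
  have [[_ [C HC]] _ _] := (gP 0%N).1; split.
    apply: (measurable_fun_cvg (h := g)) => [k|x _]; first by have [[[]]] := gP k.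
    by apply: inv_cvg => k; exact: (gP k).2.
  exists (1 + C) => x; rewrite -[f x](subrK (g 0%N x)) (le_trans (ler_normD _ _))// lerD//.
  by rewrite (le_trans ((gP 0%N).2 x))// invr1.
have mf r : bmeas (fun w => avg (@s r w) f).
  split.
    apply: (measurable_fun_cvg (h := fun k w => avg (@s r w) (g k))) => [k|w _].
      by have [[_ /(_ r)[]]] := gP k.
    by apply: inv_cvg => k; exact: avg_close.
  have [_ [C HC]] := bf; exists `|C| => w; apply: avg_norm_le => // x.
  by rewrite (le_trans (HC x))// ler_norm.
split => //; apply/cvgr0Pnorm_le => e e0.
have [|h [bh mh ch] fh] := Hf (e / 3); first by rewrite divr_gt0.
have e3 : 0 < e / 3 by rewrite divr_gt0.
have /cvgr0Pnorm_le /(_ _ e3) := ch; apply: filterS => r.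
rewrite !ger0_norm ?Ex_ge0// => hr.
apply: (@le_trans _ _ (Ex (P r) (fun w => `|avg (@s r w) h - Ex N h| + 2 * (e / 3)))).
  have b2 : bmeas (fun w : T r => `|avg (@s r w) h - Ex N h| + 2 * (e / 3)).
    by apply: bmeasD; [exact: bd|exact: bmeas_cst].
  apply: Ex_le => // [|w]; first exact: bd.
  have -> : avg (s w) f - Ex N f = (avg (s w) f - avg (s w) h) + (avg (s w) h - Ex N h)
      - (Ex N f - Ex N h) by ring.
  have hA : `|avg (s w) f - avg (s w) h| <= e / 3.
    rewrite -mulN1r -avgZ -avgD.
    by apply: avg_norm_le => [|x]; [exact: ltW|rewrite mulN1r].
  have hC : `|Ex N f - Ex N h| <= e / 3.
    rewrite -ExB// (le_trans (Ex_norm_le _ _))//; first exact: bmeasB.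
    rewrite -[leRHS](Ex_cst N); apply: Ex_le => //; last exact: bmeas_cst.
    by apply: bmeas_norm; exact: bmeasB.
  apply: le_trans (ler_normB _ _) _; apply: le_trans (lerD (ler_normD _ _) hC) _.
  move: hA; set q1 := `|_|; set q2 := `|_|; set q3 := e / 3; lra.
rewrite ExD; [|exact: bd|exact: bmeas_cst].
by rewrite Ex_cst; move: hr; set q := Ex _ _; lra.
Unshelve. all: by end_near. Qed.

Let avg_cvg_kernel z : a0 <= Im z ->
  avg_cvg (fun x => Re (stieltjes_kernel z x)) /\ avg_cvg (fun x => Im (stieltjes_kernel z x)).
Proof.
move=> z0; have Imz := lt_le_trans a0_gt0 z0.
have [b1 b2] := cbounded_bmeas (cbounded_kernel Imz).
have ku := kernel_unif Imz.
have bk r := bmeas_kavg (stieltjes N z) Imz (kavg_meas r Imz).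
have H (g : R -> R) : bmeas g ->
    (forall x, `|g x| <= (Im z)^-1) ->
    (forall r, measurable_fun setT (fun w => avg (@s r w) g)) ->
    (forall t, `|avg t g - Ex N g| <= normc (kavg t z - stieltjes N z)) -> avg_cvg g.
  move=> bg gB mg gk.
  have mg' r : bmeas (fun w => avg (@s r w) g).
    split => //; exists (Im z)^-1 => w; apply: avg_norm_le => //.
    by rewrite invr_ge0 ltW.
  split => //; have := kavg_cvg z0; apply: cvg0_squeeze => r.
  by rewrite Ex_ge0//=; apply: Ex_le => [||w]; [exact: bd|exact: bk|exact: gk].
split.
  apply: H => //; first exact: (ku _ (or_introl erefl)).2.
    by move=> r; exact: (kavg_meas r Imz).1.
  by move=> t; apply: le_trans (Re_le_normc _); rewrite ReB.
apply: H => //; first exact: (ku _ (or_intror erefl)).2.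
  by move=> r; exact: (kavg_meas r Imz).2.
by move=> t; apply: le_trans (Im_le_normc _); rewrite ImB.
Qed.

(* A Riemann sum of Poisson kernels approximates [g] uniformly. *)
Let avg_cvg_support (g : R -> R) (M B : R) : 0 < M -> continuous g ->
  (forall x, M < `|x| -> g x = 0) -> (forall x, `|g x| <= B) -> avg_cvg g.
Proof.
move=> M0 cg gM gB; apply: (class_compact_support avg_cvgD avg_cvgZ avg_cvg_lim _ M0 cg gM gB).
move=> eta t eta0.
have [_] := class_kernel a0_gt0 avg_cvgD avg_cvgZ avg_cvg_lim avg_cvg_kernel
  (w := (t +i* eta)%C) eta0.
by congr avg_cvg; apply/funext => x; exact: Im_kernel_poisson.
Qed.

Let cutoff_mass (eps : R) : 0 < eps -> exists2 M : R, 0 < M & 1 - eps <= Ex N (cutoff M).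
Proof.
move=> eps0.
pose I n : set R := `[- n%:R, n%:R]%classic.
have mI n : measurable (I n) by exact: measurable_itv.
have cI : N (I n) @[n --> \oo] --> N (\bigcup_n I n).
  apply: nondecreasing_cvg_mu => //; first by apply: bigcup_measurable => n _; exact: mI.
  by move=> m n mn; apply/subsetPset/subset_itv; rewrite leBSide/= ?lerN2 ler_nat.
have IT : \bigcup_n I n = setT.
  apply/seteqP; split => // x _; exists (Num.bound `|x|) => //.
  by rewrite /I /= in_itv /= -ler_norml ltW// archi_boundP.
rewrite IT probability_setT in cI.
have fI : fine (N (I n)) @[n --> \oo] --> (1 : R) by exact: fine_cvg.
move/cvgrPdist_le : fI => /(_ _ eps0)[n0 _ /(_ n0.+1 (leqnSn _))] /=.
have Ile : fine (N (I n0.+1)) <= Ex N (cutoff n0.+1%:R).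
  rewrite -Ex_indic//; apply: Ex_le => [||x].
  - split; first exact: measurable_indic.
    by exists 1 => x; rewrite indicE normr_nat lern1 leq_b1.
  - exact: bmeas_cutoff.
  - rewrite indicE; have [|_] := boolP (x \in I n0.+1); last exact: cutoff_ge0.
    by rewrite inE /I /= in_itv /= -ler_norml => /cutoff_in ->.
rewrite ler_norml => /andP[_ h]; exists n0.+1%:R; first by rewrite ltr0n.
by rewrite (le_trans _ Ile)// lerBlDr addrC -lerBlDr.
Qed.

Lemma avg_cvg_continuous (f : R -> R) (B : R) : continuous f -> (forall x, `|f x| <= B) ->
  avg_cvg f.
Proof.
move=> cf fB; have B0 : 0 <= B by rewrite (le_trans _ (fB 0)).
have cut M : 0 < M -> avg_cvg (fun x => f x * cutoff M x).
  move=> M0; apply: (@avg_cvg_support _ (M + 1) B) => [|x|x Mx|x].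
  - by rewrite addr_gt0.
  - by apply: cvgM; [exact: cf|exact: cutoff_continuous].
  - by rewrite cutoff_out ?mulr0.
  - by rewrite normrM -[B]mulr1 ler_pM// ger0_norm ?cutoff_ge0 ?cutoff_le1.
have cut1 M : 0 < M -> avg_cvg (cutoff M).
  move=> M0; apply: (@avg_cvg_support _ (M + 1) 1) => [|x|x Mx|x].
  - by rewrite addr_gt0.
  - exact: cutoff_continuous.
  - by rewrite cutoff_out.
  - by rewrite ger0_norm ?cutoff_ge0 ?cutoff_le1.
have bf : bmeas f by split; [exact: continuous_measurableR|exists B].
have mf r : bmeas (fun w => avg (@s r w) f).
  split; last by exists B => w; exact: avg_norm_le.
  apply: (measurable_fun_cvg (h := fun k w => avg (@s r w) (fun x => f x * cutoff k.+1%:R x))).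
    by move=> k; have [_ /(_ r)[]] := cut k.+1%:R (ltr0Sn _ _).
  move=> w _; apply: cvg_near_cst.
  (* A fixed list of eigenvalues is bounded, so its averages of [f * cutoff] eventually equal that
     of [f], which makes the latter a pointwise limit of measurable functions. *)
  have [K HK] : exists K : nat, forall x, x \in s w -> `|x| <= K%:R.
    elim: (s w) => [|x l [K HK]]; first by exists 0%N.
    exists (maxn K (Num.bound `|x|)) => y; rewrite inE natr_max le_max => /predU1P[->|/HK ->//].
    by apply/orP; right; rewrite ltW// archi_boundP.
  exists K => // k /= Kk; rewrite /avg; congr (_ * _); apply: eq_big_seq => x /HK xK.
  by rewrite cutoff_in ?mulr1// (le_trans xK)// ler_nat (leq_trans Kk).
split => //; apply/cvgr0Pnorm_le => e e0.
pose e' := e / (4 * (B + 1)).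
have e'0 : 0 < e' by rewrite divr_gt0// mulr_gt0// ltr_wpDl.
have [M M0 HM] := cutoff_mass e'0.
have [_ m1 c1] := cut M M0; have [bc m2 c2] := cut1 M M0.
have e4 : 0 < e / 4 by rewrite divr_gt0.
have BE : B * e' <= e / 4.
  have K0 : 0 < 4 * (B + 1) by rewrite mulr_gt0// ltr_wpDl.
  by rewrite /e' mulrA ler_pdivrMr// (_ : e / 4 * (4 * (B + 1)) = B * e + e);
    [rewrite lerDl ltW|field].
have C2 : B * Ex (P r) (fun w => `|avg (@s r w) (cutoff M) - Ex N (cutoff M)|) @[r --> \oo] --> (0 : R).
  by rewrite -(mulr0 B); exact: cvgMr.
have /cvgr0Pnorm_le /(_ _ e4) n1 := c1; have /cvgr0Pnorm_le /(_ _ e4) n2 := C2.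
near=> r; rewrite ger0_norm ?Ex_ge0//.
have r0 : (0 < r)%N by near: r; exists 1%N.
have h1 : `|Ex (P r) (fun w => `|avg (@s r w) (fun x => f x * cutoff M x)
    - Ex N (fun x => f x * cutoff M x)|)| <= e / 4 by near: r.
have h2 : `|B * Ex (P r) (fun w => `|avg (@s r w) (cutoff M) - Ex N (cutoff M)|)| <= e / 4.
  by near: r.
rewrite ger0_norm ?Ex_ge0// in h1; rewrite ger0_norm ?mulr_ge0 ?Ex_ge0// in h2.
have b1 := bd (m1 r); have b2 := bmeasZ B (bd (m2 r)).
have b3 : bmeas (fun w : T r => 2 * (e / 4)) by exact: bmeas_cst.
have bfc : bmeas (fun x => f x * cutoff M x) by apply: bmeasM => //; exact: bmeas_cutoff.
have gap x : `|f x - f x * cutoff M x| <= B + - B * cutoff M x.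
  have -> : f x - f x * cutoff M x = f x * (1 - cutoff M x) by ring.
  have -> : B + - B * cutoff M x = B * (1 - cutoff M x) by ring.
  rewrite normrM ler_pM//.
  by rewrite ger0_norm// subr_ge0 cutoff_le1.
have gapN : `|Ex N f - Ex N (fun x => f x * cutoff M x)| <= B - B * Ex N (cutoff M).
  rewrite -ExB// (le_trans (Ex_norm_le _ _))//; first exact: bmeasB.
  apply: (@le_trans _ _ (Ex N (fun x => B + - B * cutoff M x))).
    apply: Ex_le => //; first by apply: bmeas_norm; exact: bmeasB.
    by apply: bmeasD; [exact: bmeas_cst|exact: bmeasZ].
  by rewrite ExD; [rewrite Ex_cst ExZ// mulNr|exact: bmeas_cst|exact: bmeasZ].
have gapA w : `|avg (@s r w) f - avg (@s r w) (fun x => f x * cutoff M x)| <=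
    B - B * avg (s w) (cutoff M).
  have -> : B - B * avg (s w) (cutoff M) = avg (s w) (fun x => B * 1 + - B * cutoff M x).
    by rewrite avgD !avgZ avg1 ?mulr1 ?mulNr//; exact: s_gt0.
  have -> : avg (s w) f - avg (s w) (fun x => f x * cutoff M x) =
      avg (s w) (fun x => f x + (-1) * (f x * cutoff M x)) by rewrite avgD avgZ mulN1r.
  rewrite ler_norml; apply/andP; split.
    rewrite -[leLHS]mulN1r -avgZ; apply: avg_le => x.
    by have := gap x; rewrite ler_norml !mulN1r mulr1 mulNr => /andP[].
  by apply: avg_le => x; have := gap x; rewrite ler_norml mulN1r mulr1 => /andP[_].
have NB : B - B * Ex N (cutoff M) <= e / 4.
  apply: le_trans BE; rewrite [leLHS](_ : _ = B * (1 - Ex N (cutoff M))); last by ring.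
  by rewrite ler_wpM2l// lerBlDl -lerBlDr.
apply: (@le_trans _ _ (Ex (P r) (fun w => (`|avg (@s r w) (fun x => f x * cutoff M x)
    - Ex N (fun x => f x * cutoff M x)| +
    B * `|avg (@s r w) (cutoff M) - Ex N (cutoff M)|) + 2 * (e / 4)))).
  apply: Ex_le => [||w]; first exact: bd.
    by apply: bmeasD => //; exact: bmeasD.
  have gA := gapA w; have gN := gapN; have gB := NB.
  have gC : B * (Ex N (cutoff M) - avg (s w) (cutoff M)) <=
      B * `|avg (s w) (cutoff M) - Ex N (cutoff M)|.
    by rewrite ler_wpM2l// distrC ler_norm.
  by rewrite mulrBr in gC; exact: (cutoff_split gA gN gB gC).
rewrite ExD//; last exact: bmeasD.
rewrite ExD// ExZ; last exact: bd.
by rewrite Ex_cst; move: h1 h2; move: (Ex _ _) (B * Ex _ _) => q1 q2; lra.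
Unshelve. all: by end_near. Qed.

Lemma cvg_in_probability_of_kavg (mu : forall r, T r -> {measure set R -> \bar R}) :
  (forall r w (f : R -> R), continuous f -> Rintegral (@mu r w) setT f = avg (s w) f) ->
  cvg_in_probability_weakly P mu N.
Proof.
move=> muE m f eps cf fB eps0.
have fA j : avg_cvg (f j) by have [B fjB] := fB j; exact: avg_cvg_continuous fjB.
(* Markov's inequality is applied once, to the sum over the finitely many test functions. *)
pose X r w := \sum_(j < m) `|avg (@s r w) (f j) - Ex N (f j)|.
have bX r : bmeas (X r).
  by apply: bmeas_sum => j _; apply: bd; have [_ + _] := fA j; apply.
have EX : Ex (P r) (X r) / eps @[r --> \oo] --> (0 : R).
  rewrite -(mul0r eps^-1); apply: cvgMl.
  have -> : (fun r => Ex (P r) (X r)) = (fun r =>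
      \sum_(j < m) Ex (P r) (fun w => `|avg (@s r w) (f j) - Ex N (f j)|)).
    by apply/funext => r; apply: Ex_sum => j _; apply: bd; have [_ + _] := fA j; apply.
  by apply: cvg_sum0 => j _; have [] := fA j.
pose E r := [set w | ~ weak_nbhd N f eps (@mu r w)].
have EE r : E r = \bigcup_(j in [set: 'I_m]) [set w | eps <= `|avg (@s r w) (f j) - Ex N (f j)|].
  apply/seteqP; split => w /=.
    move=> /existsNP[j /negP]; rewrite -leNgt muE// => jE; exists j => //.
  by move=> [j _ /= jE] /(_ j); rewrite muE// ltNge jE.
have mE r : measurable (E r).
  rewrite EE; apply: fin_bigcup_measurable => // j _.
  rewrite -[X in measurable X]setTI; apply: (measurable_fun_le (f := fun=> eps)) => //.
  by have [_ /(_ r) bj _] := fA j; exact: (bd bj).1.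
have mX r : measurable [set w | eps <= X r w].
  rewrite -[X in measurable X]setTI; apply: (measurable_fun_le (f := fun=> eps)) => //.
  exact: (bX r).1.
have PE r : (0 <= P r (E r) <= (Ex (P r) (X r) / eps)%:E)%E.
  rewrite measure_ge0 /=; apply: (@le_trans _ _ (P r [set w | eps <= X r w])).
    apply: le_measure; rewrite ?inE// => w; rewrite EE => -[j _ /= jE].
    rewrite (le_trans jE)// /X (bigD1 j)//= lerDl; exact: sumr_ge0.
  rewrite -[P r _]fineK ?fin_num_measure// lee_fin.
  by apply: markov_bmeas => // w; exact: sumr_ge0.
apply: (squeeze_cvge (f := fun=> 0%E) (h := fun r => (Ex (P r) (X r) / eps)%:E)).
- by near=> r; exact: PE.
- exact: cvg_cst.
- by apply: cvg_EFin => //; near=> r.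
Unshelve. all: by end_near. Qed.

End weak_convergence.

Theorem theorem1p5 (R : realType)
    (disp : nat -> measure_display) (T : forall r, measurableType (disp r))
    (P : forall r, probability (T r) R)
    (d : nat -> nat) (p : nat -> R) (c C0 : R)
    (xi : forall r, 'I_r -> 'I_r -> T r -> R)
    (v : forall r, 'I_r -> 'I_r -> T r -> 'cV[R]_(d r))
    (d_gt0 : forall r, (0 < d r)%N)
    (p_range : forall r, 0 < p r <= 1)
    (C0_gt0 : 0 < C0)
    (c_ge0 : 0 <= c)
    (xi_meas : forall r (k l : 'I_r), (k < l)%N ->
      measurable_fun setT (xi r k l))
    (xi_law : forall r (k l : 'I_r), (k < l)%N ->
      P r [set w | xi r k l w = 1] = (p r)%:E /\
      P r [set w | xi r k l w = 0] = (1 - p r)%:E)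
    (xi_indep : forall r,
      mutually_independent (P r) [set kl : 'I_r * 'I_r | (kl.1 < kl.2)%N]%SET
        (fun kl => sigma_gen [set: unit] (fun=> xi r kl.1 kl.2)))
    (v_meas : forall r (k l : 'I_r), (k < l)%N -> forall i : 'I_(d r),
      measurable_fun setT (fun w => v r k l w i ord0))
    (v_indep : forall r,
      mutually_independent (P r) [set kl : 'I_r * 'I_r | (kl.1 < kl.2)%N]%SET
        (fun kl => sigma_gen [set: 'I_(d r)]
                     (fun i w => v r kl.1 kl.2 w i ord0)))
    (v_xi_indep : forall r,
      independent2 (P r)
        (sigma_gen [set kli : ('I_r * 'I_r) * 'I_(d r) |
                      (kli.1.1 < kli.1.2)%N]
           (fun kli w => v r kli.1.1 kli.1.2 w kli.2 ord0))
        (sigma_gen [set kl : 'I_r * 'I_r | (kl.1 < kl.2)%N]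
           (fun kl => xi r kl.1 kl.2)))
    (v_isotropic : forall r (k l : 'I_r), (k < l)%N ->
      forall i j : 'I_(d r),
        expectation (P r) (fun w => (v r k l w *m (v r k l w)^T) i j) =
          ((((d r)%:R^-1)%:M : 'M[R]_(d r)) i j)%:E)
    (v_bounded : forall r (k l : 'I_r), (k < l)%N ->
      {ae P r, forall w, norm2 (v r k l w) ^+ 2 <= C0})
    (v_var : forall D : (forall n, 'M[R]_n),
      (forall n, (0 < n)%N -> opnorm (D n) = 1) ->
      ereal_sup
        [set variance (P r) (fun w =>
               dotv (D (d r) *m v r kl.1 kl.2 w) (v r kl.1 kl.2 w))
          | kl in [set kl : 'I_r * 'I_r | (kl.1 < kl.2)%N]]
        @[r --> \oo] --> (0 : \bar R))
    (d_oo : d r @[r --> \oo] --> \oo)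
    (rp_d : r%:R * p r / (d r)%:R @[r --> \oo] --> c) :
  exists N : probability R R,
    [/\ cvg_in_probability_weakly P
          (fun r w => esd (Amx (fun k l => xi r k l w)
                               (fun k l => v r k l w))) N,
        satisfies_cubic c (stieltjes N)
      & forall mu : {measure set R -> \bar R},
          has_stieltjes mu -> satisfies_cubic c (stieltjes mu) ->
          forall z : R[i], complex.Im z != 0 ->
            stieltjes mu z = stieltjes N z].
Proof.
pose s r (w : T r) := eigvals (Amx (fun k l => xi r k l w) (fun k l => v r k l w)).
(* [8] yields the small root, [C0] brings all quadratic forms below [1], and [28 * (c + 1)] makes
   the row equation a contraction. *)
pose eta0 := Num.max (Num.max 8 C0) (28 * (c + 1)).
have eta8 : 8 <= eta0 by rewrite !le_max lexx.
have etaC : C0 <= eta0 by rewrite !le_max lexx orbT.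
have etac : 28 * (c + 1) <= eta0 by rewrite le_max lexx orbT.
have eta_gt0 : 0 < eta0 by rewrite (lt_le_trans _ eta8).
have sz r w : size (s r w) = (\sum_(k < r) d r)%N by apply: size_eigvals; exact: Amx_sym.
have s_gt0 r w : (0 < r)%N -> (0 < size (s r w))%N.
  by move=> r0; rewrite sz sum_nat_const card_ord muln_gt0 r0 d_gt0.
have sE r z : 0 < Im z -> (fun w => kavg (s r w) z) = avg_trace (xi r) (v r) z.
  move=> Imz; apply/funext => w; rewrite kavgE sz /avg_trace trace_resolvent//.
  exact: Amx_sym.
have kmeas r z : 0 < Im z -> cmeas (fun w => kavg (s r w) z).
  by move=> Imz; rewrite sE//; apply: cmeas_avg_trace => // k l kl; [exact: xi_meas|exact: v_meas].
have kcvg z F : eta0 <= Im z -> normc F <= 2^-1 -> cubic c z F = 0 ->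
    Ex (P r) (fun w => normc (kavg (s r w) z - F)) @[r --> \oo] --> (0 : R).
  move=> z0 F2 F0.
  have -> : (fun r => Ex (P r) (fun w => normc (kavg (s r w) z - F))) =
      (fun r => Ex (P r) (fun w => normc (avg_trace (xi r) (v r) z w - F))).
    by apply/funext => r; rewrite -(sE r z)// (lt_le_trans eta_gt0).
  apply: (local_law d_gt0 p_range C0_gt0 c_ge0 xi_meas xi_law xi_indep v_meas v_indep
    v_xi_indep v_isotropic v_bounded v_var d_oo rp_d) => //.
  - exact: le_trans z0.
  - exact: le_trans z0.
  - exact: le_trans z0.
have [N HN] : exists N : probability R R,
    forall z F, eta0 <= Im z -> normc F <= 2^-1 -> cubic c z F = 0 -> stieltjes N z = F.
  apply: (empirical_limit c_ge0 eta8 s_gt0 (P := P)) => [r z F Imz|[z F] [/=]].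
    exact: bmeas_kavg (kmeas r z Imz).
  exact: kcvg.
(* Existence of a small root combines with [HN], which identifies any such root with the transform,
   to give the cubic above height [eta0]; continuation takes it from there. *)
have root z : eta0 <= Im z -> normc (stieltjes N z) <= 2^-1 /\ cubic c z (stieltjes N z) = 0.
  move=> z0; have [F [F2 F0]] := small_root c (le_trans eta8 z0).
  by rewrite (HN z F z0 F2 F0).
have hN := has_stieltjes_prob N.
have cN : satisfies_cubic c (stieltjes N).
  apply: cubic_all_of_upper => // z; apply: (stieltjes_continuation c_ge0 (rho := eta0)).
    by rewrite (le_trans _ eta8)// ler_nat.
  by move=> w /root[].
exists N; split => //; last by move=> mu hmu cmu; exact: stieltjes_unique hmu hN cmu cN.
apply: (cvg_in_probability_of_kavg eta_gt0 s_gt0 kmeas) => [z z0|r w f cf].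
  by have [F2 F0] := root z z0; exact: kcvg.
by apply: Rintegral_esd; [exact: Amx_sym|exact: continuous_measurableR].
Qed.
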